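(* Let $p_0,u_0,\rho_0>0$ be constants with $M_0>1$ and let $\theta_W\in(0,\pi/2)$ satisfy $\tan\theta_W\in(0,w_*]$. Let $(p,u,v,\rho)$ be a transonic shock solution to Problem B (uniform supersonic flow $(p_0,u_0,0,\rho_0)$ given on $\Sigma_0$, against a ramp of angle $\theta_W$) such that the flow behind the shock-front satisfies $u>0$, the asymptotic condition $$w\to\tan\theta_W\quad\text{as } (x,y)\to\infty \text{ (in } \mathcal D^+\cup\mathcal S),$$ and, at the vertex $O$ of the ramp (values taken from behind the shock-front), $$w=\tan\theta_W,\qquad p=p_{strong}.$$ Then the solution is the strong transonic shock solution $U_s$.
   Context: Fix $\gamma>1$. The steady full compressible Euler system for $(p,u,v,\rho)$ (pressure, velocity components, density; $p,\rho>0$) is $$\partial_x(\rho u)+\partial_y(\rho v)=0,\quad \partial_x(\rho u^2+p)+\partial_y(\rho uv)=0,\quad \partial_x(\rho uv)+\partial_y(\rho v^2+p)=0,\quad \tfrac12(u^2+v^2)+\tfrac{c^2}{\gamma-1}=b_0,$$ where $c=\sqrt{\gamma p/\rho}$ is the sonic speed and $b_0=\tfrac12u_0^2+\frac{\gamma p_0}{(\gamma-1)\rho_0}$ (the same on both sides of the shock-front). The Mach number is $M=\sqrt{u^2+v^2}/c$; the flow is supersonic if $M>1$, subsonic if $M<1$. Write $w=v/u$, $c_0=\sqrt{\gamma p_0/\rho_0}$, $M_0=u_0/c_0$. Problem B: $\mathcal D=\{(x,y):x>0,\ y>x\tan\theta_W\}$, $\Sigma_0=\{x=0,\ y\ge0\}$,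 $\Gamma=\{x>0,\ y=x\tan\theta_W\}$, $O=(0,0)$. Data: $(p,u,v,\rho)=(p_0,u_0,0,\rho_0)$ on $\Sigma_0$ and slip condition $w=\tan\theta_W$ on $\Gamma$. Transonic shock solution of Problem B: a function $f\in C^2((0,\infty))\cap C([0,\infty))$ with $f(0)=0$ and $0<f(y)<y\cot\theta_W$ for $y>0$; shock-front $\mathcal S=\{(f(y),y):y>0\}$ issuing from $O$; $\mathcal D^-=\{(x,y)\in\mathcal D:x<f(y)\}$, $\mathcal D^+=\{(x,y)\in\mathcal D:x>f(y)\}$; and functions $p,u,v,\rho\in L^\infty_{loc}$ which on each of $\mathcal D^-$, $\mathcal D^+$ are continuous up to the boundary (one-sided values on $\mathcal S$ and at $O$) and $C^1$ locally up to the boundary away from $O$, such that: the flow is supersonic in $\mathcal D^-$ and subsonic in $\mathcal D^+$ (including boundary values); the Euler system holds pointwise in $\mathcal D^-\cup\mathcal D^+$; the data on $\Sigma_0$ and $\Gamma$ are attained pointwise; and across $\mathcal S$ $$[\rho u]-f'(y)[\rho v]=0,\quad [\rho u^2+p]-f'(y)[\rho uv]=0,\quad [\rho uv]-f'(y)[\rho v^2+p]=0,\qquad [p]>0,$$ where $[q]$ is the value of $q$ on $\mathcal S$ from $\mathcal D^+$ minus that from $\mathcal D^-$. ''Behind the shock-front'' means in $\mathcal D^+$, including boundary values. Shock polar: for $p_0\le p\le p^+:=p_0\big(1+\frac{2\gamma}{\gamma+1}(M_0^2-1)\big)$ let $$h(p)=\frac{\frac p{p_0}-1}{\gamma M_0^2-(\frac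 p{p_0}-1)}\sqrt{\frac{\frac{2\gamma}{\gamma+1}(M_0^2-1)-(\frac p{p_0}-1)}{\frac p{p_0}+\frac{\gamma-1}{\gamma+1}}}.$$ The possible values of $(w,p)$ behind a shock with upstream state $(p_0,u_0,0,\rho_0)$ satisfy $w=\pm h(p)$. The function $h$ attains its maximum $w_*=h(p_* )$ at a unique $p_*\in(p_0,p^+)$, is strictly increasing on $[p_0,p_*]$ and strictly decreasing on $[p_*,p^+]$. For $\tan\theta_W\in(0,w_*]$, $p_{strong}$ is the unique $p\in[p_*,p^+)$ with $h(p)=\tan\theta_W$. Strong transonic shock solution $U_s$: the shock-front is the ray $x=y\cot\alpha$, $y>0$; the state is $(p_0,u_0,0,\rho_0)$ in $\mathcal D^-$, and in $\mathcal D^+$ it is the constant state with $p=p_{strong}$, $w=\tan\theta_W$, $v=uw$, where, with $p=p_{strong}$, $$u=u_0-\frac{p-p_0}{\rho_0u_0},\quad \rho=\rho_0\frac{(\gamma+1)p+(\gamma-1)p_0}{(\gamma-1)p+(\gamma+1)p_0},\quad \sin\alpha=\frac1{M_0}\sqrt{\frac{\gamma+1}{2\gamma}\Big(\frac p{p_0}+\frac{\gamma-1}{\gamma+1}\Big)},\ \ \alpha\in(0,\pi/2).$$ *)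

(* Defs.v *)
From Stdlib Require Import Reals Lra.
From Coquelicot Require Import Coquelicot.
Open Scope R_scope.

Record state := mkState { pres : R; velx : R; vely : R; dens : R }.

Definition sonic (gamma : R) (s : state) : R := sqrt (gamma * pres s / dens s).

Definition speed (s : state) : R := sqrt (velx s ^ 2 + vely s ^ 2).

Definition mach (gamma : R) (s : state) : R := speed s / sonic gamma s.

Definition slope (s : state) : R := vely s / velx s.

Definition bernoulli (gamma : R) (s : state) : R :=
  / 2 * (velx s ^ 2 + vely s ^ 2) + sonic gamma s ^ 2 / (gamma - 1).

Definition upstream (p0 u0 rho0 : R) : state := mkState p0 u0 0 rho0.

Definition mach0 (gamma p0 u0 rho0 : R) : R := u0 / sqrt (gamma * p0 / rho0).

Definition b0 (gamma p0 u0 rho0 : R) : R :=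
  / 2 * u0 ^ 2 + gamma * p0 / ((gamma - 1) * rho0).

Definition mass_x (s : state) : R := dens s * velx s.
Definition mass_y (s : state) : R := dens s * vely s.
Definition momx_x (s : state) : R := dens s * velx s ^ 2 + pres s.
Definition momx_y (s : state) : R := dens s * velx s * vely s.
Definition momy_x (s : state) : R := dens s * velx s * vely s.
Definition momy_y (s : state) : R := dens s * vely s ^ 2 + pres s.

Definition origin : R * R := (0, 0).

Definition closure (E : R * R -> Prop) (q : R * R) : Prop :=
  forall P : R * R -> Prop, locally q P -> exists q', P q' /\ E q'.

(** For [E] open: [C^1] up to the boundary away from the origin means that the
    partial derivatives on [E] extend continuously to the closure minus the
    origin; at the origin only [g] itself is continuous. *)
Definition regular_up_to_boundary (E : R * R -> Prop) (g : R * R -> R) : Prop :=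
  continuous_on (closure E) g /\
  exists gx gy : R * R -> R,
    (forall x y, E (x, y) ->
       is_derive (fun t => g (t, y)) x (gx (x, y)) /\
       is_derive (fun t => g (x, t)) y (gy (x, y))) /\
    continuous_on (fun q => closure E q /\ q <> origin) gx /\
    continuous_on (fun q => closure E q /\ q <> origin) gy.

Definition regular_flow (E : R * R -> Prop) (U : R * R -> state) : Prop :=
  regular_up_to_boundary E (fun q => pres (U q)) /\
  regular_up_to_boundary E (fun q => velx (U q)) /\
  regular_up_to_boundary E (fun q => vely (U q)) /\
  regular_up_to_boundary E (fun q => dens (U q)).

Definition euler_at (gamma b : R) (U : R * R -> state) (x y : R) : Prop :=
  Derive (fun t => mass_x (U (t, y))) x + Derive (fun t => mass_y (U (x, t))) y = 0 /\
  Derive (fun t => momx_x (U (t, y))) x + Derive (fun t => momx_y (U (x, t))) y = 0 /\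
  Derive (fun t => momy_x (U (t, y))) x + Derive (fun t => momy_y (U (x, t))) y = 0 /\
  bernoulli gamma (U (x, y)) = b.

Definition cot (a : R) : R := cos a / sin a.

Definition domain (thetaW : R) (q : R * R) : Prop :=
  0 < fst q /\ fst q * tan thetaW < snd q.

Definition entrance (q : R * R) : Prop := fst q = 0 /\ 0 <= snd q.

Definition ramp (thetaW : R) (q : R * R) : Prop :=
  0 < fst q /\ snd q = fst q * tan thetaW.

Definition shock (f : R -> R) (q : R * R) : Prop :=
  0 < snd q /\ fst q = f (snd q).

Definition ahead (thetaW : R) (f : R -> R) (q : R * R) : Prop :=
  domain thetaW q /\ fst q < f (snd q).

Definition behind (thetaW : R) (f : R -> R) (q : R * R) : Prop :=
  domain thetaW q /\ f (snd q) < fst q.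

(** [f] belongs to [C^2((0,oo))] and to [C([0,oo))]; all three orders are listed
    because [Derive_n] is total, so [ex_derive_n f 2] alone does not give
    [ex_derive f]. *)
Definition shock_profile (thetaW : R) (f : R -> R) : Prop :=
  (forall y, 0 < y ->
     (forall k, (k <= 2)%nat -> ex_derive_n f k y) /\
     continuous (Derive_n f 2) y) /\
  continuous_on (fun y => 0 <= y) f /\
  f 0 = 0 /\
  (forall y, 0 < y -> 0 < f y < y * cot thetaW).

Definition jump (g : state -> R) (sm sp : state) : R := g sp - g sm.

Definition rankine_hugoniot (slope_f : R) (sm sp : state) : Prop :=
  jump mass_x sm sp - slope_f * jump mass_y sm sp = 0 /\
  jump momx_x sm sp - slope_f * jump momx_y sm sp = 0 /\
  jump momy_x sm sp - slope_f * jump momy_y sm sp = 0 /\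
  0 < jump pres sm sp.

(** A discontinuous flow is given by its two one-sided continuous branches:
    [Um] on the closure of the region ahead of the shock-front and [Up] on the
    closure of the region behind it; [Um] and [Up] are irrelevant elsewhere.
    Local boundedness of the flow follows from continuity on these closed sets. *)
Record transonic_shock_solution (gamma p0 u0 rho0 thetaW : R)
    (f : R -> R) (Um Up : R * R -> state) : Prop := {
  tss_profile : shock_profile thetaW f;
  tss_regular_ahead : regular_flow (ahead thetaW f) Um;
  tss_regular_behind : regular_flow (behind thetaW f) Up;
  tss_pos_ahead : forall q, closure (ahead thetaW f) q ->
    0 < pres (Um q) /\ 0 < dens (Um q);
  tss_pos_behind : forall q, closure (behind thetaW f) q ->
    0 < pres (Up q) /\ 0 < dens (Up q);
  tss_supersonic : forall q, closure (ahead thetaW f) q -> 1 < mach gamma (Um q);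
  tss_subsonic : forall q, closure (behind thetaW f) q -> mach gamma (Up q) < 1;
  tss_euler_ahead : forall x y, ahead thetaW f (x, y) ->
    euler_at gamma (b0 gamma p0 u0 rho0) Um x y;
  tss_euler_behind : forall x y, behind thetaW f (x, y) ->
    euler_at gamma (b0 gamma p0 u0 rho0) Up x y;
  tss_entrance : forall q, entrance q -> Um q = upstream p0 u0 rho0;
  tss_slip : forall q, ramp thetaW q ->
    velx (Up q) <> 0 /\ slope (Up q) = tan thetaW;
  tss_shock : forall y, 0 < y ->
    rankine_hugoniot (Derive f y) (Um (f y, y)) (Up (f y, y))
}.

Definition p_plus (gamma p0 u0 rho0 : R) : R :=
  p0 * (1 + 2 * gamma / (gamma + 1) * (mach0 gamma p0 u0 rho0 ^ 2 - 1)).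

Definition polar (gamma p0 u0 rho0 p : R) : R :=
  let M0 := mach0 gamma p0 u0 rho0 in
  (p / p0 - 1) / (gamma * M0 ^ 2 - (p / p0 - 1)) *
  sqrt ((2 * gamma / (gamma + 1) * (M0 ^ 2 - 1) - (p / p0 - 1)) /
        (p / p0 + (gamma - 1) / (gamma + 1))).

(** The maximizer on [[p0, p_plus]] is unique, so this determines [pstar]. *)
Definition is_pstar (gamma p0 u0 rho0 pstar : R) : Prop :=
  p0 < pstar < p_plus gamma p0 u0 rho0 /\
  forall p, p0 <= p <= p_plus gamma p0 u0 rho0 ->
    polar gamma p0 u0 rho0 p <= polar gamma p0 u0 rho0 pstar.

Definition is_pstrong (gamma p0 u0 rho0 thetaW pstar pstrong : R) : Prop :=
  pstar <= pstrong < p_plus gamma p0 u0 rho0 /\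
  polar gamma p0 u0 rho0 pstrong = tan thetaW.

Definition strong_state (gamma p0 u0 rho0 thetaW p : R) : state :=
  let u := u0 - (p - p0) / (rho0 * u0) in
  mkState p u (u * tan thetaW)
    (rho0 * (((gamma + 1) * p + (gamma - 1) * p0) /
             ((gamma - 1) * p + (gamma + 1) * p0))).

Definition is_shock_angle (gamma p0 u0 rho0 p alpha : R) : Prop :=
  0 < alpha < PI / 2 /\
  sin alpha = / mach0 gamma p0 u0 rho0 *
    sqrt ((gamma + 1) / (2 * gamma) * (p / p0 + (gamma - 1) / (gamma + 1))).

Definition is_strong_solution (gamma p0 u0 rho0 thetaW pstrong : R)
    (f : R -> R) (Um Up : R * R -> state) : Prop :=
  (exists alpha, is_shock_angle gamma p0 u0 rho0 pstrong alpha /\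
     forall y, 0 <= y -> f y = y * cot alpha) /\
  (forall q, closure (ahead thetaW f) q -> Um q = upstream p0 u0 rho0) /\
  (forall q, closure (behind thetaW f) q ->
     Up q = strong_state gamma p0 u0 rho0 thetaW pstrong).

Definition slope_tends_at_infinity (E : R * R -> Prop) (U : R * R -> state) (l : R) : Prop :=
  forall eps, 0 < eps -> exists r, forall q, E q ->
    r < sqrt (fst q ^ 2 + snd q ^ 2) -> Rabs (slope (U q) - l) < eps.

(* Main.v *)
Require Import Defs.
From Stdlib Require Import Reals Lra Classical.
From Coquelicot Require Import Coquelicot.
Open Scope R_scope.

(** The flow ahead of the shock-front is uniform, and the flow behind it has
    constant direction; the jump conditions then leave only [U_s].

    Ahead.  For a suitable function of the entropy, the entropy flux minus its
    affine part at the uniform state [U0] is a divergence-free vector field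
    [(q1, q2)] which vanishes to second order at [U0]
    ([relative_flux_divergence_free]).  Its flux [q1 - s q2] through a curve of
    slope [s = dx/dy] is negative unless the state is [U0], as soon as the curve
    is crossed supersonically ([relative_flux_definite]).  Let [psi] be the
    stream function of [(q1, q2)] that vanishes on the entrance.  It decreases
    upwards along supersonically crossed curves.  Descending from a point to the
    vertex along a vertical line and the shock-front gives [psi <= 0]; ascending
    to the entrance along a steep line and the shock-front gives [psi >= 0].
    Hence [psi = 0] and the state is [U0] ([stream_vanishes]).  The curves are
    known to be crossed supersonically only near [U0], so the argument is run
    just beyond the first abscissa at which the flow might leave [U0]; on the
    shock-front itself, the condition [p > p_-] makes the normal Mach number of
    the incoming flow exceed one ([rankine_hugoniot_normal]).

    Behind.  Let [w = v / u].  The Euler system gives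
    [w_x p_y - w_y p_x <= 0], with equality only where both gradients vanish:
    this is ellipticity ([subsonic_jacobian]).  Hence for [phi = (w - c)_+^2] with
    [c > tan thetaW], Green's formula for the exact form [dp],
      integral of [phi dp] over the shock-front
        = minus the integral of [2 (w - c)_+ (w_x p_y - w_y p_x)] over the region,
    has a nonnegative right-hand side: [phi] vanishes near the ramp, the vertex
    and infinity.  On the shock-front, [w] and [p] are functions of [s = f'(y)]
    alone, so the left-hand side is an integral over the shock polar from the
    strong state at the vertex to the state at infinity, and it is not positive
    because [p] decreases with [s] ([polar_weight_above]).  So [w <= c].  With
    [(c - w)_+^2] and [0 < c < tan thetaW] the same integral vanishes, because
    [{w >= c}] is an arc of the polar ([polar_weight_below]); so [w >= c].  This
    is [slope_comparison].  Thus [w = tan thetaW], which forces [p] to be constant,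
    the shock-front to be straight, and [u] to be transported unchanged along the
    parallel streamlines issuing from it. *)

(** * Real functions of one variable *)

Ltac rmin_facts :=
  repeat match goal with
  | |- context [Rmin ?a ?b] =>
      lazymatch goal with H : Rmin a b <= a |- _ => fail | _ => idtac end;
      pose proof (Rmin_l a b); pose proof (Rmin_r a b)
  | _ : context [Rmin ?a ?b] |- _ =>
      lazymatch goal with H : Rmin a b <= a |- _ => fail | _ => idtac end;
      pose proof (Rmin_l a b); pose proof (Rmin_r a b)
  end.

(** The supremum [s] of the points up to which [P] holds satisfies [P] by the last
    hypothesis, and would be exceeded by the preceding one if [s < b]. *)
Lemma real_induction (P : R -> Prop) (a b : R) :
  a <= b -> P a ->
  (forall x, a <= x < b -> P x ->
     exists d, 0 < d /\ forall z, x < z < x + d -> z <= b -> P z) ->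
  (forall x, a < x <= b -> (forall z, a <= z < x -> P z) -> P x) ->
  P b.
Proof.
  intros Hab Ha Hright Hleft.
  set (E := fun x => a <= x <= b /\ forall z, a <= z <= x -> P z).
  assert (Ea : E a).
  { split; [lra|]. intros z Hz. replace z with a by lra. exact Ha. }
  destruct (completeness E) as [s [Hs1 Hs2]].
  { exists b. intros x [Hx _]. lra. }
  { exists a; exact Ea. }
  assert (Has : a <= s) by (apply Hs1, Ea).
  assert (Hsb : s <= b) by (apply Hs2; intros x [Hx _]; lra).
  assert (Hbelow : forall z, a <= z < s -> P z).
  { intros z Hz. destruct (classic (exists x, E x /\ z < x)) as [[x [[Hx1 Hx2] Hzx]]|Hn].
    - apply Hx2; lra.
    - exfalso. assert (s <= z); [|lra]. apply Hs2. intros x Hx.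
      destruct (Rle_or_lt x z) as [H|H]; [exact H|]. exfalso; apply Hn; now exists x. }
  assert (Ps : P s).
  { destruct (Req_dec a s) as [<-|Hne]; [exact Ha|]. apply Hleft; [lra|exact Hbelow]. }
  destruct (Req_dec s b) as [<-|Hne]; [exact Ps|].
  exfalso. destruct (Hright s) as [d [Hd Hz]]; [lra|exact Ps|].
  set (x := Rmin b (s + d / 2)).
  assert (Hxb : x <= b) by apply Rmin_l.
  assert (Hxd : x <= s + d / 2) by apply Rmin_r.
  assert (Hsx : s < x) by (unfold x; apply Rmin_glb_lt; lra).
  assert (Ex : E x).
  { split; [lra|]. intros z Hzz.
    destruct (Rlt_or_le z s) as [H|H]; [apply Hbelow; lra|].
    destruct (Req_dec z s) as [->|Hzs]; [exact Ps|]. apply Hz; lra. }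
  specialize (Hs1 x Ex). lra.
Qed.

(** Compactness of a segment: a radius that can be chosen locally, and may always be
    decreased, can be chosen uniformly. *)
Lemma uniform_radius (Q : R -> R -> Prop) (a b : R) :
  a <= b ->
  (forall y r r', 0 < r' <= r -> Q y r -> Q y r') ->
  (forall y0, a <= y0 <= b -> exists r, 0 < r /\ forall y, Rabs (y - y0) < r -> Q y r) ->
  exists r, 0 < r /\ forall y, a <= y <= b -> Q y r.
Proof.
  intros Hab Hmono Hloc.
  apply (real_induction (fun z => exists r, 0 < r /\ forall y, a <= y <= z -> Q y r) a b Hab).
  - destruct (Hloc a) as [r [Hr H]]; [lra|]. exists r; split; [exact Hr|].
    intros y Hy. apply H. replace (y - a) with 0 by lra. now rewrite Rabs_R0.
  - intros x Hx [r [Hr H]]. destruct (Hloc x) as [d [Hd H']]; [lra|].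
    exists d; split; [exact Hd|]. intros z Hz _.
    exists (Rmin r d). split; [now apply Rmin_glb_lt|]. intros y Hy.
    rmin_facts.
    assert (0 < Rmin r d) by now apply Rmin_glb_lt.
    destruct (Rle_or_lt y x).
    + apply (Hmono y r); [lra|]. apply H; lra.
    + apply (Hmono y d); [lra|]. apply H'. rewrite Rabs_pos_eq; lra.
  - intros x Hx H. destruct (Hloc x) as [d [Hd H']]; [lra|].
    set (z := Rmax a (x - d / 2)).
    assert (Hza : a <= z) by apply Rmax_l.
    assert (Hzd : x - d / 2 <= z) by apply Rmax_r.
    assert (Hzx : z < x) by (unfold z; apply Rmax_lub_lt; lra).
    destruct (H z) as [r [Hr Hr']]; [lra|].
    exists (Rmin r d). split; [now apply Rmin_glb_lt|]. intros y Hy.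
    rmin_facts.
    assert (0 < Rmin r d) by now apply Rmin_glb_lt.
    destruct (Rle_or_lt y z).
    + apply (Hmono y r); [lra|]. apply Hr'; lra.
    + apply (Hmono y d); [lra|]. apply H'. apply Rabs_def1; lra.
Qed.

(** Only the right difference quotients enter, so that the lemma applies to a
    lower envelope of two smooth curves, which has corners. *)
Lemma nondecreasing_of_right_derivative (Psi : R -> R) (a b : R) :
  a <= b ->
  (forall y, a <= y <= b -> continuity_pt Psi y) ->
  (forall y, a <= y < b -> forall eps, 0 < eps ->
     exists d, 0 < d /\ forall h, 0 < h < d -> Psi y - eps * h <= Psi (y + h)) ->
  Psi a <= Psi b.
Proof.
  intros Hab Hc Hd. apply Rnot_lt_le. intros Hlt.
  set (eps := (Psi a - Psi b) / (2 * (b - a + 1))).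
  assert (Heps : 0 < eps) by (apply Rdiv_lt_0_compat; lra).
  assert (Hfin : Psi a - eps * (b - a) <= Psi b).
  { apply (real_induction (fun z => Psi a - eps * (z - a) <= Psi z) a b Hab).
    - lra.
    - intros x Hx H. destruct (Hd x Hx eps Heps) as [d [Hd0 H']].
      exists d; split; [exact Hd0|]. intros z Hz _.
      specialize (H' (z - x)). replace (x + (z - x)) with z in H' by ring.
      assert (0 < z - x < d) by lra. specialize (H' H0). nra.
    - intros x Hx H. apply Rnot_lt_le. intros Hbad.
      destruct (Hc x ltac:(lra) (Psi a - eps * (x - a) - Psi x) ltac:(lra)) as [d [Hd0 H']].
      set (z := Rmax a (x - d / 2)).
      assert (Hza : a <= z) by apply Rmax_l.
      assert (Hzd : x - d / 2 <= z) by apply Rmax_r.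
      assert (Hzx : z < x) by (unfold z; apply Rmax_lub_lt; lra).
      specialize (H z ltac:(lra)).
      assert (Hz := H' z). unfold dist in Hz; simpl in Hz; unfold R_dist in Hz.
      assert (Rabs (Psi z - Psi x) < Psi a - eps * (x - a) - Psi x).
      { apply Hz. split; [split; [exact I|lra]|]. apply Rabs_def1; lra. }
      apply Rabs_def2 in H0. nra. }
  assert (Hkey : eps * (2 * (b - a + 1)) = Psi a - Psi b) by (unfold eps; field; lra).
  nra.
Qed.

Lemma is_derive_R (f : R -> R) (x l : R) :
  is_derive f x l <->
  forall eps, 0 < eps -> exists d, 0 < d /\
    forall y, Rabs (y - x) < d -> Rabs (f y - f x - l * (y - x)) <= eps * Rabs (y - x).
Proof.
  split.
  - intros [_ H] eps Heps.
    specialize (H x (fun P HP => HP) (mkposreal eps Heps)).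
    destruct H as [d Hd]. exists d; split; [apply cond_pos|].
    intros y Hy. specialize (Hd y Hy).
    unfold norm, minus, plus, opp, scal in Hd; simpl in Hd.
    unfold mult in Hd; simpl in Hd. unfold abs in Hd; simpl in Hd.
    replace (f y - f x - l * (y - x)) with (f y + - f x + - ((y + - x) * l)) by ring.
    exact Hd.
  - intros H. split; [apply is_linear_scal_l|]. intros x0 Hx0.
    assert (x0 = x) as ->.
    { symmetry. exact (is_filter_lim_locally_unique _ _ Hx0). }
    intros [eps Heps]. destruct (H eps Heps) as [d [Hd0 Hd]].
    exists (mkposreal d Hd0). intros y Hy. specialize (Hd y Hy).
    unfold norm, minus, plus, opp, scal; simpl.
    unfold mult; simpl. unfold abs; simpl.
    replace (f y + - f x + - ((y + - x) * l)) with (f y - f x - l * (y - x)) by ring.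
    exact Hd.
Qed.

Lemma is_derive_ext_near (g h : R -> R) (x l d : R) :
  0 < d -> (forall t, Rabs (t - x) < d -> g t = h t) -> is_derive g x l -> is_derive h x l.
Proof.
  intros Hd H. apply is_derive_ext_loc. exists (mkposreal d Hd). intros t Ht. apply H, Ht.
Qed.

Lemma is_derive_continuity_pt (f : R -> R) (x l : R) :
  is_derive f x l -> continuity_pt f x.
Proof.
  intros H. apply continuity_pt_filterlim. apply (ex_derive_continuous f x). now exists l.
Qed.

Lemma mean_value (f df : R -> R) (x y : R) :
  (forall t, Rmin x y <= t <= Rmax x y -> is_derive f t (df t)) ->
  exists t, Rmin x y <= t <= Rmax x y /\ f y - f x = df t * (y - x).
Proof.
  intros H. apply (MVT_gen f x y df).
  - intros t Ht. apply H; lra.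
  - intros t Ht. eapply is_derive_continuity_pt, H, Ht.
Qed.

Lemma mean_value_open (f df : R -> R) (a b : R) :
  a < b -> (forall x, a < x < b -> is_derive f x (df x)) ->
  (forall x, a <= x <= b -> continuity_pt f x) ->
  exists c, a < c < b /\ f b - f a = df c * (b - a).
Proof.
  intros Hab Hd Hc.
  assert (Hd' : forall x, a < x < b -> derivable_pt_lim f x (df x)).
  { intros x Hx. now apply is_derive_Reals, Hd. }
  destruct (MVT f id a b (fun x Hx => exist _ (df x) (Hd' x Hx)) (fun x _ => derivable_pt_id x) Hab Hc)
    as (c & Hc1 & Ec).
  - intros x _. apply derivable_continuous_pt, derivable_pt_id.
  - exists c; split; [exact Hc1|]. simpl in Ec. rewrite derive_pt_id in Ec. unfold id in Ec. lra.
Qed.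

Lemma constant_of_zero_derivative (h : R -> R) (a b : R) :
  (forall t, Rmin a b <= t <= Rmax a b -> is_derive h t 0) -> h b = h a.
Proof.
  intros H. destruct (mean_value h (fun _ => 0) a b H) as [t [_ Et]]. lra.
Qed.

Lemma between_abs (x y t z d : R) :
  Rmin x y <= t <= Rmax x y -> Rabs (x - z) < d -> Rabs (y - z) < d -> Rabs (t - z) < d.
Proof.
  intros Ht Hx Hy. apply Rabs_def2 in Hx. apply Rabs_def2 in Hy.
  unfold Rmin, Rmax in Ht. destruct (Rle_dec x y); apply Rabs_def1; lra.
Qed.

Lemma continuity_pt_abs (g : R -> R) (x : R) :
  continuity_pt g x <->
  forall eps, 0 < eps -> exists d, 0 < d /\ forall y, Rabs (y - x) < d -> Rabs (g y - g x) < eps.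
Proof.
  rewrite continuity_pt_locally. split.
  - intros H eps Heps. destruct (H (mkposreal eps Heps)) as [d Hd].
    exists d; split; [apply cond_pos|]. intros y Hy. apply (Hd y Hy).
  - intros H eps. destruct (H eps (cond_pos eps)) as [d [Hd0 Hd]].
    exists (mkposreal d Hd0). intros y Hy. apply Hd, Hy.
Qed.

Lemma continuity_pt_lt (g : R -> R) (x c : R) :
  continuity_pt g x -> c < g x ->
  exists d, 0 < d /\ forall y, Rabs (y - x) < d -> c < g y.
Proof.
  intros Hg Hc. rewrite continuity_pt_abs in Hg.
  destruct (Hg (g x - c) ltac:(lra)) as [d [Hd H]]. exists d; split; [exact Hd|].
  intros y Hy. specialize (H y Hy). apply Rabs_def2 in H. lra.
Qed.

Lemma continuity_pt_gt (g : R -> R) (x c : R) :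
  continuity_pt g x -> g x < c ->
  exists d, 0 < d /\ forall y, Rabs (y - x) < d -> g y < c.
Proof.
  intros Hg Hc. rewrite continuity_pt_abs in Hg.
  destruct (Hg (c - g x) ltac:(lra)) as [d [Hd H]]. exists d; split; [exact Hd|].
  intros y Hy. specialize (H y Hy). apply Rabs_def2 in H. lra.
Qed.

Lemma continuity_pt_Rmin (c1 c2 : R -> R) (y : R) :
  continuity_pt c1 y -> continuity_pt c2 y -> continuity_pt (fun t => Rmin (c1 t) (c2 t)) y.
Proof.
  rewrite !continuity_pt_abs. intros H1 H2 eps Heps.
  destruct (H1 eps Heps) as [d1 [Hd1 K1]]. destruct (H2 eps Heps) as [d2 [Hd2 K2]].
  exists (Rmin d1 d2). split; [now apply Rmin_glb_lt|]. intros t Ht.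
  rmin_facts.
  specialize (K1 t ltac:(lra)). specialize (K2 t ltac:(lra)).
  apply Rabs_def2 in K1. apply Rabs_def2 in K2.
  unfold Rmin; destruct (Rle_dec (c1 t) (c2 t)), (Rle_dec (c1 y) (c2 y)); apply Rabs_def1; lra.
Qed.

Lemma continuous_segment_bounded (g : R -> R) (a b : R) :
  a <= b -> (forall y, a <= y <= b -> continuous g y) ->
  exists M, forall y, a <= y <= b -> Rabs (g y) <= M.
Proof.
  intros Hab Hc. destruct (continuity_ab_maj (fun y => Rabs (g y)) a b Hab) as [m [Hm _]].
  - intros y Hy. apply continuity_pt_filterlim. apply (continuous_Rabs_comp g y), Hc, Hy.
  - exists (Rabs (g m)). exact Hm.
Qed.

Lemma ex_RInt_segment (g : R -> R) (a b : R) :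
  a <= b -> (forall y, a <= y <= b -> continuous g y) -> ex_RInt g a b.
Proof.
  intros Hab H. apply (ex_RInt_continuous g). intros y Hy.
  rewrite Rmin_left, Rmax_right in Hy by lra. now apply H.
Qed.

Lemma RInt_zero (g : R -> R) (a b : R) :
  (forall s, Rmin a b <= s <= Rmax a b -> g s = 0) -> RInt g a b = 0.
Proof.
  intros H. rewrite (RInt_ext g (fun _ => 0)).
  - rewrite RInt_const. unfold scal; simpl; unfold mult; simpl. apply Rmult_0_r.
  - intros s Hs. apply H. lra.
Qed.

Lemma RInt_nonneg_zero (g : R -> R) (a b : R) :
  (forall x, a <= x <= b -> continuous g x) ->
  (forall x, a <= x <= b -> 0 <= g x) -> RInt g a b = 0 ->
  forall x, a < x < b -> g x = 0.
Proof.
  intros Hc Hp H0 x Hx.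
  assert (Hex : forall u v, a <= u -> u <= v -> v <= b -> ex_RInt g u v).
  { intros u v Hu Huv Hv. apply ex_RInt_segment; [exact Huv|]. intros z Hz. apply Hc; lra. }
  assert (HF : forall t, a <= t <= b -> RInt g a t = 0).
  { intros t Ht. pose proof (RInt_Chasles g a t b (Hex a t ltac:(lra) ltac:(lra) ltac:(lra))
      (Hex t b ltac:(lra) ltac:(lra) ltac:(lra))) as E.
    unfold plus in E; simpl in E. rewrite H0 in E.
    assert (I1 : 0 <= RInt g a t) by (apply RInt_ge_0; [lra|apply Hex; lra|intros; apply Hp; lra]).
    assert (I2 : 0 <= RInt g t b) by (apply RInt_ge_0; [lra|apply Hex; lra|intros; apply Hp; lra]).
    lra. }
  assert (Hm : 0 < Rmin (x - a) (b - x)) by (apply Rmin_glb_lt; lra).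
  assert (Hnear : forall t, Rabs (t - x) < Rmin (x - a) (b - x) -> a <= t <= b)
    by (intros t Ht; rmin_facts; apply Rabs_def2 in Ht; lra).
  assert (D : is_derive (fun t => RInt g a t) x (g x)).
  { apply (is_derive_RInt g _ a x); [|apply Hc; lra].
    exists (mkposreal _ Hm). intros t Ht. specialize (Hnear t Ht).
    apply (RInt_correct (V := R_CompleteNormedModule)), Hex; lra. }
  rewrite <- (is_derive_unique _ _ _ D). apply is_derive_unique.
  apply (is_derive_ext_near (fun _ => 0) _ x 0 _ Hm); [|apply (is_derive_const 0 x)].
  intros t Ht. symmetry. apply HF, Hnear, Ht.
Qed.

Lemma interval_approx (a b x eps : R) :
  a < b -> a <= x <= b -> 0 < eps -> exists x', Rabs (x' - x) < eps /\ a < x' < b.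
Proof.
  intros Hab Hx Heps.
  set (t := Rmin (1 / 2) (eps / (2 * (b - a)))).
  assert (Ht : 0 < t) by (apply Rmin_glb_lt; [lra|apply Rdiv_lt_0_compat; lra]).
  assert (Ht1 : t <= 1 / 2) by apply Rmin_l.
  assert (Ht2 : t * (2 * (b - a)) <= eps).
  { replace eps with (eps / (2 * (b - a)) * (2 * (b - a))) by (field; lra).
    apply Rmult_le_compat_r; [lra|apply Rmin_r]. }
  exists (x + t * ((a + b) / 2 - x)). clearbody t. split.
  - apply Rabs_def1; nra.
  - split; nra.
Qed.

Lemma is_derive_pos_part_sqr (z : R) : is_derive (fun z => Rmax 0 z ^ 2) z (2 * Rmax 0 z).
Proof.
  apply is_derive_R. intros eps Heps. exists eps; split; [exact Heps|]. intros y Hy.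
  apply Rle_trans with (Rabs (y - z) * Rabs (y - z)).
  - rewrite <- Rabs_mult, (Rabs_pos_eq ((y - z) * (y - z))) by apply Rle_0_sqr.
    apply Rabs_le. unfold Rmax. destruct (Rle_dec 0 y), (Rle_dec 0 z); simpl;
      repeat match goal with H : ~ _ <= _ |- _ => apply Rnot_le_lt in H end;
      pose proof (Rle_0_sqr (y - z)) as Hsq; unfold Rsqr in Hsq; split; nra.
  - apply Rmult_le_compat_r; [apply Rabs_pos|lra].
Qed.

(** * Functions of two variables *)

Ltac cont2d :=
  repeat first
  [ assumption | apply continuity_2d_pt_const | apply continuity_2d_pt_id1 | apply continuity_2d_pt_id2
  | apply continuity_2d_pt_minus | apply continuity_2d_pt_plus | apply continuity_2d_pt_opp
  | apply continuity_2d_pt_mult ].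

Lemma continuity_2d_slice (g : R -> R -> R) (x y : R) :
  continuity_2d_pt g x y -> continuous (g x) y.
Proof.
  intros H. apply continuity_pt_filterlim. apply continuity_pt_locally. intros eps.
  destruct (H eps) as [d Hd]. exists d. intros z Hz. apply Hd; [|exact Hz].
  rewrite Rminus_diag, Rabs_R0. apply cond_pos.
Qed.

Lemma continuity_2d_slice_l (g : R -> R -> R) (x y : R) :
  continuity_2d_pt g x y -> continuous (fun t => g t y) x.
Proof.
  intros H. apply continuity_pt_filterlim. apply continuity_pt_locally. intros eps.
  destruct (H eps) as [d Hd]. exists d. intros z Hz. apply Hd; [exact Hz|].
  rewrite Rminus_diag, Rabs_R0. apply cond_pos.
Qed.

Lemma continuity_2d_swap (g : R -> R -> R) (x y : R) :
  continuity_2d_pt g x y -> continuity_2d_pt (fun u v => g v u) y x.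
Proof.
  intros H eps. destruct (H eps) as [d Hd]. exists d. intros u v Hu Hv. now apply Hd.
Qed.

Lemma continuity_2d_comp_within (D : R * R -> Prop) (g : R * R -> R)
  (hx hy : R -> R -> R) (x y : R) :
  continuity_2d_pt hx x y -> continuity_2d_pt hy x y ->
  locally_2d (fun u v => D (hx u v, hy u v)) x y ->
  filterlim g (within D (locally (hx x y, hy x y))) (locally (g (hx x y, hy x y))) ->
  continuity_2d_pt (fun u v => g (hx u v, hy u v)) x y.
Proof.
  intros Hx Hy [dD HD] Hg eps.
  assert (Hb : locally (g (hx x y, hy x y)) (fun z => Rabs (z - g (hx x y, hy x y)) < eps)).
  { exists eps. intros z Hz. exact Hz. }
  specialize (Hg _ Hb). destruct Hg as [e He].
  destruct (Hx e) as [d1 H1]. destruct (Hy e) as [d2 H2].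
  assert (Hm : 0 < Rmin dD (Rmin d1 d2)).
  { apply Rmin_glb_lt; [apply cond_pos|apply Rmin_glb_lt; apply cond_pos]. }
  exists (mkposreal _ Hm). simpl. intros u v Hu Hv.
  rmin_facts.
  apply He.
  - split; [apply H1|apply H2]; lra.
  - apply HD; lra.
Qed.

Lemma continuity_2d_interior (E : R * R -> Prop) (D : R * R -> Prop) (g : R * R -> R) (x y : R) :
  (forall z, E z -> D z) -> locally (x, y) E -> continuous_on D g ->
  continuity_2d_pt (fun a b => g (a, b)) x y.
Proof.
  intros HED HE Hg.
  apply (continuity_2d_comp_within D g (fun a _ => a) (fun _ b => b)).
  - apply continuity_2d_pt_id1.
  - apply continuity_2d_pt_id2.
  - apply locally_2d_locally. revert HE. apply filter_imp. intros [a b]. apply HED.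
  - apply Hg. apply HED. now apply locally_singleton in HE.
Qed.

Lemma differentiable_of_partials (f fx fy : R -> R -> R) (x y : R) :
  locally_2d (fun u v => is_derive (fun t => f t v) u (fx u v) /\
                         is_derive (fun t => f u t) v (fy u v)) x y ->
  continuity_2d_pt fx x y -> continuity_2d_pt fy x y ->
  differentiable_pt_lim f x y (fx x y) (fy x y).
Proof.
  intros [d0 Hd0] Hcx Hcy eps.
  assert (He : 0 < eps / 2) by (destruct eps; simpl; lra).
  destruct (Hcx (mkposreal _ He)) as [d1 H1]. destruct (Hcy (mkposreal _ He)) as [d2 H2].
  simpl in H1, H2.
  assert (Hm : 0 < Rmin d0 (Rmin d1 d2)).
  { apply Rmin_glb_lt; [apply cond_pos|apply Rmin_glb_lt; apply cond_pos]. }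
  exists (mkposreal _ Hm). simpl. intros u v Hu Hv.
  rmin_facts.
  assert (Hxx : forall d : posreal, Rabs (x - x) < d) by (intros d; rewrite Rminus_diag, Rabs_R0; apply cond_pos).
  assert (Hyy : forall d : posreal, Rabs (y - y) < d) by (intros d; rewrite Rminus_diag, Rabs_R0; apply cond_pos).
  destruct (mean_value (fun t => f t v) (fun t => fx t v) x u) as [a [Ha Ea]].
  { intros t Ht. apply Hd0; [|lra]. eapply between_abs; [exact Ht|apply Hxx|lra]. }
  destruct (mean_value (fun t => f x t) (fun t => fy x t) y v) as [b [Hb Eb]].
  { intros t Ht. apply Hd0; [apply Hxx|]. eapply between_abs; [exact Ht|apply Hyy|lra]. }
  assert (Ka : Rabs (fx a v - fx x y) < eps / 2).
  { apply H1; [|lra]. eapply between_abs; [exact Ha|apply Hxx|lra]. }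
  assert (Kb : Rabs (fy x b - fy x y) < eps / 2).
  { apply H2; [apply Hxx|]. eapply between_abs; [exact Hb|apply Hyy|lra]. }
  replace (f u v - f x y - (fx x y * (u - x) + fy x y * (v - y))) with
    ((fx a v - fx x y) * (u - x) + (fy x b - fy x y) * (v - y)) by (simpl in *; lra).
  eapply Rle_trans; [apply Rabs_triang|]. rewrite !Rabs_mult.
  pose proof (Rmax_l (Rabs (u - x)) (Rabs (v - y))).
  pose proof (Rmax_r (Rabs (u - x)) (Rabs (v - y))).
  pose proof (Rabs_pos (u - x)). pose proof (Rabs_pos (v - y)).
  pose proof (Rabs_pos (fx a v - fx x y)). pose proof (Rabs_pos (fy x b - fy x y)).
  nra.
Qed.

(** The derivative of a boundary trace is the limit of the tangential derivatives
    taken inside: by the mean value theorem the difference quotients of [F e] are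
    values of [G e], which are close to [g0]. *)
Lemma is_derive_trace (F G : R -> R -> R) (F0 : R -> R) (y g0 d0 : R) :
  0 < d0 ->
  (forall e t, 0 < e < d0 -> Rabs (t - y) < d0 -> is_derive (F e) t (G e t)) ->
  (forall t, Rabs (t - y) < d0 -> forall eps, 0 < eps ->
     exists d, 0 < d /\ forall e, 0 < e < d -> Rabs (F e t - F0 t) < eps) ->
  (forall eps, 0 < eps -> exists d, 0 < d /\
     forall e t, 0 < e < d -> Rabs (t - y) < d -> Rabs (G e t - g0) <= eps) ->
  is_derive F0 y g0.
Proof.
  intros Hd0 HF HF0 HG. apply is_derive_R. intros eps Heps.
  destruct (HG eps Heps) as [d [Hd Hd']].
  exists (Rmin d d0). split; [now apply Rmin_glb_lt|]. intros t Ht.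
  rmin_facts.
  apply le_epsilon. intros e He.
  assert (Hy0 : Rabs (y - y) < d0) by (rewrite Rminus_diag, Rabs_R0; exact Hd0).
  destruct (HF0 t ltac:(lra) (e / 2) ltac:(lra)) as [d1 [Hd1 H1]].
  destruct (HF0 y Hy0 (e / 2) ltac:(lra)) as [d2 [Hd2 H2]].
  set (s := Rmin (Rmin d1 d2) (Rmin d d0) / 2).
  assert (Hs : 0 < Rmin (Rmin d1 d2) (Rmin d d0)) by (repeat apply Rmin_glb_lt; assumption).
  rmin_facts.
  assert (Hs1 : s < d1 /\ s < d2 /\ s < d /\ s < d0 /\ 0 < s) by (unfold s; lra).
  specialize (H1 s ltac:(lra)). specialize (H2 s ltac:(lra)).
  destruct (mean_value (F s) (G s) y t) as [xi [Hxi Heq]].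
  { intros z Hz. apply HF; [lra|]. eapply between_abs; [exact Hz| |]; [exact Hy0|lra]. }
  assert (Hxi' : Rabs (xi - y) < d).
  { eapply between_abs; [exact Hxi| |]; [rewrite Rminus_diag, Rabs_R0; exact Hd|lra]. }
  specialize (Hd' s xi ltac:(lra) Hxi').
  replace (F0 t - F0 y - g0 * (t - y)) with
    ((G s xi - g0) * (t - y) + (F0 t - F s t) + (F s y - F0 y)) by (rewrite Rmult_minus_distr_r, <- Heq; ring).
  rewrite (Rabs_minus_sym (F s t)) in H1.
  eapply Rle_trans; [apply Rabs_triang|].
  eapply Rle_trans; [apply Rplus_le_compat_r, Rabs_triang|].
  rewrite Rabs_mult. pose proof (Rabs_pos (t - y)). nra.
Qed.

Lemma continuous_RInt_param (F : R -> R -> R) (a b s : R) :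
  a <= b ->
  (forall y, a <= y <= b -> continuity_2d_pt F s y) ->
  (forall t y, a <= y <= b -> continuous (F t) y) ->
  continuity_pt (fun t => RInt (F t) a b) s.
Proof.
  intros Hab Hc Hi. apply continuity_pt_locally. intros eps.
  assert (He : 0 < eps / (b - a + 1) ) by (apply Rdiv_lt_0_compat; [apply cond_pos|lra]).
  destruct (uniform_continuity_2d_1d' F a b s Hc (mkposreal _ He)) as [d Hd]. simpl in Hd.
  exists d. intros t Ht.
  assert (Ht' : Rabs (t - s) < d) by exact Ht.
  assert (Hex : forall t, ex_RInt (F t) a b).
  { intros z. apply (ex_RInt_continuous (F z)). intros y Hy. rewrite Rmin_left, Rmax_right in Hy by lra. now apply Hi. }
  assert (Heq : RInt (F t) a b - RInt (F s) a b = RInt (fun y => minus (F t y) (F s y)) a b).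
  { symmetry. exact (RInt_minus (F t) (F s) a b (Hex t) (Hex s)). }
  rewrite Heq.
  assert (Hle : Rabs (RInt (fun y => minus (F t y) (F s y)) a b) <= (b - a) * (eps / (b - a + 1))).
  { apply abs_RInt_le_const; [lra| |].
    - apply (ex_RInt_minus (F t) (F s)); apply Hex.
    - intros y Hy. apply Rlt_le. apply Rabs_def2 in Ht'. apply Hd; try lra.
      + rewrite Rminus_diag, Rabs_R0. apply cond_pos. }
  eapply Rle_lt_trans; [exact Hle|].
  assert (eps / (b - a + 1) * (b - a + 1) = eps) by (field; lra). nra.
Qed.

(** Green's formula for [phi dp], in differential form.  Formally,
    [phi p_y] differentiates to [phi_s p_y + phi p_ys], and the last term is
    integrated by parts in [y].  As [p] is only [C^1], this integration by parts
    is done on the difference [p t y - p s y] before dividing by [t - s]. *)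
Lemma is_derive_flux_of_exact_form (phi phis phiy p ps py : R -> R -> R) (a b : R) :
  a <= b ->
  (forall s y, 0 < s < 1 -> a <= y <= b ->
     is_derive (fun t => phi t y) s (phis s y) /\ is_derive (phi s) y (phiy s y) /\
     is_derive (fun t => p t y) s (ps s y) /\ is_derive (p s) y (py s y)) ->
  (forall s y, 0 < s < 1 -> a <= y <= b ->
     continuity_2d_pt phis s y /\ continuity_2d_pt phiy s y /\
     continuity_2d_pt ps s y /\ continuity_2d_pt py s y) ->
  (forall s, 0 < s < 1 -> phi s a = 0 /\ phi s b = 0) ->
  forall s, 0 < s < 1 ->
  is_derive (fun t => RInt (fun y => phi t y * py t y) a b) s
    (RInt (fun y => phis s y * py s y - phiy s y * ps s y) a b).
Proof.
  intros Hab Hd Hc H0 s Hs. apply is_derive_R. intros eps Heps.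
  assert (Hsl : forall t y, 0 < t < 1 -> a <= y <= b ->
     continuous (phi t) y /\ continuous (p t) y /\ continuous (phis t) y /\
     continuous (phiy t) y /\ continuous (ps t) y /\ continuous (py t) y).
  { intros t y Ht Hy. destruct (Hc t y Ht Hy) as (C1 & C2 & C3 & C4).
    destruct (Hd t y Ht Hy) as (_ & D2 & _ & D4).
    repeat split; try (now apply continuity_2d_slice).
    - apply (ex_derive_continuous (phi t)). now exists (phiy t y).
    - apply (ex_derive_continuous (p t)). now exists (py t y). }
  destruct (continuous_segment_bounded (phis s) a b Hab) as [M1 HM1]; [intros; now apply Hsl|].
  destruct (continuous_segment_bounded (phiy s) a b Hab) as [M2 HM2]; [intros; now apply Hsl|].
  destruct (continuous_segment_bounded (py s) a b Hab) as [M3 HM3]; [intros; now apply Hsl|].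
  set (M := 1 + Rabs M1 + Rabs M2 + Rabs M3).
  pose proof (Rle_abs M1). pose proof (Rle_abs M2). pose proof (Rle_abs M3).
  pose proof (Rabs_pos M1). pose proof (Rabs_pos M2). pose proof (Rabs_pos M3).
  assert (HM : 1 <= M /\ M1 <= M /\ M2 <= M /\ M3 <= M) by (unfold M; lra).
  clearbody M.
  set (e0 := eps / (4 * M * (b - a + 1))).
  assert (He0 : 0 < e0).
  { unfold e0. apply Rdiv_lt_0_compat; [exact Heps|]. apply Rmult_lt_0_compat; lra. }
  assert (He0' : e0 * (4 * M) * (b - a + 1) = eps) by (unfold e0; field; lra).
  set (e := Rmin 1 e0).
  assert (He : 0 < e) by (apply Rmin_glb_lt; lra).
  assert (He1 : e <= 1) by apply Rmin_l. assert (He2 : e <= e0) by apply Rmin_r.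
  clearbody e.
  destruct (uniform_continuity_2d_1d' phis a b s) with (eps := mkposreal e He) as [d1 U1];
    [intros y Hy; now apply Hc|].
  destruct (uniform_continuity_2d_1d' ps a b s) with (eps := mkposreal e He) as [d2 U2];
    [intros y Hy; now apply Hc|].
  destruct (uniform_continuity_2d_1d' py a b s) with (eps := mkposreal e He) as [d3 U3];
    [intros y Hy; now apply Hc|].
  simpl in U1, U2, U3.
  assert (Hdd : exists d, 0 < d /\ d <= d1 /\ d <= d2 /\ d <= d3 /\ d <= s /\ d <= 1 - s).
  { exists (Rmin (Rmin d1 d2) (Rmin d3 (Rmin s (1 - s)))).
    rmin_facts.
    repeat split; try lra.
    repeat apply Rmin_glb_lt; try apply cond_pos; lra. }
  destruct Hdd as (d & Hd0 & Hdd1 & Hdd2 & Hdd3 & Hds & Hds').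
  exists d; split; [exact Hd0|]. intros t Ht.
  assert (Ht1 : 0 < t < 1) by (apply Rabs_def2 in Ht; lra).
  assert (Hss : Rabs (s - s) < d) by (rewrite Rminus_diag, Rabs_R0; exact Hd0).
  set (K := fun y => phis s y * py s y - phiy s y * ps s y).
  set (A := fun y => phi t y * py t y).
  set (B := fun y => phi s y * py s y).
  set (P := fun y => phiy s y * (p t y - p s y) + phi s y * (py t y - py s y)).
  assert (CA : forall r y, 0 < r < 1 -> a <= y <= b -> continuous (fun y => phi r y * py r y) y).
  { intros r y Hr Hy. apply (continuous_mult (phi r) (py r)); now apply Hsl. }
  assert (CK : forall y, a <= y <= b -> continuous K y).
  { intros y Hy. apply (continuous_minus (fun y => phis s y * py s y) (fun y => phiy s y * ps s y)).
    - apply (continuous_mult (phis s) (py s)); now apply Hsl.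
    - apply (continuous_mult (phiy s) (ps s)); now apply Hsl. }
  assert (CP : forall y, a <= y <= b -> continuous P y).
  { intros y Hy.
    apply (continuous_plus (fun y => phiy s y * (p t y - p s y)) (fun y => phi s y * (py t y - py s y))).
    - apply (continuous_mult (phiy s) (fun y => p t y - p s y)); [now apply Hsl|].
      apply (continuous_minus (p t) (p s)); now apply Hsl.
    - apply (continuous_mult (phi s) (fun y => py t y - py s y)); [now apply Hsl|].
      apply (continuous_minus (py t) (py s)); now apply Hsl. }
  assert (EX : forall g : R -> R, (forall y, a <= y <= b -> continuous g y) -> ex_RInt g a b).
  { intros g Hg. apply (ex_RInt_continuous g). intros y Hy.
    rewrite Rmin_left, Rmax_right in Hy by lra. now apply Hg. }
  (* [P] is the derivative of [phi s y * (p t y - p s y)], which vanishes at both ends. *)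
  assert (IP : RInt P a b = 0).
  { apply is_RInt_unique.
    replace 0 with (phi s b * (p t b - p s b) - phi s a * (p t a - p s a))
      by (destruct (H0 s Hs) as [-> ->]; ring).
    apply (is_RInt_derive (fun y => phi s y * (p t y - p s y)) P).
    - intros y Hy. rewrite Rmin_left, Rmax_right in Hy by lra. unfold P.
      apply (is_derive_mult (phi s) (fun y => p t y - p s y)).
      + now apply Hd.
      + apply (is_derive_minus (p t) (p s)); now apply Hd.
      + intros; apply Rmult_comm.
    - intros y Hy. rewrite Rmin_left, Rmax_right in Hy by lra. now apply CP. }
  assert (ID : RInt A a b - RInt B a b - RInt K a b * (t - s) =
               RInt (fun y => A y - B y - P y - (t - s) * K y) a b).
  { symmetry. apply is_RInt_unique.
    replace (RInt A a b - RInt B a b - RInt K a b * (t - s)) with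
      (RInt A a b - RInt B a b - RInt P a b - (t - s) * RInt K a b) by (rewrite IP; ring).
    apply (is_RInt_minus (fun y => A y - B y - P y) (fun y => (t - s) * K y)).
    - apply (is_RInt_minus (fun y => A y - B y) P).
      + apply (is_RInt_minus A B); apply (RInt_correct (V := R_CompleteNormedModule)), EX;
          intros y Hy; now apply CA.
      + apply (RInt_correct (V := R_CompleteNormedModule)), EX, CP.
    - apply (is_RInt_scal K), (RInt_correct (V := R_CompleteNormedModule)), EX, CK. }
  fold K A B. rewrite ID.
  assert (Hbound : Rabs (RInt (fun y => A y - B y - P y - (t - s) * K y) a b)
                   <= (b - a) * (e * (4 * M) * Rabs (t - s))).
  { apply abs_RInt_le_const; [exact Hab| |].
    - apply EX. intros y Hy.
      apply (continuous_minus (fun y => A y - B y - P y) (fun y => (t - s) * K y)).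
      + apply (continuous_minus (fun y => A y - B y) P); [|now apply CP].
        apply (continuous_minus A B); now apply CA.
      + apply (continuous_mult (fun _ => t - s) K); [apply continuous_const|now apply CK].
    - intros y Hy.
      destruct (mean_value (fun r => phi r y) (fun r => phis r y) s t) as [xi [Hxi Exi]].
      { intros r Hr. apply Hd; [|exact Hy].
        assert (Hr' : Rabs (r - s) < d) by (eapply between_abs; eassumption).
        apply Rabs_def2 in Hr'. lra. }
      destruct (mean_value (fun r => p r y) (fun r => ps r y) s t) as [eta [Heta Eeta]].
      { intros r Hr. apply Hd; [|exact Hy].
        assert (Hr' : Rabs (r - s) < d) by (eapply between_abs; eassumption).
        apply Rabs_def2 in Hr'. lra. }
      assert (Hxi' : Rabs (xi - s) < d) by (eapply between_abs; eassumption).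
      assert (Heta' : Rabs (eta - s) < d) by (eapply between_abs; eassumption).
      assert (Hyy : forall d : posreal, Rabs (y - y) < d)
        by (intros dd; rewrite Rminus_diag, Rabs_R0; apply cond_pos).
      assert (V1 : Rabs (phis xi y - phis s y) < e).
      { apply Rabs_def2 in Hxi'. apply U1; try lra. apply Hyy. }
      assert (V2 : Rabs (ps eta y - ps s y) < e).
      { apply Rabs_def2 in Heta'. apply U2; try lra. apply Hyy. }
      assert (V3 : Rabs (py t y - py s y) < e).
      { apply Rabs_def2 in Ht. apply U3; try lra. apply Hyy. }
      replace (A y - B y - P y - (t - s) * K y) with
        (((phis xi y - phis s y) * py s y + (phis xi y - phis s y) * (py t y - py s y)
          + phis s y * (py t y - py s y) - phiy s y * (ps eta y - ps s y)) * (t - s)).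
      2:{ unfold A, B, P, K.
          transitivity ((phis xi y * (t - s)) * py t y - phiy s y * (ps eta y * (t - s))
            - (t - s) * (phis s y * py s y - phiy s y * ps s y)); [ring|].
          rewrite <- Exi, <- Eeta. ring. }
      rewrite Rabs_mult. apply Rmult_le_compat_r; [apply Rabs_pos|].
      specialize (HM1 y Hy). specialize (HM2 y Hy). specialize (HM3 y Hy).
      assert (T : forall p q r z, Rabs (p + q + r - z) <= Rabs p + Rabs q + Rabs r + Rabs z).
      { intros x1 x2 x3 x4. unfold Rminus. eapply Rle_trans; [apply Rabs_triang|]. rewrite Rabs_Ropp.
        apply Rplus_le_compat_r. eapply Rle_trans; [apply Rabs_triang|].
        apply Rplus_le_compat_r. apply Rabs_triang. }
      eapply Rle_trans; [apply T|]. rewrite !Rabs_mult.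
      assert (Q : forall x z X Z, Rabs x <= X -> Rabs z <= Z -> Rabs x * Rabs z <= X * Z).
      { intros x1 x2 X Z H6 H7. apply Rmult_le_compat; try apply Rabs_pos; assumption. }
      assert (Q1 := Q (phis xi y - phis s y) (py s y) e M ltac:(lra) ltac:(lra)).
      assert (Q2 := Q (phis xi y - phis s y) (py t y - py s y) e M ltac:(lra) ltac:(lra)).
      assert (Q3 := Q (phis s y) (py t y - py s y) M e ltac:(lra) ltac:(lra)).
      assert (Q4 := Q (phiy s y) (ps eta y - ps s y) M e ltac:(lra) ltac:(lra)).
      lra. }
  eapply Rle_trans; [exact Hbound|].
  pose proof (Rabs_pos (t - s)).
  assert ((b - a) * (e * (4 * M)) <= eps).
  { assert (e * (4 * M) <= e0 * (4 * M)) by nra.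
    assert (0 <= e * (4 * M)) by nra. nra. }
  nra.
Qed.

Lemma closure_intro (E : R * R -> Prop) (x y : R) :
  (forall eps, 0 < eps -> exists x' y', Rabs (x' - x) < eps /\ Rabs (y' - y) < eps /\ E (x', y')) ->
  closure E (x, y).
Proof.
  intros H P [d Hd]. destruct (H d (cond_pos d)) as (x' & y' & Hx & Hy & HE).
  exists (x', y'). split; [|exact HE]. apply Hd. split; assumption.
Qed.

Lemma subset_closure (E : R * R -> Prop) (q : R * R) : E q -> closure E q.
Proof. intros HE P HP. exists q; split; [now apply locally_singleton|exact HE]. Qed.

Lemma closure_value (E D : R * R -> Prop) (g : R * R -> R) (q : R * R) (c : R) :
  (forall z, E z -> D z) -> closure E q ->
  filterlim g (within D (locally q)) (locally (g q)) ->
  (forall z, E z -> g z = c) -> g q = c.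
Proof.
  intros HED Hq Hg Hc. apply NNPP. intros Hne.
  assert (Hpos : 0 < Rabs (g q - c)) by (apply Rabs_pos_lt; lra).
  assert (Hb : locally (g q) (fun z => Rabs (z - g q) < Rabs (g q - c))).
  { exists (mkposreal _ Hpos). intros z Hz. exact Hz. }
  specialize (Hg _ Hb). destruct (Hq _ Hg) as [z [Hz1 Hz2]].
  specialize (Hz1 (HED z Hz2)). rewrite (Hc z Hz2) in Hz1.
  rewrite Rabs_minus_sym in Hz1. lra.
Qed.

Lemma locally_pair (x y d : R) (P : R * R -> Prop) :
  0 < d -> (forall u v, Rabs (u - x) < d -> Rabs (v - y) < d -> P (u, v)) ->
  locally (x, y) P.
Proof.
  intros Hd H. exists (mkposreal d Hd). intros [u v] [Hu Hv]. apply H; assumption.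
Qed.

(** * Stream functions *)

(** The base line of the integral is [x = 0], where the field is required to
    vanish; the line is inside the domain because the field is extended by zero
    to its left. *)
Definition stream (Q : R -> R -> R) (x y : R) : R := - RInt (fun s => Q s y) 0 x.

(** The derivative across the segment of integration is computed first from an
    abscissa [e > 0], where the field is differentiable, and then [e] tends to [0]. *)
Lemma stream_differentiable (f : R -> R) (Q1 Q2 B : R -> R -> R) :
  (forall y, 0 < y -> 0 < f y /\ continuity_pt f y) ->
  (forall x y, 0 < y -> x < f y -> continuity_2d_pt Q1 x y /\ continuity_2d_pt Q2 x y) ->
  (forall x y, 0 < y -> x <= 0 -> Q1 x y = 0 /\ Q2 x y = 0) ->
  (forall x y, 0 < y -> 0 < x < f y ->
     is_derive (fun t => Q1 t y) x (- B x y) /\ is_derive (Q2 x) y (B x y) /\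
     continuity_2d_pt B x y) ->
  forall x y, 0 < y -> x < f y ->
  differentiable_pt_lim (stream Q2) x y (- Q2 x y) (Q1 x y).
Proof.
  intros Hf Hc H0 HB.
  assert (Hder : forall x y, 0 < y -> x < f y ->
    is_derive (fun t => stream Q2 t y) x (- Q2 x y) /\ is_derive (stream Q2 x) y (Q1 x y)).
  2:{ intros x y Hy Hx.
      apply (differentiable_of_partials (stream Q2) (fun x y => - Q2 x y) Q1).
      - destruct (Hf y Hy) as [_ Hfc].
        assert (Hm : x < (x + f y) / 2 < f y) by lra.
        destruct (continuity_pt_lt f y _ Hfc (proj2 Hm)) as [d [Hd Hd']].
        assert (Hdd : 0 < Rmin (Rmin d y) ((f y - x) / 2)) by (repeat apply Rmin_glb_lt; lra).
        exists (mkposreal _ Hdd). simpl. intros u v Hu Hv.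
        rmin_facts.
        assert (Hv' := Hd' v ltac:(lra)). apply Rabs_def2 in Hu. apply Rabs_def2 in Hv.
        apply Hder; lra.
      - apply continuity_2d_pt_opp. now apply Hc.
      - now apply Hc. }
  intros x y Hy Hx. split.
  - unfold stream. apply (is_derive_opp (fun t => RInt (fun s => Q2 s y) 0 t)).
    apply (is_derive_RInt (fun s => Q2 s y) _ 0 x).
    + destruct (Hf y Hy) as [Hf0 _].
      assert (Hm : 0 < f y - x) by lra. exists (mkposreal _ Hm). intros t Ht.
      apply (RInt_correct (V := R_CompleteNormedModule)). apply (ex_RInt_continuous (fun s => Q2 s y)).
      intros z Hz. apply continuity_2d_slice_l, Hc; [exact Hy|].
      change (Rabs (t - x) < f y - x) in Ht.
      apply Rabs_def2 in Ht. unfold Rmin, Rmax in Hz. destruct (Rle_dec 0 t); lra.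
    + now apply continuity_2d_slice_l, Hc.
  - destruct (Rle_or_lt x 0) as [Hx0|Hx0].
    { destruct (H0 x y Hy Hx0) as [-> _].
      apply (is_derive_ext_near (fun _ => 0) _ y 0 y Hy); [|apply (is_derive_const 0 y)].
      intros t Ht. apply Rabs_def2 in Ht. unfold stream. symmetry.
      assert (E : is_RInt (fun s => Q2 s t) 0 x 0).
      { apply (is_RInt_ext (fun _ => 0)).
        - intros s Hs. symmetry. apply H0; [lra|]. unfold Rmin, Rmax in Hs. destruct (Rle_dec 0 x); lra.
        - replace 0 with (scal (x - 0) 0) at 2 by (unfold scal; simpl; unfold mult; simpl; ring).
          apply (is_RInt_const 0 x 0). }
      rewrite (is_RInt_unique _ _ _ _ E). apply Ropp_0. }
    destruct (Hf y Hy) as [_ Hfc].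
    destruct (continuity_pt_lt f y _ Hfc Hx) as [d [Hd Hd']].
    set (d0 := Rmin (Rmin d y) x).
    assert (Hd0 : 0 < d0) by (repeat apply Rmin_glb_lt; lra).
    assert (D1 : d0 <= Rmin d y) by apply Rmin_l. assert (D2 : d0 <= x) by apply Rmin_r.
    rmin_facts.
    assert (Hnear : forall t, Rabs (t - y) < d0 -> 0 < t /\ x < f t).
    { intros t Ht. split; [apply Rabs_def2 in Ht; lra|apply Hd'; lra]. }
    clearbody d0.
    apply (is_derive_trace (fun e t => - RInt (fun s => Q2 s t) e x)
       (fun e t => Q1 x t - Q1 e t) _ y (Q1 x y) d0 Hd0).
    + intros e t He Ht. destruct (Hnear t Ht) as [Ht0 Htx].
      assert (EI : Q1 x t - Q1 e t = - RInt (fun s => Derive (fun u => Q2 s u) t) e x).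
      { rewrite (RInt_ext _ (fun s => B s t)).
        2:{ intros s Hs. rewrite Rmin_left, Rmax_right in Hs by lra.
            apply is_derive_unique. apply HB; lra. }
        replace (Q1 x t - Q1 e t) with (- - (Q1 x t - Q1 e t)) by ring. f_equal.
        symmetry. apply is_RInt_unique.
        replace (- (Q1 x t - Q1 e t)) with (- Q1 x t - - Q1 e t) by ring.
        apply (is_RInt_derive (fun s => - Q1 s t) (fun s => B s t)).
        - intros s Hs. rewrite Rmin_left, Rmax_right in Hs by lra.
          replace (B s t) with (- - B s t) by ring.
          apply (is_derive_opp (fun s => Q1 s t)). apply HB; lra.
        - intros s Hs. rewrite Rmin_left, Rmax_right in Hs by lra.
          apply continuity_2d_slice_l. apply HB; lra. }
      rewrite EI.
      apply (is_derive_opp (fun t => RInt (fun s => Q2 s t) e x)).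
      apply (is_derive_RInt_param (fun t s => Q2 s t) e x t).
      * assert (Hm : 0 < d0 - Rabs (t - y)) by lra.
        exists (mkposreal _ Hm). intros z Hz s Hs. rewrite Rmin_left, Rmax_right in Hs by lra.
        assert (Hz' : Rabs (z - y) < d0).
        { replace (z - y) with ((z - t) + (t - y)) by ring. eapply Rle_lt_trans; [apply Rabs_triang|].
          change (Rabs (z - t) < d0 - Rabs (t - y)) in Hz. lra. }
        destruct (Hnear z Hz'). exists (B s z). apply HB; lra.
      * intros s Hs. rewrite Rmin_left, Rmax_right in Hs by lra.
        destruct (HB s t Ht0 ltac:(lra)) as (_ & _ & CB).
        apply (continuity_2d_pt_ext_loc (fun u v => B v u)); [|now apply continuity_2d_swap].
        assert (Hfs : s < f t) by lra.
        destruct (Hf t Ht0) as [_ Hft].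
        assert (Hm : s < (s + f t) / 2 < f t) by lra.
        destruct (continuity_pt_lt f t _ Hft (proj2 Hm)) as [d3 [Hd3 Hd3']].
        assert (Hdd : 0 < Rmin (Rmin d3 t) (Rmin s ((f t - s) / 2))) by (repeat apply Rmin_glb_lt; lra).
        exists (mkposreal _ Hdd). simpl. intros u v Hu Hv.
        rmin_facts.
        assert (Hu' := Hd3' u ltac:(lra)). apply Rabs_def2 in Hu. apply Rabs_def2 in Hv.
        symmetry. apply is_derive_unique. apply HB; lra.
      * assert (Hm : 0 < d0 - Rabs (t - y)) by lra.
        exists (mkposreal _ Hm). intros z Hz. apply ex_RInt_segment; [lra|].
        intros s Hs.
        assert (Hz' : Rabs (z - y) < d0).
        { replace (z - y) with ((z - t) + (t - y)) by ring. eapply Rle_lt_trans; [apply Rabs_triang|].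
          change (Rabs (z - t) < d0 - Rabs (t - y)) in Hz. lra. }
        destruct (Hnear z Hz'). apply continuity_2d_slice_l. apply Hc; lra.
    + intros t Ht eps Heps. destruct (Hnear t Ht) as [Ht0 Htx].
      assert (Cs : forall s, s <= x -> continuous (fun s => Q2 s t) s).
      { intros s Hs. apply continuity_2d_slice_l, Hc; lra. }
      destruct (continuous_segment_bounded (fun s => Q2 s t) 0 x) as [M HM]; [lra| |].
      { intros s Hs. apply Cs; lra. }
      assert (HM0 : 0 <= M) by (eapply Rle_trans; [apply Rabs_pos|apply (HM 0); lra]).
      exists (Rmin x (eps / (M + 1))).
      assert (Hq : 0 < eps / (M + 1)) by (apply Rdiv_lt_0_compat; lra).
      split; [apply Rmin_glb_lt; lra|]. intros e He.
      rmin_facts.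
      assert (Ech : RInt (fun s => Q2 s t) 0 x = RInt (fun s => Q2 s t) 0 e + RInt (fun s => Q2 s t) e x).
      { symmetry. apply (RInt_Chasles (fun s => Q2 s t) 0 e x); apply ex_RInt_segment; try lra;
          intros s Hs; apply Cs; lra. }
      unfold stream. rewrite Ech.
      replace (- RInt (fun s => Q2 s t) e x - - (RInt (fun s => Q2 s t) 0 e + RInt (fun s => Q2 s t) e x))
        with (RInt (fun s => Q2 s t) 0 e : R) by (simpl; set (i1 := RInt _ 0 e : R); set (i2 := RInt _ e x : R); ring).
      eapply Rle_lt_trans; [apply (abs_RInt_le_const _ 0 e M); [lra| |]|].
      * apply ex_RInt_segment; [lra|]. intros s Hs; apply Cs; lra.
      * intros s Hs. apply HM; lra.
      * assert (eps / (M + 1) * (M + 1) = eps) by (field; lra). nra.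
    + intros eps Heps.
      destruct (Hc x y Hy Hx) as [C1 _].
      destruct (Hc 0 y Hy ltac:(lra)) as [C2 _].
      assert (He2 : 0 < eps / 2) by lra.
      destruct (C1 (mkposreal _ He2)) as [d1 U1]. destruct (C2 (mkposreal _ He2)) as [d2 U2].
      simpl in U1, U2.
      exists (Rmin d1 d2). split; [apply Rmin_glb_lt; apply cond_pos|].
      intros e t He Ht. rmin_facts.
      assert (K1 : Rabs (Q1 x t - Q1 x y) < eps / 2).
      { apply U1; [rewrite Rminus_diag, Rabs_R0; apply cond_pos|lra]. }
      assert (K2 : Rabs (Q1 e t - Q1 0 y) < eps / 2).
      { apply U2; [rewrite Rminus_0_r, Rabs_pos_eq; lra|lra]. }
      destruct (H0 0 y Hy (Rle_refl 0)) as [Z _]. rewrite Z in K2.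
      apply Rabs_def2 in K1. apply Rabs_def2 in K2. apply Rabs_le. lra.
Qed.

(** The lower of two curves is used because the path that follows the first and
    the path that follows the second may interchange infinitely often. *)
Lemma stream_decreases_along_envelope (psi : R -> R -> R) (Q1 Q2 : R -> R -> R)
  (c1 c2 d1 d2 : R -> R) (a b : R) :
  a <= b ->
  (forall y, a <= y <= b -> is_derive c1 y (d1 y) /\ is_derive c2 y (d2 y)) ->
  (forall y, a <= y <= b ->
     differentiable_pt_lim psi (Rmin (c1 y) (c2 y)) y
       (- Q2 (Rmin (c1 y) (c2 y)) y) (Q1 (Rmin (c1 y) (c2 y)) y)) ->
  (forall y, a <= y <= b -> c1 y <= c2 y -> Q1 (c1 y) y - d1 y * Q2 (c1 y) y <= 0) ->
  (forall y, a <= y <= b -> c2 y <= c1 y -> Q1 (c2 y) y - d2 y * Q2 (c2 y) y <= 0) ->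
  psi (Rmin (c1 b) (c2 b)) b <= psi (Rmin (c1 a) (c2 a)) a.
Proof.
  intros Hab Hd Hpsi H1 H2.
  set (c := fun y => Rmin (c1 y) (c2 y)) in *.
  assert (Hcont : forall y, a <= y <= b -> continuity_pt c1 y /\ continuity_pt c2 y).
  { intros y Hy. destruct (Hd y Hy) as [D1 D2]. split; eapply is_derive_continuity_pt; eassumption. }
  (* Where [ci] is strictly the upper curve, it remains so nearby. *)
  assert (Hcurve : forall ci di, (forall y, c y <= ci y) ->
    (forall y, a <= y <= b -> is_derive ci y (di y)) ->
    (forall y, a <= y <= b -> ci y = c y -> Q1 (ci y) y - di y * Q2 (ci y) y <= 0) ->
    forall y, a <= y <= b -> forall eps, 0 < eps -> exists d, 0 < d /\
    forall h, 0 < h < d -> ci (y + h) = c (y + h) -> - psi (c y) y - eps * h <= - psi (c (y + h)) (y + h)).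
  { intros ci di Hle Hdi Hsign y Hy eps Heps.
    destruct (Rle_lt_or_eq_dec _ _ (Hle y)) as [Hlt|Hcy].
    { assert (C : continuity_pt (fun y => ci y - c y) y).
      { apply continuity_pt_minus; [eapply is_derive_continuity_pt, Hdi, Hy|].
        now apply continuity_pt_Rmin; apply Hcont. }
      destruct (continuity_pt_lt _ y 0 C) as [d [Hd0 K]]; [lra|].
      exists d; split; [exact Hd0|]. intros h Hh E. specialize (K (y + h)). rewrite E in K.
      replace (y + h - y) with h in K by ring. rewrite Rabs_pos_eq in K by lra.
      specialize (K ltac:(lra)). lra. }
    symmetry in Hcy.
    assert (D : derivable_pt_lim (fun t => psi (ci t) t) y (- Q2 (ci y) y * di y + Q1 (ci y) y * 1)).
    { apply (derivable_pt_lim_comp_2d psi ci (fun t => t)).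
      - rewrite Hcy. now apply Hpsi.
      - apply is_derive_Reals. now apply Hdi.
      - apply derivable_pt_lim_id. }
    apply is_derive_Reals in D. rewrite is_derive_R in D.
    destruct (D eps Heps) as [d [Hd0 K]]. exists d; split; [exact Hd0|]. intros h Hh E.
    specialize (K (y + h)). replace (y + h - y) with h in K by ring.
    rewrite (Rabs_pos_eq h) in K by lra. specialize (K ltac:(lra)).
    specialize (Hsign y Hy Hcy). rewrite E in K. rewrite Hcy in *.
    assert (K' := Rle_trans _ _ _ (Rle_abs _) K).
    assert ((Q1 (c y) y - di y * Q2 (c y) y) * h <= 0) by nra. lra. }
  apply Ropp_le_cancel.
  apply (nondecreasing_of_right_derivative (fun y => - psi (c y) y) a b Hab).
  - intros y Hy. apply continuity_pt_opp. apply continuity_pt_filterlim.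
    assert (Hdiff : differentiable_pt psi (c y) y) by (eexists; eexists; apply Hpsi, Hy).
    apply differentiable_continuity_pt in Hdiff. apply continuity_2d_pt_filterlim in Hdiff.
    destruct (Hcont y Hy) as [C1 C2].
    assert (Cc : continuity_pt c y) by now apply continuity_pt_Rmin.
    apply continuity_pt_filterlim in Cc.
    apply (continuous_comp_2 c (fun t => t) psi y Cc (continuous_id y) Hdiff).
  - intros y Hy eps Heps. assert (Hy' : a <= y <= b) by lra.
    destruct (Hcurve c1 d1 ltac:(intros; apply Rmin_l) ltac:(intros; now apply Hd)
      ltac:(intros z Hz Ez; apply H1; [exact Hz|rewrite Ez; apply Rmin_r]) y Hy' eps Heps) as [e1 [He1 K1]].
    destruct (Hcurve c2 d2 ltac:(intros; apply Rmin_r) ltac:(intros; now apply Hd)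
      ltac:(intros z Hz Ez; apply H2; [exact Hz|rewrite Ez; apply Rmin_l]) y Hy' eps Heps) as [e2 [He2 K2]].
    exists (Rmin e1 e2). split; [now apply Rmin_glb_lt|]. intros h Hh. rmin_facts.
    destruct (Rle_dec (c1 (y + h)) (c2 (y + h))) as [L|L]; [apply K1|apply K2]; try lra; unfold c.
    + now rewrite Rmin_left.
    + rewrite Rmin_right; lra.
Qed.

(** * Limits along filters *)

Lemma flim_plus {T} {F : (T -> Prop) -> Prop} {FF : Filter F} (a b : T -> R) (x y : R) :
  filterlim a F (locally x) -> filterlim b F (locally y) ->
  filterlim (fun t => a t + b t) F (locally (x + y)).
Proof. intros Ha Hb. exact (filterlim_comp_2 _ _ _ Ha Hb (filterlim_plus x y)). Qed.

Lemma flim_opp {T} {F : (T -> Prop) -> Prop} {FF : Filter F} (a : T -> R) (x : R) :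
  filterlim a F (locally x) -> filterlim (fun t => - a t) F (locally (- x)).
Proof. intros Ha. exact (filterlim_comp _ _ _ _ _ _ _ _ Ha (filterlim_opp x)). Qed.

Lemma flim_minus {T} {F : (T -> Prop) -> Prop} {FF : Filter F} (a b : T -> R) (x y : R) :
  filterlim a F (locally x) -> filterlim b F (locally y) ->
  filterlim (fun t => a t - b t) F (locally (x - y)).
Proof. intros Ha Hb. exact (flim_plus a _ x _ Ha (flim_opp b y Hb)). Qed.

Lemma flim_mult {T} {F : (T -> Prop) -> Prop} {FF : Filter F} (a b : T -> R) (x y : R) :
  filterlim a F (locally x) -> filterlim b F (locally y) ->
  filterlim (fun t => a t * b t) F (locally (x * y)).
Proof. intros Ha Hb. exact (filterlim_comp_2 _ _ _ Ha Hb (filterlim_mult x y)). Qed.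

Lemma flim_continuous {T} {F : (T -> Prop) -> Prop} {FF : Filter F} (g : R -> R) (a : T -> R) (x : R) :
  filterlim a F (locally x) -> continuous g x -> filterlim (fun t => g (a t)) F (locally (g x)).
Proof. intros Ha Hg. exact (filterlim_comp _ _ _ _ _ _ _ _ Ha Hg). Qed.

Lemma flim_div {T} {F : (T -> Prop) -> Prop} {FF : Filter F} (a b : T -> R) (x y : R) :
  filterlim a F (locally x) -> filterlim b F (locally y) -> y <> 0 ->
  filterlim (fun t => a t / b t) F (locally (x / y)).
Proof.
  intros Ha Hb Hy. apply (flim_mult a (fun t => / b t)); [exact Ha|].
  apply (flim_continuous Rinv b y Hb). now apply continuous_Rinv.
Qed.

Lemma flim_pow2 {T} {F : (T -> Prop) -> Prop} {FF : Filter F} (a : T -> R) (x : R) :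
  filterlim a F (locally x) -> filterlim (fun t => a t ^ 2) F (locally (x ^ 2)).
Proof.
  intros Ha. apply (flim_mult a (fun t => a t * 1)); [exact Ha|].
  apply (flim_mult a (fun _ => 1)); [exact Ha|apply filterlim_const].
Qed.

Lemma flim_sqrt {T} {F : (T -> Prop) -> Prop} {FF : Filter F} (a : T -> R) (x : R) :
  filterlim a F (locally x) -> filterlim (fun t => sqrt (a t)) F (locally (sqrt x)).
Proof. intros Ha. apply (flim_continuous sqrt a x Ha), continuous_sqrt. Qed.

Lemma flim_gt {T} {F : (T -> Prop) -> Prop} {FF : Filter F} (a : T -> R) (x c : R) :
  filterlim a F (locally x) -> c < x -> F (fun t => c < a t).
Proof. intros Ha Hc. apply (Ha (fun u => c < u)). now apply (open_gt c). Qed.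

Ltac flim :=
  repeat first
  [ assumption
  | apply filterlim_const
  | apply flim_pow2 | apply flim_sqrt
  | apply flim_plus | apply flim_minus | apply flim_mult | apply flim_opp ].

(** * Gas dynamics *)

Definition has_gradient (E : R * R -> Prop) (g gx gy : R * R -> R) : Prop :=
  forall x y, E (x, y) ->
    is_derive (fun t => g (t, y)) x (gx (x, y)) /\
    is_derive (fun t => g (x, t)) y (gy (x, y)).

Lemma is_derive_along_line (E D : R * R -> Prop) (g gx gy : R * R -> R) (x y al be t : R) :
  (forall z, E z -> D z) -> locally (x + t * al, y + t * be) E -> has_gradient E g gx gy ->
  continuous_on D gx -> continuous_on D gy ->
  is_derive (fun t => g (x + t * al, y + t * be)) t
    (gx (x + t * al, y + t * be) * al + gy (x + t * al, y + t * be) * be).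
Proof.
  intros HED Hopen Hg Cx Cy. apply is_derive_Reals.
  apply (derivable_pt_lim_comp_2d (fun a b => g (a, b)) (fun t => x + t * al) (fun t => y + t * be)).
  - apply (differentiable_of_partials (fun a b => g (a, b)) (fun a b => gx (a, b)) (fun a b => gy (a, b))).
    + apply locally_2d_locally. revert Hopen. apply filter_imp. intros [a b] Hab. exact (Hg a b Hab).
    + exact (continuity_2d_interior _ _ gx _ _ HED Hopen Cx).
    + exact (continuity_2d_interior _ _ gy _ _ HED Hopen Cy).
  - apply is_derive_Reals. auto_derive; [exact I|ring].
  - apply is_derive_Reals. auto_derive; [exact I|ring].
Qed.

Lemma gradient_of_constant (E : R * R -> Prop) (g gx gy : R * R -> R) (c : R) (q : R * R) :
  locally q E -> has_gradient E g gx gy -> (forall z, E z -> g z = c) -> E q -> gx q = 0 /\ gy q = 0.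
Proof.
  destruct q as [x y]. intros [d Hd] Hg Hc Hq. destruct (Hg x y Hq) as [D1 D2]. split.
  - rewrite <- (is_derive_unique _ _ _ D1). apply is_derive_unique.
    apply (is_derive_ext_near (fun _ => c) _ x 0 d (cond_pos d)); [|apply (is_derive_const c x)].
    intros t Ht. symmetry. apply Hc, Hd. split; [exact Ht|apply ball_center].
  - rewrite <- (is_derive_unique _ _ _ D2). apply is_derive_unique.
    apply (is_derive_ext_near (fun _ => c) _ y 0 d (cond_pos d)); [|apply (is_derive_const c y)].
    intros t Ht. symmetry. apply Hc, Hd. split; [apply ball_center|exact Ht].
Qed.

(** The nonconservative form of the system; the last equation says that the
    entropy is constant along streamlines. *)
Definition steady_gas_equations (gamma p u v r px py ux uy vx vy rx ry : R) : Prop :=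
  u * rx + r * ux + v * ry + r * vy = 0 /\
  r * (u * ux + v * uy) + px = 0 /\
  r * (u * vx + v * vy) + py = 0 /\
  u * px + v * py = gamma * p / r * (u * rx + v * ry).

Lemma sonic_sqr (gamma : R) (s : state) :
  0 < gamma -> 0 < pres s -> 0 < dens s -> sonic gamma s ^ 2 = gamma * pres s / dens s.
Proof.
  intros Hg Hp Hr. unfold sonic. rewrite pow2_sqrt; [reflexivity|].
  apply Rlt_le, Rdiv_lt_0_compat; [nra|lra].
Qed.

Ltac derive_facts H E D :=
  match type of H with is_derive ?g ?x ?l =>
    assert (E : ex_derive g x) by (now exists l);
    assert (D : Derive (fun t => g t) x = l) by exact (is_derive_unique _ _ _ H)
  end.

Lemma derive_fluxes (P U V D : R -> R) (x dp du dv dd : R) :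
  is_derive P x dp -> is_derive U x du -> is_derive V x dv -> is_derive D x dd ->
  Derive (fun t => D t * U t) x = dd * U x + D x * du /\
  Derive (fun t => D t * V t) x = dd * V x + D x * dv /\
  Derive (fun t => D t * U t ^ 2 + P t) x = dd * U x ^ 2 + D x * (2 * U x * du) + dp /\
  Derive (fun t => D t * V t ^ 2 + P t) x = dd * V x ^ 2 + D x * (2 * V x * dv) + dp /\
  Derive (fun t => D t * U t * V t) x = dd * U x * V x + D x * du * V x + D x * U x * dv.
Proof.
  intros HP HU HV HD.
  derive_facts HP EP DP. derive_facts HU EU DU. derive_facts HV EV DV. derive_facts HD ED DD.
  repeat split; apply is_derive_unique; auto_derive; repeat split; auto;
    rewrite ?DP, ?DU, ?DV, ?DD; ring.
Qed.

(** The Bernoulli law is an algebraic relation; differentiated along either axis, it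
    replaces the missing energy equation. *)
Lemma derive_bernoulli (g b : R) (P U V D : R -> R) (x dp du dv dd : R) :
  1 < g ->
  is_derive P x dp -> is_derive U x du -> is_derive V x dv -> is_derive D x dd ->
  0 < D x ->
  locally x (fun t => / 2 * (U t ^ 2 + V t ^ 2) + g * P t / D t / (g - 1) = b) ->
  U x * du + V x * dv + g / (g - 1) * (dp / D x - P x * dd / D x ^ 2) = 0.
Proof.
  intros Hg HP HU HV HD Hpos Hloc.
  derive_facts HP EP DP. derive_facts HU EU DU. derive_facts HV EV DV. derive_facts HD ED DD.
  assert (H : Derive (fun t => / 2 * (U t ^ 2 + V t ^ 2) + g * P t / D t / (g - 1)) x = 0).
  { rewrite (Derive_ext_loc _ (fun _ => b)); [apply Derive_const|exact Hloc]. }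
  rewrite <- H. symmetry. apply is_derive_unique. auto_derive; [repeat split; auto; lra|].
  rewrite DP, DU, DV, DD. field. lra.
Qed.

(** The momentum equations lose their conservative form by subtraction of [u] and
    [v] times the mass equation; multiplied by the velocity and combined with the
    derivatives of the Bernoulli law, they give the entropy equation. *)
Lemma gas_equations_of_euler (gamma b : R) (E : R * R -> Prop) (U : R * R -> state)
  (px py ux uy vx vy rx ry : R * R -> R) :
  1 < gamma ->
  (forall q, E q -> locally q E) ->
  (forall q, E q -> 0 < pres (U q) /\ 0 < dens (U q)) ->
  (forall x y, E (x, y) -> euler_at gamma b U x y) ->
  has_gradient E (fun q => pres (U q)) px py ->
  has_gradient E (fun q => velx (U q)) ux uy ->
  has_gradient E (fun q => vely (U q)) vx vy ->
  has_gradient E (fun q => dens (U q)) rx ry ->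
  forall q, E q ->
  steady_gas_equations gamma (pres (U q)) (velx (U q)) (vely (U q)) (dens (U q))
    (px q) (py q) (ux q) (uy q) (vx q) (vy q) (rx q) (ry q).
Proof.
  intros Hg Hopen Hpos Heu Gp Gu Gv Gr [x y] Eq.
  destruct (Gp x y Eq) as [Gpx Gpy]. destruct (Gu x y Eq) as [Gux Guy].
  destruct (Gv x y Eq) as [Gvx Gvy]. destruct (Gr x y Eq) as [Grx Gry].
  destruct (Hpos _ Eq) as [Pp Pr].
  destruct (Heu x y Eq) as (E1 & E2 & E3 & _).
  unfold mass_x, mass_y, momx_x, momx_y, momy_x, momy_y in E1, E2, E3.
  destruct (derive_fluxes _ _ _ _ _ _ _ _ _ Gpx Gux Gvx Grx) as (A1 & A2 & A3 & A4 & A5).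
  destruct (derive_fluxes _ _ _ _ _ _ _ _ _ Gpy Guy Gvy Gry) as (B1 & B2 & B3 & B4 & B5).
  cbv beta in *. change (AbsRing.sort R_AbsRing) with R in *.
  rewrite A1, B2 in E1. rewrite A3, B5 in E2. rewrite A5, B4 in E3.
  assert (HB : forall z, E z ->
    / 2 * (velx (U z) ^ 2 + vely (U z) ^ 2) + gamma * pres (U z) / dens (U z) / (gamma - 1) = b).
  { intros [z1 z2] Ez. destruct (Hpos _ Ez). destruct (Heu _ _ Ez) as (_ & _ & _ & HBz).
    unfold bernoulli in HBz. rewrite sonic_sqr in HBz by lra. exact HBz. }
  destruct (Hopen _ Eq) as [d Hd].
  assert (Bx := derive_bernoulli gamma b _ _ _ _ x _ _ _ _ Hg Gpx Gux Gvx Grx Pr).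
  assert (By := derive_bernoulli gamma b _ _ _ _ y _ _ _ _ Hg Gpy Guy Gvy Gry Pr).
  simpl in Bx, By.
  assert (Bx' := Bx ltac:(exists d; intros t Ht; apply HB, Hd; split; [exact Ht|apply ball_center])).
  assert (By' := By ltac:(exists d; intros t Ht; apply HB, Hd; split; [apply ball_center|exact Ht])).
  clear Bx By HB. simpl in *.
  set (p := pres (U (x, y))) in *. set (u := velx (U (x, y))) in *.
  set (v := vely (U (x, y))) in *. set (r := dens (U (x, y))) in *.
  set (Px := px (x, y)) in *. set (Py := py (x, y)) in *.
  set (Ux := ux (x, y)) in *. set (Uy := uy (x, y)) in *.
  set (Vx := vx (x, y)) in *. set (Vy := vy (x, y)) in *.
  set (Rx := rx (x, y)) in *. set (Ry := ry (x, y)) in *.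
  assert (M1 : u * Rx + r * Ux + v * Ry + r * Vy = 0) by lra.
  assert (M2 : r * (u * Ux + v * Uy) + Px = 0) by (apply (f_equal (Rmult u)) in M1; lra).
  assert (M3 : r * (u * Vx + v * Vy) + Py = 0) by (apply (f_equal (Rmult v)) in M1; lra).
  repeat split; try assumption.
  assert (Z1 : u * Ux + v * Vx = - (gamma / (gamma - 1) * (Px / r - p * Rx / r ^ 2))) by (simpl; lra).
  assert (Z2 : u * Uy + v * Vy = - (gamma / (gamma - 1) * (Py / r - p * Ry / r ^ 2))) by (simpl; lra).
  assert (Z3 : r * (u * (u * Ux + v * Vx) + v * (u * Uy + v * Vy)) + (u * Px + v * Py) = 0).
  { transitivity (u * (r * (u * Ux + v * Uy) + Px) + v * (r * (u * Vx + v * Vy) + Py)); [ring|].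
    rewrite M2, M3; ring. }
  rewrite Z1, Z2 in Z3.
  apply (Rmult_eq_reg_l (/ (gamma - 1))); [|apply Rinv_neq_0_compat; lra].
  transitivity (- (r * (u * - (gamma / (gamma - 1) * (Px / r - p * Rx / r ^ 2)) +
      v * - (gamma / (gamma - 1) * (Py / r - p * Ry / r ^ 2))) + (u * Px + v * Py))
      + gamma * p / r * (u * Rx + v * Ry) / (gamma - 1) + 2 * (u * Px + v * Py) * 0
      + 0); [field; lra|].
  rewrite Z3. field. lra.
Qed.

(** The last equation says that the square of the incoming normal Mach number is
    [1 + (gamma + 1) / (2 gamma) * (p_+ - p_-) / p_-]. *)
Lemma rankine_hugoniot_normal (gamma b s : R) (sm sp : state) :
  1 < gamma -> 0 < dens sm -> 0 < dens sp -> 0 < pres sm -> 0 < pres sp ->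
  bernoulli gamma sm = b -> bernoulli gamma sp = b ->
  rankine_hugoniot s sm sp ->
  dens sm * (velx sm - s * vely sm) = dens sp * (velx sp - s * vely sp) /\
  dens sm * (velx sm - s * vely sm) * (velx sp - velx sm) = - (pres sp - pres sm) /\
  dens sm * (velx sm - s * vely sm) * (vely sp - vely sm) = s * (pres sp - pres sm) /\
  dens sm * (velx sm - s * vely sm) ^ 2 =
    (1 + s ^ 2) * (gamma * pres sm + (gamma + 1) / 2 * (pres sp - pres sm)).
Proof.
  intros Hg Hr1 Hr2 Hp1 Hp2 HB1 HB2 (R1 & R2 & R3 & R4).
  unfold bernoulli in HB1, HB2. rewrite sonic_sqr in HB1, HB2 by lra.
  unfold jump, mass_x, mass_y, momx_x, momx_y, momy_x, momy_y in *.
  destruct sm as [p1 u1 v1 r1], sp as [p2 u2 v2 r2]; simpl pres in *; simpl velx in *;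
    simpl vely in *; simpl dens in *.
  assert (Q1 : r1 * (u1 - s * v1) = r2 * (u2 - s * v2)) by lra.
  assert (Q2 : r1 * (u1 - s * v1) * (u2 - u1) = - (p2 - p1)).
  { transitivity (u2 * (r1 * (u1 - s * v1)) - r1 * (u1 - s * v1) * u1); [ring|].
    rewrite Q1 at 1. lra. }
  assert (Q3 : r1 * (u1 - s * v1) * (v2 - v1) = s * (p2 - p1)).
  { transitivity (v2 * (r1 * (u1 - s * v1)) - r1 * (u1 - s * v1) * v1); [ring|].
    rewrite Q1 at 1. lra. }
  repeat split; try assumption.
  assert (Hn : u1 - s * v1 <> 0) by (intros Hn; rewrite Hn in Q2; lra).
  assert (Hn2 : u2 - s * v2 <> 0) by (intros Hn2; rewrite Q1, Hn2 in Q2; lra).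
  set (n := u1 - s * v1) in *. set (P := p2 - p1) in *.
  assert (Eu : u2 = u1 - P / (r1 * n)).
  { apply (Rmult_eq_reg_l (r1 * n)); [|nra]. transitivity (r1 * n * u1 - P); [lra|field; split; [exact Hn|lra]]. }
  assert (Ev : v2 = v1 + s * P / (r1 * n)).
  { apply (Rmult_eq_reg_l (r1 * n)); [|nra]. transitivity (r1 * n * v1 + s * P); [lra|field; split; [exact Hn|lra]]. }
  assert (Ei : / r2 = (n - P * (1 + s ^ 2) / (r1 * n)) / (r1 * n)).
  { replace (n - P * (1 + s ^ 2) / (r1 * n)) with (u2 - s * v2)
      by (rewrite Eu, Ev; unfold n; field; split; [exact Hn|lra]).
    rewrite Q1. field. split; [exact Hn2|lra]. }
  assert (Hb : / 2 * (u2 ^ 2 + v2 ^ 2) + gamma * p2 * / r2 / (gamma - 1)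
               = / 2 * (u1 ^ 2 + v1 ^ 2) + gamma * p1 / r1 / (gamma - 1)) by (rewrite HB1; exact HB2).
  rewrite Ei, Eu, Ev in Hb.
  assert (Ep2 : p2 = p1 + P) by (unfold P; ring).
  assert (Eu1 : u1 = n + s * v1) by (unfold n; ring).
  clearbody n P. subst p2 u1.
  apply (Rmult_eq_reg_l (P / (r1 * n) ^ 2 / (gamma - 1))).
  2:{ apply Rmult_integral_contrapositive_currified; [|apply Rinv_neq_0_compat; lra].
      apply Rmult_integral_contrapositive_currified; [lra|apply Rinv_neq_0_compat, pow_nonzero; nra]. }
  apply Rminus_diag_uniq.
  apply Rminus_diag_eq in Hb. rewrite <- Hb. field. repeat split; lra || exact Hn.
Qed.

Lemma mach0_sqr (gamma p0 u0 rho0 : R) :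
  1 < gamma -> 0 < p0 -> 0 < u0 -> 0 < rho0 ->
  mach0 gamma p0 u0 rho0 ^ 2 * (gamma * p0) = rho0 * u0 ^ 2.
Proof.
  intros Hg Hp Hu Hr. unfold mach0.
  assert (Hq : 0 < gamma * p0 / rho0) by (apply Rdiv_lt_0_compat; nra).
  replace ((u0 / sqrt (gamma * p0 / rho0)) ^ 2) with (u0 ^ 2 / (gamma * p0 / rho0)).
  - field. repeat split; lra.
  - rewrite <- (pow2_sqrt (gamma * p0 / rho0)) at 1 by lra. field.
    apply Rgt_not_eq, sqrt_lt_R0, Hq.
Qed.

Definition flow_continuous_on (D : R * R -> Prop) (U : R * R -> state) : Prop :=
  continuous_on D (fun q => pres (U q)) /\ continuous_on D (fun q => velx (U q)) /\
  continuous_on D (fun q => vely (U q)) /\ continuous_on D (fun q => dens (U q)).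

Lemma regular_flow_continuous (E : R * R -> Prop) (U : R * R -> state) :
  regular_flow E U -> flow_continuous_on (closure E) U.
Proof. intros ((H1 & _) & (H2 & _) & (H3 & _) & (H4 & _)). now repeat split. Qed.

Lemma bernoulli_closure (gamma b : R) (E : R * R -> Prop) (U : R * R -> state) (q : R * R) :
  1 < gamma -> flow_continuous_on (closure E) U ->
  (forall q, closure E q -> 0 < pres (U q) /\ 0 < dens (U q)) ->
  (forall q, E q -> bernoulli gamma (U q) = b) ->
  closure E q -> bernoulli gamma (U q) = b.
Proof.
  intros Hg (C1 & C2 & C3 & C4) Hpos HB Hq.
  apply (closure_value E (closure E) (fun q => bernoulli gamma (U q)) q b).
  - apply subset_closure.
  - exact Hq.
  - unfold bernoulli, sonic.
    specialize (C1 q Hq). specialize (C2 q Hq). specialize (C3 q Hq). specialize (C4 q Hq).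
    destruct (Hpos q Hq) as [P1 P2].
    assert (FF : Filter (within (closure E) (locally q))) by (apply within_filter, locally_filter).
    apply flim_plus; [flim|]. apply flim_mult; [|apply filterlim_const].
    apply flim_pow2, flim_sqrt. apply flim_div; [flim|exact C4|lra].
  - exact HB.
Qed.

(** * The relative entropy flux *)

(** Isentropically, the enthalpy difference [int_p0^p dp' / rho(p')] exceeds
    [(p - p0) / rho] by a quadratic term, since [1 / rho] decreases with the
    pressure; here [r = p0 / p].  For [r > 1] the quadratic bound degrades, by the
    factor [r ^ 2] only. *)
Lemma isentropic_convexity (gamma r : R) :
  1 < gamma -> 0 < r ->
  (1 - r) ^ 2 / (2 * gamma * Rmax 1 r ^ 2) <=
  gamma / (gamma - 1) * (1 - r * exp (- (ln r / gamma))) - (1 - r).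
Proof.
  intros Hg Hr.
  set (F := fun r => gamma / (gamma - 1) * (1 - r * exp (- (ln r / gamma))) - (1 - r)).
  assert (dF : forall t, 0 < t -> is_derive F t (1 - exp (- (ln t / gamma)))).
  { intros t Ht. unfold F. auto_derive; [exact Ht|]. unfold Rdiv; set (zz := exp _); field. repeat split; lra. }
  assert (F1 : F 1 = 0) by (unfold F; rewrite ln_1; replace (- (0 / gamma)) with 0 by (field; lra); rewrite exp_0; field; lra).
  assert (dln : forall t, 0 < t -> ln t <= t - 1).
  { intros t Ht. pose proof (exp_ineq1_le (ln t)). rewrite exp_ln in H by exact Ht. lra. }
  destruct (Rle_or_lt r 1) as [Hr1|Hr1].
  - rewrite Rmax_left by exact Hr1.
    destruct (mean_value (fun t => F t - (1 - t) ^ 2 / (2 * gamma))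
       (fun t => (1 - exp (- (ln t / gamma))) + (1 - t) / gamma) r 1) as [t [Ht Et]].
    { intros t Ht. rewrite Rmin_left, Rmax_right in Ht by lra.
      replace (1 - exp (- (ln t / gamma)) + (1 - t) / gamma) with
        ((1 - exp (- (ln t / gamma))) - (- (1 - t) / gamma)) by (field; lra).
      apply (is_derive_minus F (fun t => (1 - t) ^ 2 / (2 * gamma))); [apply dF; lra|].
      auto_derive; [exact I|]. field. lra. }
    rewrite Rmin_left, Rmax_right in Ht by lra.
    rewrite F1 in Et.
    assert (1 + (1 - t) / gamma <= exp (- (ln t / gamma))).
    { eapply Rle_trans; [|apply exp_ineq1_le]. apply Rplus_le_compat_l.
      replace (- (ln t / gamma)) with ((- ln t) / gamma) by (field; lra).
      apply Rmult_le_compat_r; [apply Rlt_le, Rinv_0_lt_compat; lra|].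
      pose proof (dln t ltac:(lra)). lra. }
    fold (F r). replace (2 * gamma * 1 ^ 2) with (2 * gamma) by ring.
    replace ((1 - 1) ^ 2 / (2 * gamma)) with 0 in Et by (field; lra). nra.
  - rewrite Rmax_right by lra. fold (F r).
    destruct (mean_value (fun t => F t - (1 - / t) ^ 2 / (2 * gamma))
       (fun t => (1 - exp (- (ln t / gamma))) - (1 - / t) / (gamma * t ^ 2)) 1 r) as [t [Ht Et]].
    { intros t Ht. rewrite Rmin_left, Rmax_right in Ht by lra.
      apply (is_derive_minus F (fun t => (1 - / t) ^ 2 / (2 * gamma))); [apply dF; lra|].
      auto_derive; [lra|]. field. lra. }
    rewrite Rmin_left, Rmax_right in Ht by lra.
    rewrite F1 in Et.
    replace ((1 - / 1) ^ 2 / (2 * gamma)) with 0 in Et by (field; lra).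
    replace ((1 - / r) ^ 2 / (2 * gamma)) with ((1 - r) ^ 2 / (2 * gamma * r ^ 2)) in Et by (field; lra).
    assert (Hi : 0 < / t <= 1) by (split; [apply Rinv_0_lt_compat; lra|rewrite <- Rinv_1; apply Rinv_le_contravar; lra]).
    assert (Hit : / t * t = 1) by (field; lra).
    set (i := / t) in *. set (w := (1 - i) / gamma).
    assert (Hw : 0 <= w <= 1 - i).
    { unfold w. split; [apply Rmult_le_pos; [lra|apply Rlt_le, Rinv_0_lt_compat; lra]|].
      rewrite <- (Rmult_1_r (1 - i)) at 2. apply Rmult_le_compat_l; [lra|].
      rewrite <- Rinv_1; apply Rinv_le_contravar; lra. }
    assert (Hln : 1 - i <= ln t).
    { pose proof (dln i ltac:(lra)). unfold i in H at 1. rewrite ln_Rinv in H by lra. lra. }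
    set (E := exp (- (ln t / gamma))) in *.
    assert (HE : E * (1 + w) <= 1).
    { unfold E. rewrite exp_Ropp. pose proof (exp_ineq1_le (ln t / gamma)).
      assert (w <= ln t / gamma) by (apply Rmult_le_compat_r; [apply Rlt_le, Rinv_0_lt_compat; lra|exact Hln]).
      apply (Rmult_le_reg_l (exp (ln t / gamma))); [apply exp_pos|].
      rewrite <- Rmult_assoc, Rinv_r by (apply Rgt_not_eq, exp_pos). lra. }
    assert (HE0 : 0 < E) by apply exp_pos.
    replace ((1 - i) / (gamma * t ^ 2)) with (w * i ^ 2) in Et by (unfold w, i; field; lra).
    assert (K1 : w * i ^ 2 * (1 + w) <= w).
    { assert (i ^ 2 * (1 + w) <= 1); [|nra].
      assert (i ^ 2 * (1 + w) <= i ^ 2 * (2 - i)) by (apply Rmult_le_compat_l; nra). nra. }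
    assert (K2 : w * i ^ 2 <= 1 - E).
    { apply (Rmult_le_reg_r (1 + w)); [lra|]. nra. }
    nra.
Qed.

(** The hypothesis on [q] says that the coefficient [1 / q] of [X Y] is less than
    twice the geometric mean of the coefficients of [X ^ 2] and [Y ^ 2]. *)
Lemma quadratic_form_neg (X Y c q s R : R) :
  0 < c -> 0 < R -> c * R * sqrt (1 + s ^ 2) < q ->
  X * Y / q - X ^ 2 / (2 * c ^ 2 * R ^ 2) - Y ^ 2 / (2 * (1 + s ^ 2)) <= 0 /\
  (X * Y / q - X ^ 2 / (2 * c ^ 2 * R ^ 2) - Y ^ 2 / (2 * (1 + s ^ 2)) = 0 -> X = 0).
Proof.
  intros Hc HR Hq.
  assert (Hs : 0 < 1 + s ^ 2) by nra.
  assert (Hk : 0 < sqrt (1 + s ^ 2)) by now apply sqrt_lt_R0.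
  assert (Hk2 : sqrt (1 + s ^ 2) ^ 2 = 1 + s ^ 2) by (apply pow2_sqrt; lra).
  rewrite <- Hk2. set (k := sqrt (1 + s ^ 2)) in *. clearbody k.
  assert (Hcr : 0 < c * R * k) by (repeat apply Rmult_lt_0_compat; assumption).
  set (a := X / (c * R)). set (b := Y / k). set (th := c * R * k / q).
  assert (Hth : 0 < th < 1).
  { unfold th. split; [apply Rdiv_lt_0_compat; lra|]. apply (Rmult_lt_reg_r q); [lra|].
    unfold Rdiv; rewrite Rmult_assoc, Rinv_l by lra. lra. }
  replace (X * Y / q - X ^ 2 / (2 * c ^ 2 * R ^ 2) - Y ^ 2 / (2 * k ^ 2)) with
    (th * a * b - a ^ 2 / 2 - b ^ 2 / 2) by (unfold th, a, b; field; lra).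
  split.
  - pose proof (pow2_ge_0 (a - b)). pose proof (pow2_ge_0 (a + b)). nra.
  - intros H. assert (a = 0).
    { destruct (Req_dec a 0) as [|Ha]; [assumption|]. exfalso.
      assert (0 < a ^ 2) by (apply pow2_gt_0; exact Ha).
      pose proof (pow2_ge_0 (b - th * a)).
      assert (th ^ 2 < 1) by nra.
      assert (0 < (1 - th ^ 2) * a ^ 2) by (apply Rmult_lt_0_compat; lra). lra. }
    unfold a in H0. replace X with (X / (c * R) * (c * R)) by (field; lra). rewrite H0; ring.
Qed.

Definition stagnation_enthalpy (gamma p0 rho0 : R) : R := gamma * p0 / ((gamma - 1) * rho0).

(** The factor of the velocity in the relative flux.  The first term is
    [rho h0 sigma], where [sigma = (p / p0)^(1/gamma) rho0 / rho] is the function of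
    the entropy in which the enthalpy at fixed pressure is linear. *)
Definition relative_potential (gamma p0 u0 rho0 p u r : R) : R :=
  let h0 := stagnation_enthalpy gamma p0 rho0 in
  rho0 * h0 * exp (ln (p / p0) / gamma) - r * h0 + r * u0 * (u - u0).

Definition relative_flux_x (gamma p0 u0 rho0 : R) (s : state) : R :=
  velx s * relative_potential gamma p0 u0 rho0 (pres s) (velx s) (dens s) + u0 * (pres s - p0).

Definition relative_flux_y (gamma p0 u0 rho0 : R) (s : state) : R :=
  vely s * relative_potential gamma p0 u0 rho0 (pres s) (velx s) (dens s).

(** A curve of slope [s = dx/dy] is crossed supersonically when the normal velocity
    exceeds the sound speed.  The second condition asks this with the factor
    [p0 / p], to compensate for the degradation in [isentropic_convexity]. *)
Definition spacelike (gamma p0 s : R) (U : state) : Prop :=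
  sonic gamma U * sqrt (1 + s ^ 2) < velx U - s * vely U /\
  p0 * (sonic gamma U * sqrt (1 + s ^ 2)) < pres U * (velx U - s * vely U).

(** With the Bernoulli law, the flux divided by [rho (u - s v)] is
    [X Y / q - int_p0^p (1/rho(p') - 1/rho) dp' - |U - U0|^2 / 2], where
    [q = u - s v], [X = (p - p0) / rho] and [Y = u0 - q]. *)
Lemma relative_flux_definite (gamma p0 u0 rho0 s : R) (U : state) :
  1 < gamma -> 0 < p0 -> 0 < u0 -> 0 < rho0 -> 0 < pres U -> 0 < dens U ->
  bernoulli gamma U = b0 gamma p0 u0 rho0 ->
  spacelike gamma p0 s U ->
  relative_flux_x gamma p0 u0 rho0 U - s * relative_flux_y gamma p0 u0 rho0 U <= 0 /\
  (relative_flux_x gamma p0 u0 rho0 U - s * relative_flux_y gamma p0 u0 rho0 U = 0 ->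
   U = upstream p0 u0 rho0).
Proof.
  intros Hg Hp0 Hu0 Hr0 Hp Hr HB [Hq1 Hq2].
  assert (Hc2 := sonic_sqr gamma U ltac:(lra) Hp Hr).
  unfold bernoulli in HB. rewrite Hc2 in HB. unfold b0 in HB.
  assert (Hc : 0 < sonic gamma U).
  { unfold sonic. apply sqrt_lt_R0, Rdiv_lt_0_compat; [nra|lra]. }
  set (c := sonic gamma U) in *. clearbody c.
  destruct U as [p u v r]; unfold relative_flux_x, relative_flux_y, upstream;
    simpl pres in *; simpl velx in *; simpl vely in *; simpl dens in *.
  set (q := u - s * v) in *.
  assert (Hk : 0 < sqrt (1 + s ^ 2)) by (apply sqrt_lt_R0; nra).
  assert (Hq : 0 < q) by nra.
  set (rr := p0 / p). assert (Hrr : 0 < rr) by (apply Rdiv_lt_0_compat; lra).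
  assert (HR : c * Rmax 1 rr * sqrt (1 + s ^ 2) < q).
  { unfold Rmax. destruct (Rle_dec 1 rr); [|lra].
    apply (Rmult_lt_reg_l p); [exact Hp|].
    replace (p * (c * rr * sqrt (1 + s ^ 2))) with (p0 * (c * sqrt (1 + s ^ 2))) by (unfold rr; field; lra).
    exact Hq2. }
  assert (HR0 : 0 < Rmax 1 rr) by (eapply Rlt_le_trans; [apply Rlt_0_1|apply Rmax_l]).
  pose proof (isentropic_convexity gamma rr Hg Hrr) as HF.
  assert (Eln : ln (p / p0) = - ln rr).
  { unfold rr. rewrite <- ln_Rinv by exact Hrr. f_equal. field. lra. }
  unfold relative_potential. rewrite Eln.
  replace (- ln rr / gamma) with (- (ln rr / gamma)) by (field; lra).
  set (z := exp (- (ln rr / gamma))) in *.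
  set (h0 := stagnation_enthalpy gamma p0 rho0).
  set (X := (p - p0) / r). set (Y := u0 - q).
  set (FF := gamma / (gamma - 1) * (1 - rr * z) - (1 - rr)) in *.
  set (W := (u - u0) ^ 2 + v ^ 2).
  assert (HY : Y ^ 2 <= (1 + s ^ 2) * W).
  { unfold Y, q, W. pose proof (pow2_ge_0 (s * (u - u0) + v)). nra. }
  assert (Hbern : u0 * (u - u0) = h0 - gamma * p / r / (gamma - 1) - / 2 * W).
  { unfold h0, stagnation_enthalpy, W. lra. }
  assert (Eflux : u * (rho0 * h0 * z - r * h0 + r * u0 * (u - u0)) + u0 * (p - p0)
     - s * (v * (rho0 * h0 * z - r * h0 + r * u0 * (u - u0))) =
     r * q * (X * Y / q - p / r * FF - / 2 * W)).
  { replace (r * u0 * (u - u0)) with (r * (u0 * (u - u0))) by ring. rewrite Hbern.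
    assert (Eh : rho0 * h0 * z - r * h0 + r * (h0 - gamma * p / r / (gamma - 1) - / 2 * W)
       = - (p - p0) - p * FF - r / 2 * W).
    { unfold FF, h0, stagnation_enthalpy, rr. field. repeat split; lra. }
    rewrite Eh.
    replace (u * (- (p - p0) - p * FF - r / 2 * W) + u0 * (p - p0) - s * (v * (- (p - p0) - p * FF - r / 2 * W)))
      with (q * (- (p - p0) - p * FF - r / 2 * W) + u0 * (p - p0)) by (unfold q; ring).
    unfold X, Y. field. lra. }
  rewrite Eflux.
  assert (HFF : X ^ 2 / (2 * c ^ 2 * Rmax 1 rr ^ 2) <= p / r * FF).
  { replace (X ^ 2 / (2 * c ^ 2 * Rmax 1 rr ^ 2)) with (p / r * ((1 - rr) ^ 2 / (2 * gamma * Rmax 1 rr ^ 2))).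
    - apply Rmult_le_compat_l; [apply Rlt_le, Rdiv_lt_0_compat; lra|exact HF].
    - rewrite Hc2. unfold X. replace ((1 - rr) ^ 2) with ((p - p0) ^ 2 / p ^ 2) by (unfold rr; field; lra).
      field. repeat split; lra. }
  destruct (quadratic_form_neg X Y c q s (Rmax 1 rr) Hc HR0 HR) as [Q1 Q2].
  assert (HY2 : Y ^ 2 / (2 * (1 + s ^ 2)) <= / 2 * W).
  { apply (Rmult_le_reg_r (2 * (1 + s ^ 2))); [nra|]. unfold Rdiv.
    rewrite Rmult_assoc, Rinv_l by nra. lra. }
  assert (Hrq : 0 < r * q) by now apply Rmult_lt_0_compat.
  split; [nra|]. intros H0.
  assert (H1 : X * Y / q - p / r * FF - / 2 * W = 0) by nra.
  assert (X0 : X = 0) by (apply Q2; lra).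
  assert (Ep : p = p0).
  { unfold X in X0. assert (p - p0 = 0); [|lra]. replace (p - p0) with ((p - p0) / r * r) by (field; lra). rewrite X0; ring. }
  assert (W0 : W = 0).
  { rewrite X0 in H1, HFF. replace (0 ^ 2 / (2 * c ^ 2 * Rmax 1 rr ^ 2)) with 0 in HFF by (field; split; lra).
    replace (0 * Y / q) with 0 in H1 by (field; lra). unfold W in *.
    pose proof (pow2_ge_0 (u - u0)). pose proof (pow2_ge_0 v). lra. }
  destruct (Rplus_sqr_eq_0 (u - u0) v) as [Eu Ev]; [unfold W, Rsqr in *; lra|]. apply Rminus_diag_uniq in Eu.
  subst p u v. f_equal.
  assert (Er : gamma * p0 / r / (gamma - 1) = gamma * p0 / ((gamma - 1) * rho0)) by lra.
  assert (Er2 : / r = / rho0).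
  { apply (Rmult_eq_reg_l (gamma * p0 / (gamma - 1))).
    - transitivity (gamma * p0 / r / (gamma - 1)); [field; lra|]. rewrite Er. field. lra.
    - apply Rgt_not_eq, Rdiv_lt_0_compat; nra. }
  rewrite <- (Rinv_inv r), Er2, Rinv_inv. reflexivity.
Qed.

Lemma relative_flux_upstream (gamma p0 u0 rho0 : R) :
  1 < gamma -> 0 < p0 ->
  relative_flux_x gamma p0 u0 rho0 (upstream p0 u0 rho0) = 0 /\
  relative_flux_y gamma p0 u0 rho0 (upstream p0 u0 rho0) = 0.
Proof.
  intros Hg Hp. unfold relative_flux_x, relative_flux_y, relative_potential; simpl.
  replace (p0 / p0) with 1 by (field; lra). rewrite ln_1.
  replace (0 / gamma) with 0 by (field; lra). rewrite exp_0. split; ring.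
Qed.

Definition relative_flux_dy (gamma p0 u0 rho0 : R) (U : state) (py uy vy ry : R) : R :=
  vy * relative_potential gamma p0 u0 rho0 (pres U) (velx U) (dens U) +
  vely U * (rho0 * stagnation_enthalpy gamma p0 rho0 *
      (exp (ln (pres U / p0) / gamma) * (py / (gamma * pres U)))
    - ry * stagnation_enthalpy gamma p0 rho0
    + ry * u0 * (velx U - u0) + dens U * u0 * uy).

Lemma derive_relative_flux (g p0 u0 h k x : R) (A V P D : R -> R) (da dv dp dd : R) :
  g <> 0 -> 0 < p0 -> 0 < P x ->
  is_derive A x da -> is_derive V x dv -> is_derive P x dp -> is_derive D x dd ->
  is_derive (fun t => A t * (k * exp (ln (P t / p0) / g) - D t * h + D t * u0 * (V t - u0))) x
    (da * (k * exp (ln (P x / p0) / g) - D x * h + D x * u0 * (V x - u0)) +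
     A x * (k * (exp (ln (P x / p0) / g) * (dp / (g * P x))) - dd * h
            + dd * u0 * (V x - u0) + D x * u0 * dv)).
Proof.
  intros Hg Hp0 Hp HA HV HP HD.
  derive_facts HP EP DP. derive_facts HA EA DA. derive_facts HV EV DV. derive_facts HD ED DD.
  assert (Hq : 0 < P x * / p0) by (apply Rdiv_lt_0_compat; lra).
  auto_derive; [repeat split; auto|].
  rewrite DP, DA, DV, DD. unfold Rdiv. set (z := exp _). field. lra.
Qed.

(** The field combines the mass, momentum and entropy fluxes, which are
    divergence-free. *)
Lemma relative_flux_divergence_free (gamma p0 u0 rho0 b : R) (E : R * R -> Prop)
  (U : R * R -> state) (px py ux uy vx vy rx ry : R * R -> R) :
  1 < gamma -> 0 < p0 ->
  (forall q, E q -> locally q E) ->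
  (forall q, E q -> 0 < pres (U q) /\ 0 < dens (U q)) ->
  (forall x y, E (x, y) -> euler_at gamma b U x y) ->
  has_gradient E (fun q => pres (U q)) px py ->
  has_gradient E (fun q => velx (U q)) ux uy ->
  has_gradient E (fun q => vely (U q)) vx vy ->
  has_gradient E (fun q => dens (U q)) rx ry ->
  forall x y, E (x, y) ->
  let B := relative_flux_dy gamma p0 u0 rho0 (U (x, y))
             (py (x, y)) (uy (x, y)) (vy (x, y)) (ry (x, y)) in
  is_derive (fun t => relative_flux_x gamma p0 u0 rho0 (U (t, y))) x (- B) /\
  is_derive (fun t => relative_flux_y gamma p0 u0 rho0 (U (x, t))) y B.
Proof.
  intros Hg Hp0 Hopen Hpos Heu Gp Gu Gv Gr x y Exy B.
  destruct (gas_equations_of_euler gamma b E U px py ux uy vx vy rx ry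
    Hg Hopen Hpos Heu Gp Gu Gv Gr (x, y) Exy) as (M1 & M2 & _ & M4).
  destruct (Hpos _ Exy) as [Pp Pr].
  destruct (Gp x y Exy) as [Gpx Gpy]. destruct (Gu x y Exy) as [Gux Guy].
  destruct (Gv x y Exy) as [Gvx Gvy]. destruct (Gr x y Exy) as [Grx Gry].
  unfold relative_flux_x, relative_flux_y, relative_potential, B, relative_flux_dy, relative_potential.
  cbv zeta. set (h0 := stagnation_enthalpy gamma p0 rho0).
  split.
  - assert (Dx := derive_relative_flux gamma p0 u0 h0 (rho0 * h0) x _ _ _ _ _ _ _ _
      ltac:(lra) Hp0 Pp Gux Gux Gpx Grx).
    assert (Dp := is_derive_scal _ x u0 _ (is_derive_minus _ _ x _ _ Gpx (is_derive_const p0 x))).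
    assert (Ds := is_derive_plus _ _ x _ _ Dx Dp).
    unfold plus, minus, opp, zero in Ds; simpl in Ds.
    match type of Ds with is_derive _ _ ?D => match goal with |- is_derive _ _ ?D' =>
      assert (ED : D' = D); [|rewrite ED; exact Ds] end end.
    clear Dx Dp Ds.
    set (p := pres (U (x, y))) in *. set (u := velx (U (x, y))) in *.
    set (v := vely (U (x, y))) in *. set (r := dens (U (x, y))) in *.
    set (z := exp _).
    set (T := u * rx (x, y) + v * ry (x, y)) in *.
    assert (T1 : ux (x, y) = - (T / r) - vy (x, y)).
    { apply (Rmult_eq_reg_l r); [|lra]. replace (r * (- (T / r) - vy (x, y))) with (- T - r * vy (x, y)) by (field; lra). unfold T; lra. }
    symmetry. apply Rminus_diag_uniq.
    match goal with |- ?L = 0 => assert (HH : L =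
      (rho0 * h0 * z - r * h0 + r * u0 * (u - u0)) * (ux (x, y) + vy (x, y))
      + rho0 * h0 * z * / (gamma * p) * (u * px (x, y) + v * py (x, y))
      + (u0 * (u - u0) - h0) * T
      + u0 * (r * (u * ux (x, y) + v * uy (x, y)) + px (x, y))) end.
    { unfold T, plus; simpl. field. lra. }
    rewrite HH, M2, M4, T1. field. lra.
  - exact (derive_relative_flux gamma p0 u0 h0 (rho0 * h0) y _ _ _ _ _ _ _ _
      ltac:(lra) Hp0 Pp Gvy Guy Gpy Gry).
Qed.

Lemma continuity_2d_relative_flux (gamma p0 u0 rho0 : R) (U : R -> R -> state) (x y : R) :
  1 < gamma -> 0 < p0 -> 0 < pres (U x y) ->
  continuity_2d_pt (fun a b => pres (U a b)) x y ->
  continuity_2d_pt (fun a b => velx (U a b)) x y ->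
  continuity_2d_pt (fun a b => vely (U a b)) x y ->
  continuity_2d_pt (fun a b => dens (U a b)) x y ->
  continuity_2d_pt (fun a b => exp (ln (pres (U a b) / p0) / gamma)) x y /\
  continuity_2d_pt (fun a b => relative_potential gamma p0 u0 rho0 (pres (U a b)) (velx (U a b)) (dens (U a b))) x y /\
  continuity_2d_pt (fun a b => relative_flux_x gamma p0 u0 rho0 (U a b)) x y /\
  continuity_2d_pt (fun a b => relative_flux_y gamma p0 u0 rho0 (U a b)) x y.
Proof.
  intros Hg Hp0 Hp Cp Cu Cv Cr.
  assert (C0 : continuity_2d_pt (fun a b => exp (ln (pres (U a b) / p0) / gamma)) x y).
  { apply (continuity_1d_2d_pt_comp (fun p => exp (ln (p / p0) / gamma))); [|exact Cp].
    apply (is_derive_continuity_pt _ _ (exp (ln (pres (U x y) / p0) / gamma) * / (gamma * pres (U x y)))).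
    assert (0 < pres (U x y) * / p0) by (apply Rdiv_lt_0_compat; lra).
    auto_derive; [assumption|]. unfold Rdiv. set (z := exp _). field. lra. }
  assert (C1 : continuity_2d_pt (fun a b => relative_potential gamma p0 u0 rho0 (pres (U a b)) (velx (U a b)) (dens (U a b))) x y).
  { unfold relative_potential. cbv zeta. cont2d. }
  repeat split; [exact C0|exact C1| |].
  - unfold relative_flux_x. cont2d.
  - unfold relative_flux_y. cont2d.
Qed.

Lemma continuity_2d_Rmax0 (x y : R) : continuity_2d_pt (fun u _ => Rmax 0 u) x y.
Proof.
  intros eps. exists eps. intros u v Hu _.
  apply Rabs_def2 in Hu. unfold Rmax; destruct (Rle_dec 0 u), (Rle_dec 0 x); apply Rabs_def1; lra.
Qed.

Lemma spacelike_eventually {T} {F : (T -> Prop) -> Prop} {FF : Filter F}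
  (gamma p0 s0 : R) (U0 : state) (U : T -> state) (s : T -> R) :
  filterlim (fun t => pres (U t)) F (locally (pres U0)) ->
  filterlim (fun t => velx (U t)) F (locally (velx U0)) ->
  filterlim (fun t => vely (U t)) F (locally (vely U0)) ->
  filterlim (fun t => dens (U t)) F (locally (dens U0)) ->
  filterlim s F (locally s0) ->
  0 < dens U0 -> spacelike gamma p0 s0 U0 ->
  F (fun t => spacelike gamma p0 (s t) (U t)).
Proof.
  intros Hp Hu Hv Hr Hs Hd [H1 H2]. unfold spacelike, sonic in *.
  assert (Hc : filterlim (fun t => sqrt (gamma * pres (U t) / dens (U t)) * sqrt (1 + s t ^ 2)) F
     (locally (sqrt (gamma * pres U0 / dens U0) * sqrt (1 + s0 ^ 2)))).
  { apply flim_mult.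
    - apply flim_sqrt. apply flim_div; [flim|exact Hr|lra].
    - flim. }
  assert (Hn : filterlim (fun t => velx (U t) - s t * vely (U t)) F
     (locally (velx U0 - s0 * vely U0))) by flim.
  apply filter_and.
  - apply (filter_imp (fun t => 0 < velx (U t) - s t * vely (U t) -
      sqrt (gamma * pres (U t) / dens (U t)) * sqrt (1 + s t ^ 2))); [intros t Ht; lra|].
    eapply flim_gt; [apply flim_minus; [exact Hn|exact Hc]|lra].
  - apply (filter_imp (fun t => 0 < pres (U t) * (velx (U t) - s t * vely (U t)) -
      p0 * (sqrt (gamma * pres (U t) / dens (U t)) * sqrt (1 + s t ^ 2)))); [intros t Ht; lra|].
    eapply flim_gt; [apply flim_minus; [apply flim_mult; [exact Hp|exact Hn]|
      apply flim_mult; [apply filterlim_const|exact Hc]]|lra].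
Qed.

Lemma spacelike_upstream (gamma p0 u0 rho0 s : R) :
  1 < gamma -> 0 < p0 -> 0 < u0 -> 0 < rho0 ->
  (1 + s ^ 2) * (gamma * p0 / rho0) < u0 ^ 2 ->
  spacelike gamma p0 s (upstream p0 u0 rho0).
Proof.
  intros Hg Hp Hu Hr H. unfold spacelike, sonic, upstream; simpl velx; simpl vely; simpl pres; simpl dens.
  assert (K : sqrt (gamma * p0 / rho0) * sqrt (1 + s ^ 2) < u0).
  { rewrite <- sqrt_mult.
    - rewrite <- (sqrt_pow2 u0) by lra. apply sqrt_lt_1; [|apply pow2_ge_0|lra].
      apply Rmult_le_pos; [|nra]. apply Rlt_le, Rdiv_lt_0_compat; nra.
    - apply Rlt_le, Rdiv_lt_0_compat; nra.
    - nra. }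
  rewrite Rmult_0_r, Rminus_0_r. split; [exact K|]. apply Rmult_lt_compat_l; assumption.
Qed.

(** * The shock polar *)

(** Parametrized by the slope [s = dx/dy] of the shock-front, the polar is a
    smooth curve given by rational functions, on which the normal shock [s = 0]
    and the change of sign of the deflection are regular points. *)
Definition shock_pressure (gamma p0 M s : R) : R :=
  p0 * (1 + 2 * gamma / (gamma + 1) * (M ^ 2 / (1 + s ^ 2) - 1)).

Definition shock_deflection (gamma M s : R) : R :=
  2 * s * (M ^ 2 - 1 - s ^ 2) /
  ((gamma - 1) * M ^ 2 + 2 + ((gamma + 1) * M ^ 2 + 2) * s ^ 2).

Lemma shock_deflection_den_pos (gamma M s : R) :
  1 < gamma -> 0 < (gamma - 1) * M ^ 2 + 2 + ((gamma + 1) * M ^ 2 + 2) * s ^ 2.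
Proof. intros Hg. pose proof (pow2_ge_0 M). pose proof (pow2_ge_0 s). nra. Qed.

Lemma shock_from_upstream (gamma p0 u0 rho0 s : R) (sp : state) :
  1 < gamma -> 0 < p0 -> 0 < u0 -> 0 < rho0 -> 0 < pres sp -> 0 < dens sp ->
  bernoulli gamma sp = b0 gamma p0 u0 rho0 ->
  rankine_hugoniot s (upstream p0 u0 rho0) sp ->
  let M := mach0 gamma p0 u0 rho0 in
  p0 < pres sp /\
  pres sp = shock_pressure gamma p0 M s /\
  s ^ 2 < M ^ 2 - 1 /\
  velx sp = u0 - (pres sp - p0) / (rho0 * u0) /\
  vely sp = s * (pres sp - p0) / (rho0 * u0) /\
  slope sp = shock_deflection gamma M s /\
  dens sp = rho0 * (((gamma + 1) * pres sp + (gamma - 1) * p0) /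
                    ((gamma - 1) * pres sp + (gamma + 1) * p0)).
Proof.
  intros Hg Hp0 Hu0 Hr0 Hp Hr HB HRH M.
  assert (HM := mach0_sqr gamma p0 u0 rho0 Hg Hp0 Hu0 Hr0). fold M in HM. clearbody M.
  assert (HP : 0 < pres sp - p0) by (destruct HRH as (_ & _ & _ & H); exact H).
  assert (HB0 : bernoulli gamma (upstream p0 u0 rho0) = b0 gamma p0 u0 rho0).
  { unfold bernoulli. rewrite sonic_sqr by (simpl; lra). unfold b0; simpl. field. lra. }
  destruct (rankine_hugoniot_normal gamma _ s (upstream p0 u0 rho0) sp Hg Hr0 Hr Hp0 Hp HB0 HB HRH)
    as (R1 & R2 & R3 & R4).
  simpl in R1, R2, R3, R4. destruct sp as [p u v r]; unfold slope; simpl pres in *; simpl velx in *;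
    simpl vely in *; simpl dens in *.
  set (P := p - p0) in *.
  assert (Hs : 0 < 1 + s ^ 2) by nra.
  assert (E4 : M ^ 2 * (gamma * p0) = (1 + s ^ 2) * (gamma * p0 + (gamma + 1) / 2 * P)).
  { rewrite HM. lra. }
  assert (EP : P = 2 * gamma * p0 / (gamma + 1) * (M ^ 2 / (1 + s ^ 2) - 1)).
  { apply (Rmult_eq_reg_l ((gamma + 1) / 2 * (1 + s ^ 2))); [|nra].
    transitivity (M ^ 2 * (gamma * p0) - (1 + s ^ 2) * (gamma * p0)); [lra|field; lra]. }
  assert (Hmu : 0 < rho0 * u0) by (apply Rmult_lt_0_compat; lra).
  assert (Eu : u = u0 - P / (rho0 * u0)).
  { apply (Rmult_eq_reg_l (rho0 * u0)); [|lra].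
    transitivity (rho0 * u0 * u0 - P); [lra|field; lra]. }
  assert (Ev : v = s * P / (rho0 * u0)).
  { apply (Rmult_eq_reg_l (rho0 * u0)); [|lra].
    transitivity (s * P); [lra|field; lra]. }
  assert (Hn : s ^ 2 < M ^ 2 - 1).
  { assert (0 < (1 + s ^ 2) * ((gamma + 1) / 2 * P)).
    { apply Rmult_lt_0_compat; [lra|]. apply Rmult_lt_0_compat; lra. }
    assert (0 < (M ^ 2 - (1 + s ^ 2)) * (gamma * p0)) by lra.
    assert (0 < gamma * p0) by (apply Rmult_lt_0_compat; lra). nra. }
  repeat split; try assumption.
  - unfold P in HP; lra.
  - unfold shock_pressure. transitivity (p0 + P); [unfold P; ring|]. rewrite EP. field. lra.
  - pose proof (shock_deflection_den_pos gamma M s Hg) as Hden.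
    assert (Hg0 : 0 < gamma * p0) by (apply Rmult_lt_0_compat; lra).
    assert (Ed : M ^ 2 * (gamma * p0) - P = gamma * p0 / ((gamma + 1) * (1 + s ^ 2)) *
      ((gamma - 1) * M ^ 2 + 2 + ((gamma + 1) * M ^ 2 + 2) * s ^ 2)) by (rewrite EP; field; lra).
    assert (Hd : 0 < M ^ 2 * (gamma * p0) - P).
    { rewrite Ed. apply Rmult_lt_0_compat; [|exact Hden]. apply Rdiv_lt_0_compat; [lra|].
      apply Rmult_lt_0_compat; lra. }
    transitivity (s * P / (M ^ 2 * (gamma * p0) - P)).
    + rewrite HM in *. rewrite Eu, Ev. field. repeat split; lra.
    + rewrite Ed, EP. unfold shock_deflection. field. repeat split; lra.
  - replace ((gamma + 1) * p + (gamma - 1) * p0) with (2 * (gamma * p0 + (gamma + 1) / 2 * P)) by (unfold P; field).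
    replace ((gamma - 1) * p + (gamma + 1) * p0) with (2 * (gamma * p0 + (gamma - 1) / 2 * P)) by (unfold P; field).
    assert (Hg0 : 0 < gamma * p0) by (apply Rmult_lt_0_compat; lra).
    assert (Ha : 0 < gamma * p0 + (gamma + 1) / 2 * P) by (assert (0 < (gamma + 1) / 2 * P) by (apply Rmult_lt_0_compat; lra); lra).
    assert (Hb : 0 < gamma * p0 + (gamma - 1) / 2 * P) by (assert (0 < (gamma - 1) / 2 * P) by (apply Rmult_lt_0_compat; lra); lra).
    assert (Es : 1 + s ^ 2 = rho0 * u0 ^ 2 / (gamma * p0 + (gamma + 1) / 2 * P)).
    { rewrite <- HM, E4. field. lra. }
    assert (En : u - s * v = u0 * (gamma * p0 + (gamma - 1) / 2 * P) / (gamma * p0 + (gamma + 1) / 2 * P)).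
    { rewrite Eu, Ev. transitivity (u0 - P * (1 + s ^ 2) / (rho0 * u0)); [field; lra|].
      rewrite Es. field. lra. }
    apply (Rmult_eq_reg_r (u - s * v)).
    + transitivity (rho0 * u0); [lra|]. rewrite En. field. lra.
    + rewrite En. apply Rgt_not_eq, Rdiv_lt_0_compat; [apply Rmult_lt_0_compat; lra|lra].
Qed.

(** The condition [c <= shock_deflection s] is the nonnegativity of a cubic in [s]
    which is concave on [s >= 0]. *)
Lemma shock_deflection_quasiconcave (gamma M c s1 s s2 : R) :
  1 < gamma -> 0 < c -> 0 <= s1 -> s1 <= s <= s2 ->
  c <= shock_deflection gamma M s1 -> c <= shock_deflection gamma M s2 -> c <= shock_deflection gamma M s.
Proof.
  intros Hg Hc H1 Hs.
  set (A := (gamma - 1) * M ^ 2 + 2). set (B := (gamma + 1) * M ^ 2 + 2).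
  assert (HB : 0 < B) by (unfold B; pose proof (pow2_ge_0 M); nra).
  assert (Hiff : forall t, c <= shock_deflection gamma M t <-> 0 <= 2 * t * (M ^ 2 - 1 - t ^ 2) - c * (A + B * t ^ 2)).
  { intros t. pose proof (shock_deflection_den_pos gamma M t Hg) as Hd. unfold shock_deflection. fold A B in Hd |- *.
    split; intros H.
    - apply (Rmult_le_compat_r (A + B * t ^ 2)) in H; [|lra].
      unfold Rdiv in H. rewrite Rmult_assoc, Rinv_l in H by lra. lra.
    - apply (Rmult_le_reg_r (A + B * t ^ 2)); [lra|].
      unfold Rdiv. rewrite Rmult_assoc, Rinv_l by lra. lra. }
  rewrite !Hiff. intros K1 K2.
  destruct (Req_dec s1 s2) as [E|E].
  - replace s with s1 by lra. exact K1.
  - apply (Rmult_le_reg_l (s2 - s1)); [lra|]. rewrite Rmult_0_r.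
    set (q := fun t => 2 * t * (M ^ 2 - 1 - t ^ 2) - c * (A + B * t ^ 2)) in *.
    assert (Eid : (s2 - s1) * q s = (s2 - s) * q s1 + (s - s1) * q s2
       + (s - s1) * (s2 - s) * (s2 - s1) * (2 * (s + s1 + s2) + c * B)) by (unfold q; ring).
    change (0 <= (s2 - s1) * q s). rewrite Eid.
    change (0 <= q s1) in K1. change (0 <= q s2) in K2.
    assert (0 <= (s2 - s) * q s1) by (apply Rmult_le_pos; lra).
    assert (0 <= (s - s1) * q s2) by (apply Rmult_le_pos; lra).
    assert (0 < c * B) by (apply Rmult_lt_0_compat; lra).
    assert (0 <= (s - s1) * (s2 - s) * (s2 - s1) * (2 * (s + s1 + s2) + c * B)).
    { repeat apply Rmult_le_pos; lra. }
    lra.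
Qed.

Lemma polar_parametrization (gamma p0 u0 rho0 s : R) :
  1 < gamma -> 0 < p0 -> 0 < u0 -> 0 < rho0 -> 0 <= s ->
  let M := mach0 gamma p0 u0 rho0 in
  polar gamma p0 u0 rho0 (shock_pressure gamma p0 M s) = shock_deflection gamma M s.
Proof.
  intros Hg Hp0 Hu0 Hr0 Hs M. unfold polar. fold M. cbv zeta.
  assert (HM : 0 < M ^ 2).
  { assert (H := mach0_sqr gamma p0 u0 rho0 Hg Hp0 Hu0 Hr0). fold M in H.
    assert (0 < rho0 * u0 ^ 2) by (apply Rmult_lt_0_compat; nra).
    assert (0 < gamma * p0) by (apply Rmult_lt_0_compat; lra). nra. }
  assert (Hs2 : 0 < 1 + s ^ 2) by nra.
  replace (shock_pressure gamma p0 M s / p0) with (1 + 2 * gamma / (gamma + 1) * (M ^ 2 / (1 + s ^ 2) - 1))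
    by (unfold shock_pressure; field; lra).
  replace ((2 * gamma / (gamma + 1) * (M ^ 2 - 1) -
     (1 + 2 * gamma / (gamma + 1) * (M ^ 2 / (1 + s ^ 2) - 1) - 1)) /
    (1 + 2 * gamma / (gamma + 1) * (M ^ 2 / (1 + s ^ 2) - 1) + (gamma - 1) / (gamma + 1))) with (s ^ 2).
  2:{ field. repeat split; try lra.
      intros Z. assert (Hpos : 0 < gamma * (2 * M ^ 2)) by (apply Rmult_lt_0_compat; lra). lra. }
  rewrite sqrt_pow2 by exact Hs.
  pose proof (shock_deflection_den_pos gamma M s Hg) as Hden. unfold shock_deflection.
  replace (gamma * M ^ 2 - (1 + 2 * gamma / (gamma + 1) * (M ^ 2 / (1 + s ^ 2) - 1) - 1)) with
    (gamma / ((gamma + 1) * (1 + s ^ 2)) * ((gamma - 1) * M ^ 2 + 2 + ((gamma + 1) * M ^ 2 + 2) * s ^ 2)) by (field; lra).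
  field. repeat split; lra.
Qed.

Lemma shock_pressure_decreasing (gamma p0 M s t : R) :
  1 < gamma -> 0 < p0 -> M <> 0 -> 0 <= s < t ->
  shock_pressure gamma p0 M t < shock_pressure gamma p0 M s.
Proof.
  intros Hg Hp0 HM Hst. unfold shock_pressure.
  apply Rmult_lt_compat_l; [exact Hp0|]. apply Rplus_lt_compat_l.
  apply Rmult_lt_compat_l; [apply Rdiv_lt_0_compat; lra|].
  apply Rplus_lt_compat_r. assert (0 < M ^ 2) by now apply pow2_gt_0.
  apply Rmult_lt_compat_l; [lra|]. apply Rinv_lt_contravar; nra.
Qed.

(** The pressure decreases with [s], so the strong branch [p >= pstar]
    corresponds to [0 <= s <= ss], where [ss] maximizes the deflection; there,
    quasi-concavity makes the deflection increase with [s]. *)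
Lemma strong_branch (gamma p0 u0 rho0 th pstar pstrong s1 : R) :
  1 < gamma -> 0 < p0 -> 0 < u0 -> 0 < rho0 -> 1 < mach0 gamma p0 u0 rho0 ->
  0 < tan th ->
  is_pstar gamma p0 u0 rho0 pstar -> is_pstrong gamma p0 u0 rho0 th pstar pstrong ->
  let M := mach0 gamma p0 u0 rho0 in
  0 <= s1 -> shock_pressure gamma p0 M s1 = pstrong ->
  shock_deflection gamma M s1 = tan th /\
  forall s, 0 <= s <= s1 -> shock_deflection gamma M s <= tan th.
Proof.
  intros Hg Hp0 Hu0 Hr0 HM1 Hth [Hst1 Hst2] [Hsg1 Hsg2] M Hs1 Es1.
  assert (HM : 1 < M) by exact HM1.
  assert (Hpol := fun s H => polar_parametrization gamma p0 u0 rho0 s Hg Hp0 Hu0 Hr0 H).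
  unfold p_plus in *. fold M in Hpol, Hst1, Hst2, Hsg1. clearbody M.
  assert (EW : shock_deflection gamma M s1 = tan th) by (rewrite <- Hpol by exact Hs1; rewrite Es1; exact Hsg2).
  split; [exact EW|].
  (* [ss] solves [shock_pressure ss = pstar]. *)
  set (X := (pstar / p0 - 1) * ((gamma + 1) / (2 * gamma))).
  assert (HX : 0 < X < M ^ 2 - 1).
  { assert (Hq : 0 < (gamma + 1) / (2 * gamma)) by (apply Rdiv_lt_0_compat; lra).
    assert (Hr : 1 < pstar / p0 < 1 + 2 * gamma / (gamma + 1) * (M ^ 2 - 1)).
    { split; apply (Rmult_lt_reg_l p0); try exact Hp0;
        replace (p0 * (pstar / p0)) with pstar by (field; lra); lra. }
    unfold X. split; [apply Rmult_lt_0_compat; lra|].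
    replace (M ^ 2 - 1) with (2 * gamma / (gamma + 1) * (M ^ 2 - 1) * ((gamma + 1) / (2 * gamma))) by (field; lra).
    apply Rmult_lt_compat_r; lra. }
  assert (Hr0' : 0 < M ^ 2 / (1 + X) - 1).
  { apply (Rmult_lt_reg_r (1 + X)); [lra|]. replace ((M ^ 2 / (1 + X) - 1) * (1 + X)) with (M ^ 2 - 1 - X) by (field; lra). lra. }
  set (ss := sqrt (M ^ 2 / (1 + X) - 1)).
  assert (Hss : 0 < ss) by now apply sqrt_lt_R0.
  assert (Ess : shock_pressure gamma p0 M ss = pstar).
  { unfold shock_pressure, ss. rewrite pow2_sqrt by lra.
    replace (1 + (M ^ 2 / (1 + X) - 1)) with (M ^ 2 / (1 + X)) by ring.
    replace (M ^ 2 / (M ^ 2 / (1 + X))) with (1 + X) by (field; split; nra).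
    unfold X. field. lra. }
  assert (Hle : s1 <= ss).
  { apply Rnot_lt_le. intros Hlt.
    pose proof (shock_pressure_decreasing gamma p0 M ss s1 Hg Hp0 ltac:(lra) ltac:(lra)). lra. }
  intros s Hs. apply Rnot_lt_le. intros Hlt.
  assert (Hss1 : s < s1).
  { destruct (Req_dec s s1) as [->|]; lra. }
  assert (Hmax : shock_deflection gamma M s <= shock_deflection gamma M ss).
  { rewrite <- !Hpol by lra. rewrite Ess. apply Hst2.
    pose proof (shock_pressure_decreasing gamma p0 M s s1 Hg Hp0 ltac:(lra) ltac:(lra)). split; [lra|].
    destruct (Req_dec s 0) as [->|].
    - unfold shock_pressure. apply Req_le. field. lra.
    - pose proof (shock_pressure_decreasing gamma p0 M 0 s Hg Hp0 ltac:(lra) ltac:(lra)) as Hdec.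
      replace (shock_pressure gamma p0 M 0) with (p0 * (1 + 2 * gamma / (gamma + 1) * (M ^ 2 - 1))) in Hdec
        by (unfold shock_pressure; field; lra). lra. }
  pose proof (shock_deflection_quasiconcave gamma M (shock_deflection gamma M s) s s1 ss Hg ltac:(lra) ltac:(lra)
    ltac:(lra) (Rle_refl _) Hmax). lra.
Qed.

Lemma shock_angle_of_slope (gamma p0 u0 rho0 s : R) :
  1 < gamma -> 0 < p0 -> 1 < mach0 gamma p0 u0 rho0 -> 0 < s ->
  let alpha := PI / 2 - atan s in
  is_shock_angle gamma p0 u0 rho0 (shock_pressure gamma p0 (mach0 gamma p0 u0 rho0) s) alpha /\
  cot alpha = s.
Proof.
  intros Hg Hp0 HM Hs alpha. set (M := mach0 gamma p0 u0 rho0) in *.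
  assert (Hq : 0 < sqrt (1 + s ^ 2)) by (apply sqrt_lt_R0; nra).
  assert (Es : sin alpha = / sqrt (1 + s ^ 2)).
  { unfold alpha. rewrite sin_shift, cos_atan. unfold Rsqr, Rdiv. rewrite Rmult_1_l. do 3 f_equal. ring. }
  assert (Ec : cos alpha = s / sqrt (1 + s ^ 2)).
  { unfold alpha. rewrite cos_shift, sin_atan. unfold Rsqr, Rdiv. do 4 f_equal. ring. }
  split.
  - split.
    + unfold alpha. pose proof (atan_bound s). pose proof (atan_increasing 0 s Hs). rewrite atan_0 in H0. lra.
    + fold M. rewrite Es.
      replace ((gamma + 1) / (2 * gamma) * (shock_pressure gamma p0 M s / p0 + (gamma - 1) / (gamma + 1)))
        with (M ^ 2 / (1 + s ^ 2)) by (unfold shock_pressure; field; repeat split; nra).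
      rewrite sqrt_div by nra. rewrite sqrt_pow2 by lra. field. split; lra.
  - unfold cot. rewrite Es, Ec. field. lra.
Qed.

Lemma shock_deflection_sign (gamma M s : R) :
  1 < gamma -> s ^ 2 < M ^ 2 - 1 -> s <= 0 -> shock_deflection gamma M s <= 0.
Proof.
  intros Hg Hs Hs0. unfold shock_deflection. pose proof (shock_deflection_den_pos gamma M s Hg) as Hd.
  apply (Rmult_le_reg_r ((gamma - 1) * M ^ 2 + 2 + ((gamma + 1) * M ^ 2 + 2) * s ^ 2)); [exact Hd|].
  unfold Rdiv. rewrite Rmult_assoc, Rinv_l by lra. nra.
Qed.

Definition shock_pressure_deriv (gamma p0 M s : R) : R :=
  - (p0 * (2 * gamma / (gamma + 1)) * M ^ 2 * (2 * s) / (1 + s ^ 2) ^ 2).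

Lemma is_derive_shock_pressure (gamma p0 M s : R) :
  1 < gamma -> is_derive (shock_pressure gamma p0 M) s (shock_pressure_deriv gamma p0 M s).
Proof.
  intros Hg. unfold shock_pressure, shock_pressure_deriv. assert (0 < 1 + s ^ 2) by nra.
  auto_derive; [simpl in *; lra|]. field. simpl in *. lra.
Qed.

Lemma ex_derive_shock_deflection (gamma M s : R) : 1 < gamma -> ex_derive (shock_deflection gamma M) s.
Proof.
  intros Hg. unfold shock_deflection. pose proof (shock_deflection_den_pos gamma M s Hg).
  auto_derive. simpl in *. lra.
Qed.

Lemma continuous_polar_weight (gamma p0 M e c s : R) : 1 < gamma ->
  continuous (fun s => Rmax 0 (e * (shock_deflection gamma M s - c)) ^ 2 * shock_pressure_deriv gamma p0 M s) s.
Proof.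
  intros Hg.
  apply (continuous_mult (fun s => Rmax 0 (e * (shock_deflection gamma M s - c)) ^ 2) (shock_pressure_deriv gamma p0 M)).
  - destruct (ex_derive_shock_deflection gamma M s Hg) as [l Hl].
    apply (continuous_comp (fun s => e * (shock_deflection gamma M s - c)) (fun z => Rmax 0 z ^ 2)).
    + apply (ex_derive_continuous (fun s => e * (shock_deflection gamma M s - c))).
      exists (e * (l - 0)). apply (is_derive_scal (fun s => shock_deflection gamma M s - c) s e).
      apply (is_derive_minus (shock_deflection gamma M) (fun _ => c)); [exact Hl|apply (is_derive_const c s)].
    + apply (ex_derive_continuous (fun z => Rmax 0 z ^ 2)). eexists. apply is_derive_pos_part_sqr.
  - apply (ex_derive_continuous (shock_pressure_deriv gamma p0 M)).
    unfold shock_pressure_deriv. auto_derive. assert (0 < 1 + s ^ 2) by nra. simpl in *. nra.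
Qed.

(** On [[0, sa]] the weight vanishes.  For [sb > 0] the integrand on [[0, sb]] is
    not positive, since the pressure decreases; for [sb < 0] the deflection is
    negative and the weight vanishes again. *)
Lemma polar_weight_above (gamma p0 M c sa sb : R) :
  1 < gamma -> 0 < p0 -> 0 < c -> 0 <= sa -> sb ^ 2 < M ^ 2 - 1 ->
  (forall s, 0 <= s <= sa -> shock_deflection gamma M s <= c) ->
  1 * RInt (fun s => Rmax 0 (1 * (shock_deflection gamma M s - c)) ^ 2 * shock_pressure_deriv gamma p0 M s) sa sb <= 0.
Proof.
  intros Hg Hp0 Hc Hsa Hsb HW. rewrite Rmult_1_l.
  set (g := fun s => Rmax 0 (1 * (shock_deflection gamma M s - c)) ^ 2 * shock_pressure_deriv gamma p0 M s).
  assert (Hex : forall a b, ex_RInt g a b).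
  { intros a b. apply (ex_RInt_continuous g). intros z _. now apply continuous_polar_weight. }
  assert (Hz : forall s, shock_deflection gamma M s <= c -> g s = 0).
  { intros s Hs. unfold g. rewrite Rmax_left by lra. ring. }
  assert (Ech : RInt g sa sb = RInt g sa 0 + RInt g 0 sb) by (symmetry; apply (RInt_Chasles g); apply Hex).
  rewrite Ech, (RInt_zero g sa 0), Rplus_0_l.
  2:{ intros s Hs. rewrite Rmin_right, Rmax_left in Hs by lra. apply Hz, HW, Hs. }
  destruct (Rle_or_lt sb 0) as [Hb|Hb].
  - rewrite (RInt_zero g 0 sb); [apply Rle_refl|].
    intros s Hs. rewrite Rmin_right, Rmax_left in Hs by lra. apply Hz.
    apply Rle_trans with 0; [|lra]. apply shock_deflection_sign; [exact Hg|nra|lra].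
  - apply Rle_trans with (RInt (fun _ => 0) 0 sb).
    + apply RInt_le; [lra|apply Hex|apply ex_RInt_const|]. intros s Hs. unfold g.
      assert (Hd : 0 <= p0 * (2 * gamma / (gamma + 1)) * M ^ 2 * (2 * s) / (1 + s ^ 2) ^ 2).
      { apply Rmult_le_pos; [|apply Rlt_le, Rinv_0_lt_compat, pow_lt; nra].
        apply Rmult_le_pos; [|lra]. apply Rmult_le_pos; [|apply pow2_ge_0].
        apply Rmult_le_pos; [lra|]. apply Rlt_le, Rdiv_lt_0_compat; lra. }
      unfold shock_pressure_deriv.
      pose proof (pow2_ge_0 (Rmax 0 (1 * (shock_deflection gamma M s - c)))) as Hsq. nra.
    + rewrite RInt_const. unfold scal; simpl; unfold mult; simpl. rewrite Rmult_0_r. apply Rle_refl.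
Qed.

(** Both ends lie in [{c <= shock_deflection}], which is an interval of slopes, and
    the weight vanishes there. *)
Lemma polar_weight_below (gamma p0 M c sa sb : R) :
  1 < gamma -> 0 < c -> 0 <= sa -> 0 <= sb ->
  c <= shock_deflection gamma M sa -> c <= shock_deflection gamma M sb ->
  -1 * RInt (fun s => Rmax 0 (-1 * (shock_deflection gamma M s - c)) ^ 2 * shock_pressure_deriv gamma p0 M s) sa sb <= 0.
Proof.
  intros Hg Hc Hsa Hsb Ha Hb. rewrite RInt_zero; [lra|]. intros s Hs.
  assert (HW : c <= shock_deflection gamma M s).
  { unfold Rmin, Rmax in Hs. destruct (Rle_dec sa sb).
    - apply (shock_deflection_quasiconcave gamma M c sa s sb); assumption.
    - apply (shock_deflection_quasiconcave gamma M c sb s sa); assumption. }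
  rewrite Rmax_left by lra. ring.
Qed.

(** * Ellipticity behind the shock-front *)

Definition quotient_deriv (a b da db : R) : R := (da * b - a * db) / b ^ 2.

Lemma slope_gradient (E : R * R -> Prop) (U : R * R -> state) (ux uy vx vy : R * R -> R) :
  (forall q, E q -> velx (U q) <> 0) ->
  has_gradient E (fun q => velx (U q)) ux uy -> has_gradient E (fun q => vely (U q)) vx vy ->
  has_gradient E (fun q => slope (U q))
    (fun q => quotient_deriv (vely (U q)) (velx (U q)) (vx q) (ux q))
    (fun q => quotient_deriv (vely (U q)) (velx (U q)) (vy q) (uy q)).
Proof.
  intros Hu Gu Gv x y Hxy. destruct (Gu x y Hxy) as [U1 U2]. destruct (Gv x y Hxy) as [V1 V2].
  specialize (Hu _ Hxy). unfold slope, quotient_deriv. split.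
  - exact (is_derive_div (fun t => vely (U (t, y))) (fun t => velx (U (t, y))) x _ _ V1 U1 Hu).
  - exact (is_derive_div (fun t => vely (U (x, t))) (fun t => velx (U (x, t))) y _ _ V2 U2 Hu).
Qed.

Lemma continuous_on_quotient_deriv (D : R * R -> Prop) (a b da db : R * R -> R) :
  (forall q, D q -> b q <> 0) ->
  continuous_on D a -> continuous_on D b -> continuous_on D da -> continuous_on D db ->
  continuous_on D (fun q => quotient_deriv (a q) (b q) (da q) (db q)).
Proof.
  intros Hb Ca Cb Cda Cdb q Hq.
  specialize (Ca q Hq). specialize (Cb q Hq). specialize (Cda q Hq). specialize (Cdb q Hq).
  assert (FF : Filter (within D (locally q))) by (apply within_filter, locally_filter).
  unfold quotient_deriv. apply flim_div; [flim|apply flim_pow2; exact Cb|apply pow_nonzero, Hb, Hq].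
Qed.

Lemma continuous_on_slope (D : R * R -> Prop) (U : R * R -> state) :
  (forall q, D q -> velx (U q) <> 0) ->
  continuous_on D (fun q => velx (U q)) -> continuous_on D (fun q => vely (U q)) ->
  continuous_on D (fun q => slope (U q)).
Proof.
  intros Hu Cu Cv q Hq. specialize (Cu q Hq). specialize (Cv q Hq).
  assert (FF : Filter (within D (locally q))) by (apply within_filter, locally_filter).
  unfold slope. apply flim_div; [exact Cv|exact Cu|apply Hu, Hq].
Qed.

Lemma subsonic_speed (gamma : R) (s : state) :
  1 < gamma -> 0 < pres s -> 0 < dens s -> mach gamma s < 1 ->
  dens s * (velx s ^ 2 + vely s ^ 2) < gamma * pres s.
Proof.
  intros Hg Hp Hr HM. unfold mach, speed in HM.
  assert (Hc2 := sonic_sqr gamma s ltac:(lra) Hp Hr).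
  assert (Hc : 0 < sonic gamma s).
  { unfold sonic. apply sqrt_lt_R0, Rdiv_lt_0_compat; [nra|lra]. }
  assert (HV : 0 <= velx s ^ 2 + vely s ^ 2) by (pose proof (pow2_ge_0 (velx s)); pose proof (pow2_ge_0 (vely s)); lra).
  assert (Hlt : sqrt (velx s ^ 2 + vely s ^ 2) < sonic gamma s).
  { apply (Rmult_lt_reg_r (/ sonic gamma s)); [now apply Rinv_0_lt_compat|]. rewrite Rinv_r by lra. exact HM. }
  assert (Hlt2 : velx s ^ 2 + vely s ^ 2 < gamma * pres s / dens s).
  { rewrite <- Hc2, <- (pow2_sqrt (velx s ^ 2 + vely s ^ 2)) by exact HV.
    pose proof (sqrt_pos (velx s ^ 2 + vely s ^ 2)). nra. }
  apply (Rmult_lt_compat_l (dens s)) in Hlt2; [|exact Hr].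
  replace (dens s * (gamma * pres s / dens s)) with (gamma * pres s) in Hlt2 by (field; lra). exact Hlt2.
Qed.

(** Elimination of the derivatives of [u], [v] and [rho] expresses the Jacobian as
    [(p_x + w p_y)^2 / (gamma p) - (p_x^2 + p_y^2) / (rho u^2)]. *)
Lemma subsonic_jacobian (gamma p u v r px py ux uy vx vy rx ry : R) :
  1 < gamma -> 0 < p -> 0 < u -> 0 < r -> r * (u ^ 2 + v ^ 2) < gamma * p ->
  steady_gas_equations gamma p u v r px py ux uy vx vy rx ry ->
  let wx := (vx * u - v * ux) / u ^ 2 in
  let wy := (vy * u - v * uy) / u ^ 2 in
  wx * py - wy * px <= 0 /\
  (wx * py - wy * px = 0 -> px = 0 /\ py = 0 /\ wx = 0 /\ wy = 0).
Proof.
  intros Hg Hp Hu Hr Hsub (M1 & M2 & M3 & M4) wx wy.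
  set (w := v / u).
  assert (Hgp : 0 < gamma * p) by (apply Rmult_lt_0_compat; lra).
  assert (Hru : 0 < r * u ^ 2) by (apply Rmult_lt_0_compat; [lra|apply pow_lt; lra]).
  assert (Ev : v = u * w) by (unfold w; field; lra).
  assert (Hwx : u * wx = vx - w * ux) by (unfold wx, w; field; lra).
  assert (Hwy : u * wy = vy - w * uy) by (unfold wy, w; field; lra).
  clearbody wx wy w. subst v.
  assert (E1 : wx + w * wy = (w * px - py) / (r * u ^ 2)).
  { apply (Rmult_eq_reg_l (r * u ^ 2)); [|lra].
    transitivity (r * u * (u * wx) + r * u * w * (u * wy)); [ring|]. rewrite Hwx, Hwy.
    transitivity ((r * (u * vx + u * w * vy) + py) - w * (r * (u * ux + u * w * uy) + px) + w * px - py); [ring|].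
    rewrite M2, M3. field. lra. }
  assert (E2 : wy = px / (r * u ^ 2) - (px + w * py) / (gamma * p)).
  { assert (T1 : u * rx + u * w * ry = (u * px + u * w * py) * r / (gamma * p)).
    { rewrite M4. field. lra. }
    apply (Rmult_eq_reg_l (r * u)); [|apply Rgt_not_eq, Rmult_lt_0_compat; lra].
    transitivity (r * (u * wy)); [ring|]. rewrite Hwy.
    transitivity ((u * rx + r * ux + u * w * ry + r * vy) - (u * rx + u * w * ry)
       - (r * (u * ux + u * w * uy) + px) / u + px / u); [field; lra|].
    rewrite M1, M2, T1. field. lra. }
  assert (E1' : wx = (w * px - py) / (r * u ^ 2) - w * wy) by lra.
  set (A := / (r * u ^ 2)). set (B := / (gamma * p)).
  assert (HAB : B * (1 + w ^ 2) < A).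
  { unfold A, B. apply (Rmult_lt_reg_l (gamma * p)); [exact Hgp|]. apply (Rmult_lt_reg_l (r * u ^ 2)); [exact Hru|].
    replace (r * u ^ 2 * (gamma * p * (/ (gamma * p) * (1 + w ^ 2)))) with (r * (u ^ 2 + (u * w) ^ 2)) by (field; lra).
    replace (r * u ^ 2 * (gamma * p * / (r * u ^ 2))) with (gamma * p) by (field; lra). exact Hsub. }
  assert (HB : 0 < B) by (apply Rinv_0_lt_compat; exact Hgp).
  assert (EJ : wx * py - wy * px = B * (px + w * py) ^ 2 - A * (px ^ 2 + py ^ 2)).
  { rewrite E1', E2. unfold A, B. field. lra. }
  assert (CS : (px + w * py) ^ 2 <= (1 + w ^ 2) * (px ^ 2 + py ^ 2)).
  { pose proof (pow2_ge_0 (w * px - py)). lra. }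
  set (S2 := px ^ 2 + py ^ 2) in *.
  assert (HS : 0 <= S2) by (unfold S2; pose proof (pow2_ge_0 px); pose proof (pow2_ge_0 py); lra).
  assert (HJ : wx * py - wy * px <= - (A - B * (1 + w ^ 2)) * S2).
  { rewrite EJ. assert (B * (px + w * py) ^ 2 <= B * ((1 + w ^ 2) * S2)) by (apply Rmult_le_compat_l; lra). lra. }
  split; [nra|]. intros H0.
  assert (Z : S2 = 0) by nra.
  destruct (Rplus_sqr_eq_0 px py) as [Zx Zy]; [unfold S2, Rsqr in *; lra|].
  assert (Ey : wy = 0) by (rewrite E2, Zx, Zy; field; lra).
  repeat split; try assumption. rewrite E1', Ey, Zx, Zy. field. lra.
Qed.

(** The strip [0 <= s <= 1] has the shock-front at [s = 0] and the ramp at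
    [s = 1]; [e = 1] gives an upper and [e = -1] a lower bound.  With
    [phi = (e (w - c))_+^2] and [I s = int phi p_y dy], the sign of the Jacobian
    makes [e I] nonincreasing.  It vanishes at [s = 1] and is not positive at
    [s = 0], so it is zero, and so are [phi_s] and [phi]. *)
Lemma strip_maximum_principle (e c a b : R) (p ps py w ws wy : R -> R -> R) :
  e ^ 2 = 1 -> a < b ->
  (forall s y, 0 < s < 1 -> a <= y <= b ->
     is_derive (fun t => p t y) s (ps s y) /\ is_derive (p s) y (py s y) /\
     is_derive (fun t => w t y) s (ws s y) /\ is_derive (w s) y (wy s y) /\
     continuity_2d_pt ps s y /\ continuity_2d_pt ws s y /\ continuity_2d_pt wy s y) ->
  (forall s y, a <= y <= b -> continuity_2d_pt w s y /\ continuity_2d_pt py s y) ->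
  (forall s y, 0 < s < 1 -> a <= y <= b ->
     ws s y * py s y - wy s y * ps s y <= 0 /\
     (ws s y * py s y - wy s y * ps s y = 0 -> ws s y = 0)) ->
  (forall s, 0 < s < 1 -> e * (w s a - c) <= 0 /\ e * (w s b - c) <= 0) ->
  (forall y, a <= y <= b -> e * (w 1 y - c) <= 0) ->
  e * RInt (fun y => Rmax 0 (e * (w 0 y - c)) ^ 2 * py 0 y) a b <= 0 ->
  forall s y, 0 < s < 1 -> a < y < b -> e * (w s y - c) <= 0.
Proof.
  intros He Hab Hd Hc HJ Hends Hone Hbd.
  set (m := fun s y => Rmax 0 (e * (w s y - c))).
  assert (Hm0 : forall s y, 0 <= m s y) by (intros; apply Rmax_l).
  assert (Hmz : forall s y, e * (w s y - c) <= 0 -> m s y = 0).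
  { intros s y H. unfold m. apply Rmax_left. exact H. }
  assert (Dm : forall g t dg, is_derive g t dg ->
     is_derive (fun t => Rmax 0 (e * (g t - c)) ^ 2) t (2 * e * Rmax 0 (e * (g t - c)) * dg)).
  { intros g t dg Dg.
    replace (2 * e * Rmax 0 (e * (g t - c)) * dg) with ((e * dg) * (2 * Rmax 0 (e * (g t - c)))) by ring.
    apply (is_derive_comp (fun z => Rmax 0 z ^ 2) (fun t => e * (g t - c)) t); [apply is_derive_pos_part_sqr|].
    apply (is_derive_scal (fun t => g t - c) t e).
    replace dg with (dg - 0) by ring. apply (is_derive_minus g (fun _ => c)); [exact Dg|apply (is_derive_const c t)]. }
  set (phi := fun s y => m s y ^ 2).
  set (phis := fun s y => 2 * e * m s y * ws s y).
  set (phiy := fun s y => 2 * e * m s y * wy s y).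
  assert (Cm : forall s y, a <= y <= b -> continuity_2d_pt m s y).
  { intros s y Hy. unfold m.
    apply (continuity_1d_2d_pt_comp (Rmax 0) (fun s y => e * (w s y - c))).
    - apply continuity_pt_abs. intros eps Heps. exists eps; split; [exact Heps|]. intros z Hz.
      apply Rabs_def2 in Hz. unfold Rmax. destruct (Rle_dec 0 z), (Rle_dec 0 (e * (w s y - c))); apply Rabs_def1; lra.
    - apply continuity_2d_pt_mult; [apply continuity_2d_pt_const|].
      apply continuity_2d_pt_minus; [now apply Hc|apply continuity_2d_pt_const]. }
  assert (Cphi : forall s y, a <= y <= b -> continuity_2d_pt phi s y).
  { intros s y Hy. unfold phi. simpl. apply continuity_2d_pt_mult; [now apply Cm|].
    apply continuity_2d_pt_mult; [now apply Cm|apply continuity_2d_pt_const]. }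
  pose (I := (fun s => RInt (fun y => phi s y * py s y) a b) : R -> R).
  assert (Hphi01 : forall s, 0 < s < 1 -> phi s a = 0 /\ phi s b = 0).
  { intros s Hs. destruct (Hends s Hs) as [E1 E2]. unfold phi. rewrite !Hmz by assumption. split; ring. }
  assert (DI : forall s, 0 < s < 1 -> is_derive I s (RInt (fun y => phis s y * py s y - phiy s y * ps s y) a b)).
  { apply (is_derive_flux_of_exact_form phi phis phiy p ps py a b); [lra| | |exact Hphi01].
    - intros s y Hs Hy. destruct (Hd s y Hs Hy) as (D1 & D2 & D3 & D4 & _).
      split; [exact (Dm _ _ _ D3)|split; [exact (Dm _ _ _ D4)|split; assumption]].
    - intros s y Hs Hy. destruct (Hd s y Hs Hy) as (_ & _ & _ & _ & K1 & K2 & K3).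
      assert (K4 := Cm s y Hy). destruct (Hc s y Hy) as [_ K5].
      unfold phis, phiy. split; [|split; [|split; assumption]]; cont2d. }
  assert (CI : forall s, continuity_pt I s).
  { intros s. apply (continuous_RInt_param (fun s y => phi s y * py s y)); [lra| |].
    - intros y Hy. apply continuity_2d_pt_mult; [now apply Cphi|now apply Hc].
    - intros t y Hy. apply (continuity_2d_slice (fun s y => phi s y * py s y)).
      apply continuity_2d_pt_mult; [now apply Cphi|now apply Hc]. }
  assert (EI : forall s, RInt (fun y => phis s y * py s y - phiy s y * ps s y) a b
    = RInt (fun y => 2 * e * (m s y * (ws s y * py s y - wy s y * ps s y))) a b).
  { intros s. apply RInt_ext. intros y _.
    change (phis s y * py s y - phiy s y * ps s y = 2 * e * (m s y * (ws s y * py s y - wy s y * ps s y))).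
    unfold phis, phiy. ring. }
  assert (CJ : forall s y, 0 < s < 1 -> a <= y <= b ->
    continuous (fun y => m s y * (ws s y * py s y - wy s y * ps s y)) y).
  { intros s y Hs Hy. destruct (Hd s y Hs Hy) as (_ & _ & _ & _ & K1 & K2 & K3).
    assert (K4 := Cm s y Hy). destruct (Hc s y Hy) as [_ K5].
    apply (continuity_2d_slice (fun s y => m s y * (ws s y * py s y - wy s y * ps s y))).
    apply continuity_2d_pt_mult; [exact K4|].
    apply continuity_2d_pt_minus; now apply continuity_2d_pt_mult. }
  pose (K := (fun s => RInt (fun y => m s y * (ws s y * py s y - wy s y * ps s y)) a b) : R -> R).
  assert (EIK : forall s, 0 < s < 1 -> RInt (fun y => phis s y * py s y - phiy s y * ps s y) a b = 2 * e * K s).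
  { intros s Hs. rewrite EI. apply is_RInt_unique.
    apply (is_RInt_scal (fun y => m s y * (ws s y * py s y - wy s y * ps s y))).
    apply (RInt_correct (V := R_CompleteNormedModule)), ex_RInt_segment; [lra|].
    intros y Hy. now apply CJ. }
  assert (HK : forall s, 0 < s < 1 -> K s <= 0).
  { intros s Hs. unfold K. replace 0 with ((b - a) * 0) by ring.
    apply Rle_trans with (RInt (fun _ => 0) a b).
    - apply RInt_le; [lra| |apply ex_RInt_const|].
      + apply ex_RInt_segment; [lra|]. intros y Hy. now apply CJ.
      + intros y Hy. destruct (HJ s y Hs ltac:(lra)) as [J _]. pose proof (Hm0 s y). nra.
    - rewrite RInt_const. unfold scal; simpl; unfold mult; simpl. lra. }
  assert (Hdec : forall s t, 0 <= s < t -> t <= 1 -> e * I t <= e * I s).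
  { intros s t Hs Ht.
    destruct (mean_value_open I (fun s => RInt (fun y => phis s y * py s y - phiy s y * ps s y) a b) s t)
      as [x [Hx Ex]]; [lra|intros x Hx; apply DI; lra|intros; apply CI|].
    rewrite EIK in Ex by lra. pose proof (HK x ltac:(lra)).
    assert (e * (I t - I s) = 2 * (K x * (t - s))) by (rewrite Ex; transitivity (e ^ 2 * (2 * K x * (t - s))); [ring|rewrite He; ring]).
    nra. }
  assert (HI1 : I 1 = 0).
  { unfold I. rewrite (RInt_ext _ (fun _ => 0)).
    - rewrite RInt_const. unfold scal; simpl; unfold mult; simpl. ring.
    - intros y Hy. rewrite Rmin_left, Rmax_right in Hy by lra.
      unfold phi. rewrite (Hmz 1 y) by (apply Hone; lra).
      change (0 ^ 2 * py 1 y = 0). ring. }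
  assert (HI0 : e * I 0 <= 0) by exact Hbd.
  assert (HI : forall s, 0 < s < 1 -> I s = 0).
  { intros s Hs. pose proof (Hdec 0 s ltac:(lra) ltac:(lra)). pose proof (Hdec s 1 ltac:(lra) ltac:(lra)).
    rewrite HI1 in H0. assert (Z : e * I s = 0) by lra.
    transitivity (e ^ 2 * I s); [rewrite He; ring|]. transitivity (e * (e * I s)); [ring|]. rewrite Z; ring. }
  assert (HK0 : forall s, 0 < s < 1 -> K s = 0).
  { intros s Hs. assert (D := DI s Hs). rewrite EIK in D by exact Hs.
    assert (D0 : is_derive I s 0).
    { apply (is_derive_ext_near (fun _ => 0) I s 0 (Rmin s (1 - s))).
      - apply Rmin_glb_lt; lra.
      - intros t Ht. rmin_facts. apply Rabs_def2 in Ht.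
        symmetry. apply HI. lra.
      - apply (is_derive_const 0 s). }
    assert (Z : 2 * e * K s = 0) by (rewrite <- (is_derive_unique _ _ _ D); exact (is_derive_unique _ _ _ D0)).
    transitivity (e ^ 2 * K s); [rewrite He; ring|]. transitivity (/ 2 * e * (2 * e * K s)); [field|]. rewrite Z; ring. }
  assert (Hmw : forall s y, 0 < s < 1 -> a < y < b -> m s y * ws s y = 0).
  { intros s y Hs Hy.
    assert (Z : - (m s y * (ws s y * py s y - wy s y * ps s y)) = 0).
    { apply (RInt_nonneg_zero (fun y => - (m s y * (ws s y * py s y - wy s y * ps s y))) a b).
      - intros x Hx. apply (continuous_opp (fun y => m s y * (ws s y * py s y - wy s y * ps s y))). now apply CJ.
      - intros x Hx. destruct (HJ s x Hs Hx) as [J _]. pose proof (Hm0 s x). nra.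
      - transitivity (- K s); [|rewrite HK0 by exact Hs; exact Ropp_0].
        apply is_RInt_unique. apply (is_RInt_opp (fun y => m s y * (ws s y * py s y - wy s y * ps s y))).
        apply (RInt_correct (V := R_CompleteNormedModule)), ex_RInt_segment; [lra|].
        intros x Hx. now apply CJ.
      - exact Hy. }
    destruct (Req_dec (m s y) 0) as [Z0|Z0]; [rewrite Z0; ring|].
    destruct (HJ s y Hs ltac:(lra)) as [_ J0]. rewrite J0; [ring|].
    apply (Rmult_eq_reg_l (m s y)); [lra|exact Z0]. }
  intros s y Hs Hy.
  destruct (mean_value_open (fun t => phi t y) (fun t => phis t y) s 1) as [x [Hx Ex]]; [lra| | |].
  - intros x Hx. destruct (Hd x y ltac:(lra) ltac:(lra)) as (_ & _ & D3 & _). exact (Dm _ _ _ D3).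
  - intros x _. apply continuity_pt_filterlim. apply (continuity_2d_slice_l phi x y). apply Cphi; lra.
  - cbv beta in Ex. unfold phis in Ex.
    replace (2 * e * m x y * ws x y) with (2 * e * (m x y * ws x y)) in Ex by ring.
    rewrite Hmw in Ex by lra. unfold phi in Ex. rewrite (Hmz 1 y) in Ex by (apply Hone; lra).
    assert (Z : m s y = 0) by (apply Rsqr_0_uniq; unfold Rsqr; lra).
    unfold m in Z. rewrite <- Z. apply Rmax_r.
Qed.

(** * Geometry of the two regions *)

Lemma tan_pos_of_angle (th : R) : 0 < th < PI / 2 -> 0 < tan th.
Proof. intros H. apply tan_gt_0; lra. Qed.

Lemma cot_tan (th : R) : 0 < th < PI / 2 -> cot th * tan th = 1.
Proof.
  intros H. unfold cot, tan. field. split.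
  - apply Rgt_not_eq, cos_gt_0; lra.
  - apply Rgt_not_eq, sin_gt_0; lra.
Qed.

Lemma cot_pos (th : R) : 0 < th < PI / 2 -> 0 < cot th.
Proof.
  intros H. pose proof (cot_tan th H). pose proof (tan_pos_of_angle th H). nra.
Qed.

Lemma wedge_iff (th x y : R) : 0 < th < PI / 2 -> (x * tan th < y <-> x < y * cot th).
Proof.
  intros H. pose proof (cot_tan th H). pose proof (tan_pos_of_angle th H). pose proof (cot_pos th H).
  split; intros K.
  - apply (Rmult_lt_reg_r (tan th)); [lra|]. rewrite Rmult_assoc, H0. lra.
  - apply (Rmult_lt_reg_r (cot th)); [lra|]. rewrite Rmult_assoc, (Rmult_comm (tan th)), H0. lra.
Qed.

Arguments tss_regular_ahead {_ _ _ _ _ _ _ _} _.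
Arguments tss_regular_behind {_ _ _ _ _ _ _ _} _.
Arguments tss_pos_ahead {_ _ _ _ _ _ _ _} _ _ _.
Arguments tss_pos_behind {_ _ _ _ _ _ _ _} _ _ _.
Arguments tss_subsonic {_ _ _ _ _ _ _ _} _ _ _.
Arguments tss_euler_ahead {_ _ _ _ _ _ _ _} _ _ _ _.
Arguments tss_euler_behind {_ _ _ _ _ _ _ _} _ _ _ _.
Arguments tss_entrance {_ _ _ _ _ _ _ _} _ _ _.
Arguments tss_slip {_ _ _ _ _ _ _ _} _ _ _.
Arguments tss_shock {_ _ _ _ _ _ _ _} _ _ _.

Section Wedge.
Variables (th : R) (f : R -> R).
Hypotheses (Hth : 0 < th < PI / 2) (Hf : shock_profile th f).

Lemma profile_continuity (y : R) :
  0 < y ->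
  0 < f y < y * cot th /\ is_derive f y (Derive f y) /\ continuity_pt f y.
Proof.
  destruct Hf as (H1 & _ & _ & H4). intros Hy. split; [now apply H4|].
  destruct (H1 y Hy) as [H _]. specialize (H 1%nat ltac:(auto)). simpl in H.
  assert (D : is_derive f y (Derive f y)) by (apply Derive_correct; exact H).
  split; [exact D|]. eapply is_derive_continuity_pt, D.
Qed.

Lemma profile_second_derivative (y : R) :
  0 < y ->
  is_derive (Derive f) y (Derive_n f 2 y) /\ continuous (Derive_n f 2) y.
Proof.
  destruct Hf as (H1 & _). intros Hy. destruct (H1 y Hy) as [H Hc]. split; [|exact Hc].
  specialize (H 2%nat ltac:(auto)). exact (Derive_correct (Derive_n f 1) y H).
Qed.

Lemma profile_limit_zero (eps : R) :
  0 < eps -> exists d, 0 < d /\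
    forall y, 0 <= y < d -> Rabs (f y) < eps.
Proof.
  destruct Hf as (_ & Hc & H0 & _). intros Heps.
  assert (Hb : locally (f 0) (fun z => Rabs (z - f 0) < eps)).
  { exists (mkposreal _ Heps). intros z Hz. exact Hz. }
  destruct (Hc 0 (Rle_refl 0) _ Hb) as [d Hd]. exists d; split; [apply cond_pos|].
  intros y Hy. specialize (Hd y). rewrite H0, Rminus_0_r in Hd. apply Hd; [|lra].
  change (Rabs (y - 0) < d). apply Rabs_def1; lra.
Qed.

Lemma ahead_iff (x y : R) :
  (ahead th f (x, y) <-> 0 < y /\ 0 < x < f y).
Proof.
  unfold ahead, Defs.domain; simpl. pose proof (tan_pos_of_angle th Hth). split.
  - intros [[K1 K2] K3]. split; [nra|lra].
  - intros [K1 K2]. destruct (profile_continuity y K1) as [Hb _].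
    rewrite (wedge_iff th x y Hth). lra.
Qed.

Lemma behind_iff (x y : R) :
  (behind th f (x, y) <-> 0 < y /\ f y < x < y * cot th).
Proof.
  unfold behind, Defs.domain; simpl. pose proof (tan_pos_of_angle th Hth).
  rewrite (wedge_iff th x y Hth). split.
  - intros [[K1 K2] K3]. split; [|lra]. rewrite <- (wedge_iff th x y Hth) in K2. nra.
  - intros [K1 K2]. destruct (profile_continuity y K1) as [Hb _]. lra.
Qed.

Lemma ahead_open (q : R * R) :
  ahead th f q -> locally q (ahead th f).
Proof.
  destruct q as [x y]. intros Hq. apply (ahead_iff x y) in Hq.
  destruct Hq as [Hy Hx]. destruct (profile_continuity y Hy) as (_ & _ & Hc).
  destruct (continuity_pt_lt f y ((x + f y) / 2) Hc ltac:(lra)) as [d [Hd Hd']].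
  assert (Hm : 0 < Rmin (Rmin d y) (Rmin x ((f y - x) / 2))) by (repeat apply Rmin_glb_lt; lra).
  apply (locally_pair x y _ _ Hm). intros u v Hu Hv.
  rmin_facts.
  apply (ahead_iff u v). specialize (Hd' v ltac:(lra)).
  apply Rabs_def2 in Hu. apply Rabs_def2 in Hv. lra.
Qed.

Lemma behind_open (q : R * R) :
  behind th f q -> locally q (behind th f).
Proof.
  destruct q as [x y]. intros Hq. apply (behind_iff x y) in Hq.
  destruct Hq as [Hy Hx]. destruct (profile_continuity y Hy) as (_ & _ & Hc).
  pose proof (cot_pos th Hth).
  destruct (continuity_pt_gt f y ((x + f y) / 2) Hc ltac:(lra)) as [d [Hd Hd']].
  set (e := (y * cot th - x) / (2 * (1 + cot th))).
  assert (He : 0 < e) by (apply Rdiv_lt_0_compat; lra).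
  assert (He' : e * (2 * (1 + cot th)) = y * cot th - x) by (unfold e; field; lra).
  assert (Hm : 0 < Rmin (Rmin d y) (Rmin e ((x - f y) / 2))) by (repeat apply Rmin_glb_lt; lra).
  apply (locally_pair x y _ _ Hm). intros u v Hu Hv.
  rmin_facts.
  apply (behind_iff u v). specialize (Hd' v ltac:(lra)).
  apply Rabs_def2 in Hu. apply Rabs_def2 in Hv. split; [lra|]. split; [lra|].
  assert ((y - v) * cot th <= e * cot th) by (apply Rmult_le_compat_r; lra). lra.
Qed.

Lemma behind_not_origin (q : R * R) : behind th f q -> closure (behind th f) q /\ q <> origin.
Proof.
  destruct q as [a b]. intros Hz. split; [now apply subset_closure|]. intros E. injection E as -> ->.
  apply behind_iff in Hz. lra.
Qed.

Lemma origin_closure :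
  closure (ahead th f) (0, 0) /\ closure (behind th f) (0, 0).
Proof.
  pose proof (cot_pos th Hth) as Hcot.
  split; apply closure_intro; intros eps Heps.
  - destruct (profile_limit_zero eps Heps) as [d [Hd H]].
    set (y := Rmin d eps / 2).
    assert (Hm : 0 < Rmin d eps) by (apply Rmin_glb_lt; lra).
    rmin_facts.
    assert (Hy : 0 < y /\ y < d /\ y < eps) by (unfold y; lra). clearbody y.
    destruct (profile_continuity y ltac:(lra)) as [Hb _].
    exists (f y / 2), y. specialize (H y ltac:(lra)).
    rewrite (Rabs_pos_eq (f y)) in H by lra.
    rewrite !Rminus_0_r, (Rabs_pos_eq (f y / 2)), (Rabs_pos_eq y) by lra.
    split; [lra|split; [lra|]]. apply ahead_iff. lra.
  - set (e := eps / (1 + cot th)).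
    assert (He : 0 < e) by (apply Rdiv_lt_0_compat; lra).
    assert (He' : e * (1 + cot th) = eps) by (unfold e; field; lra).
    set (y := e / 2).
    assert (Hec : 0 < e * cot th) by (apply Rmult_lt_0_compat; lra).
    assert (Hy : 0 < y /\ y < eps /\ y * cot th < eps) by (unfold y; lra). clearbody y.
    destruct (profile_continuity y ltac:(lra)) as [Hb _].
    exists ((f y + y * cot th) / 2), y.
    rewrite !Rminus_0_r, !Rabs_pos_eq by lra.
    split; [lra|split; [lra|]]. apply behind_iff. lra.
Qed.

Lemma closure_ahead (x y : R) :
  0 <= y -> 0 <= x <= f y ->
  closure (ahead th f) (x, y).
Proof.
  intros Hy Hx. destruct (Req_dec y 0) as [->|Hy0].
  - assert (f 0 = 0) by apply Hf. replace x with 0 by lra. now apply origin_closure.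
  - assert (Hy' : 0 < y) by lra. destruct (profile_continuity y Hy') as [Hb _].
    apply closure_intro. intros eps Heps.
    destruct (interval_approx 0 (f y) x eps) as [x' [H1 H2]]; try lra.
    exists x', y. rewrite Rminus_diag, Rabs_R0. split; [lra|split; [lra|]].
    apply ahead_iff; lra.
Qed.

Lemma closure_behind (x y : R) :
  0 <= y -> f y <= x <= y * cot th ->
  closure (behind th f) (x, y).
Proof.
  intros Hy Hx. destruct (Req_dec y 0) as [->|Hy0].
  - assert (f 0 = 0) by apply Hf. replace x with 0 by lra.
    now apply origin_closure.
  - assert (Hy' : 0 < y) by lra. destruct (profile_continuity y Hy') as [Hb _].
    apply closure_intro. intros eps Heps.
    destruct (interval_approx (f y) (y * cot th) x eps) as [x' [H1 H2]]; try lra.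
    exists x', y. rewrite Rminus_diag, Rabs_R0. split; [lra|split; [lra|]].
    apply behind_iff; lra.
Qed.

Lemma shock_in_closures (y : R) :
  0 <= y -> closure (ahead th f) (f y, y) /\ closure (behind th f) (f y, y).
Proof.
  intros Hy. assert (H : 0 <= f y <= y * cot th).
  { destruct (Req_dec y 0) as [->|Hy'].
    - replace (f 0) with 0 by (symmetry; apply Hf). lra.
    - destruct (profile_continuity y ltac:(lra)); lra. }
  split; [apply closure_ahead|apply closure_behind]; lra.
Qed.

(** The filter of the heights tending to [y0] from among the positive ones, so
    that the vertex [y0 = 0] is treated like the other points of the shock-front. *)
Definition at_height (y0 : R) : (R -> Prop) -> Prop := within (fun y => 0 < y) (locally y0).

Lemma at_height_proper (y0 : R) : 0 <= y0 -> ProperFilter (at_height y0).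
Proof.
  intros Hy0. constructor.
  - intros P [d Hd]. exists (y0 + d / 2). pose proof (cond_pos d). apply Hd; [|lra].
    change (Rabs (y0 + d / 2 - y0) < d). replace (y0 + d / 2 - y0) with (d / 2) by ring. rewrite Rabs_pos_eq; lra.
  - apply within_filter, locally_filter.
Qed.

Lemma at_height_pos (y0 : R) (P : R -> Prop) : (forall y, 0 < y -> P y) -> at_height y0 P.
Proof. intros H. exists (mkposreal 1 Rlt_0_1). intros y _ Hy. now apply H. Qed.

Lemma shock_approach (D : R * R -> Prop) (y0 : R) :
  0 <= y0 -> (forall y, 0 < y -> D (f y, y)) ->
  filterlim (fun y => (f y, y)) (at_height y0) (within D (locally (f y0, y0))).
Proof.
  destruct Hf as (_ & Hc & _). intros Hy0 HD P [d HP].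
  assert (Hb : locally (f y0) (ball (f y0) d)) by (exists d; auto).
  destruct (Hc y0 Hy0 _ Hb) as [e He].
  exists (mkposreal _ (Rmin_stable_in_posreal d e)). intros y Hy Hpos.
  apply HP; [|now apply HD]. split.
  - apply He; [|lra]. eapply Rlt_le_trans; [exact Hy|apply Rmin_r].
  - eapply Rlt_le_trans; [exact Hy|apply Rmin_l].
Qed.

Definition clip (s : R) : R := Rmax 0 (Rmin 1 s).

Lemma clip_range (s : R) : 0 <= clip s <= 1.
Proof. unfold clip. split; [apply Rmax_l|]. apply Rmax_lub; [lra|apply Rmin_l]. Qed.

Lemma clip_id (s : R) : 0 <= s <= 1 -> clip s = s.
Proof. intros Hs. unfold clip. rewrite Rmin_right, Rmax_right; lra. Qed.

Lemma continuity_clip (s : R) : continuity_pt clip s.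
Proof.
  apply continuity_pt_abs. intros eps Heps. exists eps; split; [exact Heps|]. intros t Ht.
  apply Rabs_def2 in Ht. unfold clip, Rmax, Rmin.
  destruct (Rle_dec 1 t), (Rle_dec 1 s); destruct (Rle_dec _ _); try destruct (Rle_dec _ _); apply Rabs_def1; lra.
Qed.

(** The coordinate [s] runs from [0] on the shock-front to [1] on the ramp, at
    fixed height. *)
Definition strip_x (s y : R) : R := (1 - s) * f y + s * (y * cot th).

Lemma strip_position (x y : R) :
  0 < y -> f y < x < y * cot th -> exists s, 0 < s < 1 /\ strip_x s y = x.
Proof.
  intros Hy Hx. exists ((x - f y) / (y * cot th - f y)). split.
  - split; [apply Rdiv_lt_0_compat; lra|]. apply (Rmult_lt_reg_r (y * cot th - f y)); [lra|].
    unfold Rdiv. rewrite Rmult_assoc, Rinv_l by lra. lra.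
  - unfold strip_x. field. lra.
Qed.

Lemma strip_ends (y : R) : strip_x 0 y = f y /\ strip_x 1 y = y * cot th.
Proof. unfold strip_x. split; ring. Qed.

Lemma strip_closure (s y : R) :
  0 < y -> 0 <= s <= 1 ->
  closure (behind th f) (strip_x s y, y).
Proof.
  intros Hy Hs. destruct (profile_continuity y Hy) as [Hb _].
  apply closure_behind; try assumption; [lra|]. unfold strip_x. split; nra.
Qed.

Lemma strip_behind (s y : R) :
  0 < y -> 0 < s < 1 ->
  behind th f (strip_x s y, y).
Proof.
  intros Hy Hs. destruct (profile_continuity y Hy) as [Hb _].
  apply behind_iff; try assumption. unfold strip_x. split; [exact Hy|split; nra].
Qed.

(** Clipping [s] to [[0, 1]] makes the field continuous on a full neighbourhood of
    the boundary points of the strip. *)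
Lemma strip_continuity (D : R * R -> Prop) (g : R * R -> R) (s y : R) :
  (forall q, closure (behind th f) q -> q <> origin -> D q) ->
  continuous_on D g -> 0 < y ->
  continuity_2d_pt (fun s y => g (strip_x (clip s) y, y)) s y.
Proof.
  intros HD Hg Hy.
  assert (Hin : forall s y, 0 < y -> D (strip_x (clip s) y, y)).
  { intros a b Hb. apply HD.
    - apply strip_closure; try assumption. apply clip_range.
    - intros E. injection E as _ E. lra. }
  apply (continuity_2d_comp_within D g (fun s y => strip_x (clip s) y) (fun _ y => y)).
  - destruct (profile_continuity y Hy) as (_ & _ & Hc). unfold strip_x.
    assert (C1 : continuity_2d_pt (fun s _ => clip s) s y).
    { apply (continuity_1d_2d_pt_comp clip (fun s _ => s)); [apply continuity_clip|apply continuity_2d_pt_id1]. }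
    assert (C2 : continuity_2d_pt (fun _ y => f y) s y)
      by (apply (continuity_1d_2d_pt_comp f (fun _ y => y)); [exact Hc|apply continuity_2d_pt_id2]).
    cont2d.
  - apply continuity_2d_pt_id2.
  - exists (mkposreal y Hy). simpl. intros u v _ Hv. apply Rabs_def2 in Hv. apply Hin. lra.
  - apply Hg, Hin, Hy.
Qed.

Lemma strip_derivatives (g gx gy : R * R -> R) (s y : R) :
  has_gradient (behind th f) g gx gy ->
  continuous_on (fun q => closure (behind th f) q /\ q <> origin) gx ->
  continuous_on (fun q => closure (behind th f) q /\ q <> origin) gy ->
  0 < s < 1 -> 0 < y ->
  is_derive (fun t => g (strip_x (clip t) y, y)) s
    (gx (strip_x (clip s) y, y) * (y * cot th - f y)) /\
  is_derive (fun t => g (strip_x (clip s) t, t)) y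
    (gx (strip_x (clip s) y, y) * ((1 - clip s) * Derive f y + clip s * cot th)
     + gy (strip_x (clip s) y, y)).
Proof.
  intros Hg Cx Cy Hs Hy.
  assert (Hcs : clip s = s) by (apply clip_id; lra). rewrite Hcs.
  set (x := strip_x s y).
  assert (Hxy : behind th f (x, y)) by now apply strip_behind.
  assert (Hopen := behind_open _ Hxy).
  assert (Hdiff : differentiable_pt_lim (fun a b => g (a, b)) x y (gx (x, y)) (gy (x, y))).
  { apply (differentiable_of_partials (fun a b => g (a, b)) (fun a b => gx (a, b)) (fun a b => gy (a, b))).
    - apply locally_2d_locally. revert Hopen. apply filter_imp. intros [a b] Hab. exact (Hg a b Hab).
    - exact (continuity_2d_interior _ _ gx x y behind_not_origin Hopen Cx).
    - exact (continuity_2d_interior _ _ gy x y behind_not_origin Hopen Cy). }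
  destruct (profile_continuity y Hy) as (_ & Df & _).
  split.
  - assert (D : derivable_pt_lim (fun t => g (strip_x t y, y)) s
      (gx (x, y) * (y * cot th - f y) + gy (x, y) * 0)).
    { apply (derivable_pt_lim_comp_2d (fun a b => g (a, b)) (fun t => strip_x t y) (fun _ => y)); [exact Hdiff| |].
      - apply is_derive_Reals. unfold strip_x. auto_derive; [exact I|ring].
      - apply derivable_pt_lim_const. }
    apply is_derive_Reals in D. rewrite Rmult_0_r, Rplus_0_r in D.
    refine (is_derive_ext_near _ _ s _ (Rmin s (1 - s)) _ _ D); [apply Rmin_glb_lt; lra|].
    intros t Ht. rmin_facts. apply Rabs_def2 in Ht.
    rewrite clip_id by lra. reflexivity.
  - assert (D : derivable_pt_lim (fun t => g (strip_x s t, t)) y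
      (gx (x, y) * ((1 - s) * Derive f y + s * cot th) + gy (x, y) * 1)).
    { apply (derivable_pt_lim_comp_2d (fun a b => g (a, b)) (fun t => strip_x s t) (fun t => t)); [exact Hdiff| |].
      - apply is_derive_Reals. unfold strip_x.
        assert (Ef : ex_derive f y) by now exists (Derive f y).
        auto_derive; [exact Ef|]. change (Derive (fun x0 : R => f x0) y) with (Derive f y). ring.
      - apply derivable_pt_lim_id. }
    apply is_derive_Reals in D. rewrite Rmult_1_r in D. exact D.
Qed.

(** * The flow ahead of the shock-front *)

Variables (gamma p0 u0 rho0 : R) (Um Up : R * R -> state).
Hypotheses (Hg : 1 < gamma) (Hp0 : 0 < p0) (Hu0 : 0 < u0) (Hr0 : 0 < rho0)
  (HM0 : 1 < mach0 gamma p0 u0 rho0)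
  (Hsol : transonic_shock_solution gamma p0 u0 rho0 th f Um Up).
Local Notation M := (mach0 gamma p0 u0 rho0).
Local Notation U0 := (upstream p0 u0 rho0).

Lemma flow_bernoulli :
  (forall q, closure (ahead th f) q -> bernoulli gamma (Um q) = b0 gamma p0 u0 rho0) /\
  (forall q, closure (behind th f) q -> bernoulli gamma (Up q) = b0 gamma p0 u0 rho0).
Proof.
  split; intros q Hq; eapply bernoulli_closure; try exact Hq; try exact Hg.
  - exact (regular_flow_continuous _ _ (tss_regular_ahead Hsol)).
  - apply (tss_pos_ahead Hsol).
  - intros [x y] Hxy. apply (tss_euler_ahead Hsol x y Hxy).
  - exact (regular_flow_continuous _ _ (tss_regular_behind Hsol)).
  - apply (tss_pos_behind Hsol).
  - intros [x y] Hxy. apply (tss_euler_behind Hsol x y Hxy).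
Qed.

(** The third jump condition can be solved for [f'] in terms of the two states,
    which are continuous up to the vertex; so [f'] has a limit at any height where
    the incoming state is [U0], the vertex included, and the equation for the
    normal Mach number passes to the limit. *)
Lemma shock_inclination_limit (y0 : R) :
  0 <= y0 -> Um (f y0, y0) = U0 -> p0 < pres (Up (f y0, y0)) ->
  exists s, filterlim (Derive f) (at_height y0) (locally s) /\ spacelike gamma p0 s U0.
Proof.
  intros Hy0 HU HP.
  assert (Cm := fun y Hy => proj1 (shock_in_closures y Hy)).
  assert (Cp := fun y Hy => proj2 (shock_in_closures y Hy)).
  pose proof (at_height_proper y0 Hy0) as PF.
  assert (FF : Filter (at_height y0)) by apply PF.
  assert (Am := shock_approach _ y0 Hy0 (fun y Hy => Cm y (Rlt_le _ _ Hy))).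
  assert (Ap := shock_approach _ y0 Hy0 (fun y Hy => Cp y (Rlt_le _ _ Hy))).
  destruct (regular_flow_continuous _ _ (tss_regular_ahead Hsol)) as (M1 & M2 & M3 & M4).
  destruct (regular_flow_continuous _ _ (tss_regular_behind Hsol)) as (P1 & _ & P3 & _).
  specialize (M1 _ (Cm y0 Hy0)). specialize (M2 _ (Cm y0 Hy0)).
  specialize (M3 _ (Cm y0 Hy0)). specialize (M4 _ (Cm y0 Hy0)).
  specialize (P1 _ (Cp y0 Hy0)). specialize (P3 _ (Cp y0 Hy0)).
  assert (LU : forall g : state -> R,
    filterlim (fun q => g (Um q)) (within (closure (ahead th f)) (locally (f y0, y0))) (locally (g (Um (f y0, y0)))) ->
    filterlim (fun y => g (Um (f y, y))) (at_height y0) (locally (g U0))).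
  { intros g Lg. rewrite <- HU. exact (filterlim_comp _ _ _ _ _ _ _ _ Am Lg). }
  apply LU in M1, M2, M3, M4. simpl in M1, M2, M3, M4.
  assert (K1 : filterlim (fun y => pres (Up (f y, y))) (at_height y0) (locally (pres (Up (f y0, y0)))))
    by exact (filterlim_comp _ _ _ _ _ _ _ _ Ap P1).
  assert (K3 : filterlim (fun y => vely (Up (f y, y))) (at_height y0) (locally (vely (Up (f y0, y0)))))
    by exact (filterlim_comp _ _ _ _ _ _ _ _ Ap P3).
  set (pp := pres (Up (f y0, y0))) in *. set (vp := vely (Up (f y0, y0))) in *.
  assert (RH := fun y (Hy : 0 < y) => rankine_hugoniot_normal gamma (b0 gamma p0 u0 rho0) (Derive f y)
     (Um (f y, y)) (Up (f y, y)) Hg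
     (proj2 (tss_pos_ahead Hsol _ (Cm y (Rlt_le _ _ Hy))))
     (proj2 (tss_pos_behind Hsol _ (Cp y (Rlt_le _ _ Hy))))
     (proj1 (tss_pos_ahead Hsol _ (Cm y (Rlt_le _ _ Hy))))
     (proj1 (tss_pos_behind Hsol _ (Cp y (Rlt_le _ _ Hy))))
     (proj1 flow_bernoulli _ (Cm y (Rlt_le _ _ Hy))) (proj2 flow_bernoulli _ (Cp y (Rlt_le _ _ Hy)))
     (tss_shock Hsol y Hy)).
  (* The third jump condition reads [f' * den = num]. *)
  set (den := fun y => (pres (Up (f y, y)) - pres (Um (f y, y)))
      + dens (Um (f y, y)) * vely (Um (f y, y)) * (vely (Up (f y, y)) - vely (Um (f y, y)))).
  set (num := fun y => dens (Um (f y, y)) * velx (Um (f y, y)) * (vely (Up (f y, y)) - vely (Um (f y, y)))).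
  assert (Lden : filterlim den (at_height y0) (locally ((pp - p0) + rho0 * 0 * (vp - 0)))).
  { unfold den. apply flim_plus; [apply flim_minus; assumption|].
    apply flim_mult; [apply flim_mult; assumption|apply flim_minus; assumption]. }
  replace ((pp - p0) + rho0 * 0 * (vp - 0)) with (pp - p0) in Lden by ring.
  assert (Lnum : filterlim num (at_height y0) (locally (rho0 * u0 * (vp - 0)))).
  { unfold num. apply flim_mult; [apply flim_mult; assumption|apply flim_minus; assumption]. }
  set (s := rho0 * u0 * (vp - 0) / (pp - p0)).
  assert (Ls : filterlim (Derive f) (at_height y0) (locally s)).
  { apply (filterlim_ext_loc (fun y => num y / den y)).
    - assert (Hpos : at_height y0 (fun y => 0 < den y)) by (apply (flim_gt den (pp - p0) 0 Lden); lra).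
      generalize (filter_and _ _ Hpos (at_height_pos y0 _ (fun y Hy => Hy))). apply filter_imp. intros y [Hd Hy'].
      destruct (RH y Hy') as (_ & _ & R3 & _).
      apply (Rmult_eq_reg_r (den y)); [|lra]. unfold Rdiv. rewrite Rmult_assoc, Rinv_l, Rmult_1_r by lra.
      unfold num, den. lra.
    - apply flim_div; [exact Lnum|exact Lden|lra]. }
  exists s. split; [exact Ls|].
  assert (Elim : rho0 * (u0 - s * 0) ^ 2 = (1 + s ^ 2) * (gamma * p0 + (gamma + 1) / 2 * (pp - p0))).
  { apply (filterlim_locally_unique (F := at_height y0)
      (fun y => dens (Um (f y, y)) * (velx (Um (f y, y)) - Derive f y * vely (Um (f y, y))) ^ 2)).
    - apply flim_mult; [exact M4|]. apply flim_pow2, flim_minus; [exact M2|].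
      apply flim_mult; [exact Ls|exact M3].
    - apply (filterlim_ext_loc (fun y => (1 + Derive f y ^ 2) * (gamma * pres (Um (f y, y)) +
        (gamma + 1) / 2 * (pres (Up (f y, y)) - pres (Um (f y, y)))))).
      + apply at_height_pos. intros y Hy. symmetry. apply (RH y Hy).
      + apply flim_mult; [apply flim_plus; [apply filterlim_const|apply flim_pow2, Ls]|].
        apply flim_plus; apply flim_mult; try apply filterlim_const; [exact M1|].
        apply flim_minus; assumption. }
  apply spacelike_upstream; try assumption.
  apply (Rmult_lt_reg_l rho0); [exact Hr0|].
  replace (rho0 * ((1 + s ^ 2) * (gamma * p0 / rho0))) with ((1 + s ^ 2) * (gamma * p0)) by (field; lra).
  assert (0 < 1 + s ^ 2) by nra.
  assert (0 < (1 + s ^ 2) * ((gamma + 1) / 2 * (pp - p0))).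
  { apply Rmult_lt_0_compat; [assumption|]. apply Rmult_lt_0_compat; lra. }
  lra.
Qed.

(** To the left of the entrance the flow is continued by the uniform state. *)
Definition ahead_extension (x y : R) : state := Um (Rmax 0 x, y).

Definition relative_stream : R -> R -> R :=
  stream (fun x y => relative_flux_y gamma p0 u0 rho0 (ahead_extension x y)).

Lemma ahead_extension_left (x y : R) : 0 < y -> x <= 0 -> ahead_extension x y = U0.
Proof.
  intros Hy Hx. unfold ahead_extension. rewrite Rmax_left by exact Hx.
  apply (tss_entrance Hsol). split; simpl; lra.
Qed.

Lemma relative_stream_differentiable (x y : R) :
  0 < y -> x < f y ->
  differentiable_pt_lim relative_stream x y
    (- relative_flux_y gamma p0 u0 rho0 (ahead_extension x y))
    (relative_flux_x gamma p0 u0 rho0 (ahead_extension x y)).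
Proof.
  revert x y. pose proof (tss_pos_ahead Hsol) as Hpos.
  destruct (tss_regular_ahead Hsol) as ((Cp & px & py & Gp & Cpx & Cpy) &
    (Cu & ux & uy & Gu & Cux & Cuy) & (Cv & vx & vy & Gv & Cvx & Cvy) & (Cr & rx & ry & Gr & Crx & Cry)).
  assert (Hprof : forall y, 0 < y -> 0 < f y /\ continuity_pt f y).
  { intros y Hy. destruct (profile_continuity y Hy) as (H1 & _ & H3). split; [lra|exact H3]. }
  assert (Hcl : forall x y, 0 < y -> x < f y -> closure (ahead th f) (Rmax 0 x, y)).
  { intros x y Hy Hx. apply closure_ahead; [lra|].
    split; [apply Rmax_l|]. apply Rmax_lub; [|lra]. apply Rlt_le, Hprof, Hy. }
  assert (Hcont : forall g : R * R -> R, continuous_on (closure (ahead th f)) g ->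
    forall x y, 0 < y -> x < f y -> continuity_2d_pt (fun a b => g (Rmax 0 a, b)) x y).
  { intros g Hgc x y Hy Hx.
    apply (continuity_2d_comp_within (closure (ahead th f)) g (fun a _ => Rmax 0 a) (fun _ b => b)).
    - apply continuity_2d_Rmax0.
    - apply continuity_2d_pt_id2.
    - destruct (Hprof y Hy) as [_ Hfc].
      destruct (continuity_pt_lt f y ((x + f y) / 2) Hfc ltac:(lra)) as [d [Hd Hd']].
      assert (Hm : 0 < Rmin (Rmin d y) ((f y - x) / 2)) by (repeat apply Rmin_glb_lt; lra).
      exists (mkposreal _ Hm). simpl. intros a b Ha Hb. rmin_facts.
      specialize (Hd' b ltac:(lra)). apply Rabs_def2 in Ha. apply Rabs_def2 in Hb.
      apply Hcl; lra.
    - apply Hgc, Hcl; assumption. }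
  apply (stream_differentiable f _ _
    (fun x y => relative_flux_dy gamma p0 u0 rho0 (Um (x, y)) (py (x, y)) (uy (x, y)) (vy (x, y)) (ry (x, y))));
    [exact Hprof| | |].
  - intros x y Hy Hx.
    destruct (continuity_2d_relative_flux gamma p0 u0 rho0 ahead_extension x y) as (_ & _ & K1 & K2);
      try assumption; unfold ahead_extension.
    + apply Hpos, Hcl; assumption.
    + exact (Hcont (fun q => pres (Um q)) Cp x y Hy Hx).
    + exact (Hcont (fun q => velx (Um q)) Cu x y Hy Hx).
    + exact (Hcont (fun q => vely (Um q)) Cv x y Hy Hx).
    + exact (Hcont (fun q => dens (Um q)) Cr x y Hy Hx).
    + split; assumption.
  - intros x y Hy Hx. rewrite ahead_extension_left by assumption. now apply relative_flux_upstream.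
  - intros x y Hy Hx.
    assert (Hxy : ahead th f (x, y)) by (apply ahead_iff; lra).
    assert (Hopen := ahead_open (x, y) Hxy).
    destruct (relative_flux_divergence_free gamma p0 u0 rho0 (b0 gamma p0 u0 rho0) (ahead th f) Um
      px py ux uy vx vy rx ry Hg Hp0) with (x := x) (y := y) as [D1 D2]; try assumption.
    { exact ahead_open. }
    { intros q Hq. apply Hpos, subset_closure, Hq. }
    { apply (tss_euler_ahead Hsol). }
    assert (Hcle : forall z, ahead th f z -> closure (ahead th f) z) by apply subset_closure.
    assert (Hclo : forall z, ahead th f z -> closure (ahead th f) z /\ z <> origin).
    { intros [a b] Hz. split; [now apply subset_closure|]. intros He. injection He as -> ->.
      apply ahead_iff in Hz; lra. }
    assert (Hint : forall g, continuous_on (closure (ahead th f)) g -> continuity_2d_pt (fun a b => g (a, b)) x y)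
      by (intros g Hgc; exact (continuity_2d_interior _ _ g x y Hcle Hopen Hgc)).
    assert (Hint' : forall g, continuous_on (fun q => closure (ahead th f) q /\ q <> origin) g ->
      continuity_2d_pt (fun a b => g (a, b)) x y)
      by (intros g Hgc; exact (continuity_2d_interior _ _ g x y Hclo Hopen Hgc)).
    split; [|split].
    + unfold ahead_extension. refine (is_derive_ext_near _ _ x _ x _ _ D1); [lra|].
      intros t Ht. apply Rabs_def2 in Ht. rewrite Rmax_right by lra. reflexivity.
    + unfold ahead_extension. rewrite Rmax_right by lra. exact D2.
    + assert (Ip := Hint _ Cp). assert (Iu := Hint _ Cu). assert (Iv := Hint _ Cv). assert (Ir := Hint _ Cr).
      assert (Ipy := Hint' _ Cpy). assert (Iuy := Hint' _ Cuy). assert (Ivy := Hint' _ Cvy). assert (Iry := Hint' _ Cry).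
      assert (Hpp : 0 < pres (Um (x, y))) by (apply Hpos, subset_closure, Hxy).
      destruct (continuity_2d_relative_flux gamma p0 u0 rho0 (fun a b => Um (a, b)) x y) as (K0 & K1 & _ & _);
        try assumption.
      unfold relative_flux_dy.
      repeat first [ progress cont2d | apply continuity_2d_pt_inv; [|apply Rgt_not_eq; nra] ].
Qed.

Lemma relative_stream_left (x y : R) : 0 < y -> x <= 0 -> relative_stream x y = 0.
Proof.
  intros Hy Hx. unfold relative_stream, stream. rewrite RInt_zero; [apply Ropp_0|].
  intros s Hs. rewrite Rmin_right, Rmax_left in Hs by lra.
  rewrite ahead_extension_left by lra. now apply relative_flux_upstream.
Qed.

Lemma ahead_flux_sign (x y s : R) :
  0 < y -> x < f y -> (0 < x -> Um (x, y) <> U0 -> spacelike gamma p0 s (Um (x, y))) ->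
  relative_flux_x gamma p0 u0 rho0 (ahead_extension x y)
    - s * relative_flux_y gamma p0 u0 rho0 (ahead_extension x y) <= 0.
Proof.
  intros Hy Hx Hs.
  destruct (relative_flux_upstream gamma p0 u0 rho0 Hg Hp0) as [E1 E2].
  destruct (Rle_or_lt x 0) as [Hx0|Hx0].
  - rewrite ahead_extension_left, E1, E2 by assumption. lra.
  - unfold ahead_extension. rewrite Rmax_right by lra.
    destruct (classic (Um (x, y) = U0)) as [E|E]; [rewrite E, E1, E2; lra|].
    assert (Hxy : ahead th f (x, y)) by (apply ahead_iff; lra).
    destruct (tss_pos_ahead Hsol _ (subset_closure _ _ Hxy)).
    apply relative_flux_definite; try assumption.
    + apply (tss_euler_ahead Hsol x y Hxy).
    + now apply Hs.
Qed.

Lemma ahead_limit (E : R * R -> Prop) (q : R * R) :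
  closure E q -> (forall z, E z -> ahead th f z) -> closure (ahead th f) q ->
  (forall z, E z -> Um z = U0) -> Um q = U0.
Proof.
  intros Hq HE Hcl HEU.
  destruct (regular_flow_continuous _ _ (tss_regular_ahead Hsol)) as (C1 & C2 & C3 & C4).
  assert (HED : forall z, E z -> closure (ahead th f) z) by (intros z Hz; apply subset_closure, HE, Hz).
  assert (V1 := closure_value E _ (fun z => pres (Um z)) q p0 HED Hq (C1 q Hcl)).
  assert (V2 := closure_value E _ (fun z => velx (Um z)) q u0 HED Hq (C2 q Hcl)).
  assert (V3 := closure_value E _ (fun z => vely (Um z)) q 0 HED Hq (C3 q Hcl)).
  assert (V4 := closure_value E _ (fun z => dens (Um z)) q rho0 HED Hq (C4 q Hcl)).
  cbv beta in V1, V2, V3, V4. unfold upstream in *.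
  destruct (Um q) as [a b c d]; simpl pres in *; simpl velx in *; simpl vely in *; simpl dens in *.
  rewrite V1, V2, V3, V4; [reflexivity| | | |]; intros z Hz; rewrite (HEU z Hz); reflexivity.
Qed.

(** For [kap] small, the rays of slope [dx/dy = - kap] are crossed supersonically
    by [U0], and this is a domain of dependence bounded by such a ray. *)
Definition in_dependence (kap Y x y : R) : Prop := 0 < y /\ 0 < x < f y /\ x < kap * (Y - y).

(** The three kinds of curves along which the stream function is followed: the
    vertical lines, the rays, and the shock-front shifted to the left. *)
Definition all_spacelike (kap r x y : R) : Prop :=
  spacelike gamma p0 0 (Um (x, y)) /\ spacelike gamma p0 (- kap) (Um (x, y)) /\
  (f y - x < r -> spacelike gamma p0 (Derive f y) (Um (x, y))).

(** A curve crossed supersonically by [U0] is crossed supersonically by all nearby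
    states, which by uniform continuity are those just beyond the abscissa [ts].
    This needs a limit of [f'] where the shock-front meets [x = ts]; elsewhere the
    shock-front does not come within the distance [r]. *)
Lemma spacelike_beyond (kap Y ts : R) :
  0 < kap -> 0 < Y -> 0 <= ts -> spacelike gamma p0 0 U0 -> spacelike gamma p0 (- kap) U0 ->
  p0 < pres (Up origin) ->
  (forall y0, 0 <= y0 -> ts <= f y0 -> ts <= kap * (Y - y0) -> Um (ts, y0) = U0) ->
  exists r, 0 < r /\ forall x y, in_dependence kap Y x y -> ts <= x < ts + r -> all_spacelike kap r x y.
Proof.
  intros Hkap HY Hts0 Hsp0 Hspk HO Hat.
  destruct (regular_flow_continuous _ _ (tss_regular_ahead Hsol)) as (C1 & C2 & C3 & C4).
  destruct (uniform_radius (fun y r => 0 < y -> forall x, in_dependence kap Y x y -> ts <= x < ts + r ->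
     all_spacelike kap r x y) 0 Y) as [r [Hr HQ]].
  { lra. }
  { intros y r r' Hrr H Hy x HD Hx. destruct (H Hy x HD ltac:(lra)) as (A1 & A2 & A3).
    split; [exact A1|split; [exact A2|]]. intros H3. apply A3. lra. }
  2:{ exists r; split; [exact Hr|]. intros x y HD Hx. assert (HD' := HD). destruct HD' as (D1 & D2 & D3).
      apply (HQ y); try assumption. split; [lra|]. assert (0 < kap * (Y - y)) by lra. nra. }
  intros y0 Hy0.
  destruct (Rlt_or_le (kap * (Y - y0)) ts) as [Hk|Hk].
  { (* [(ts, y0)] lies beyond the bounding ray, and so do the points near it. *)
    assert (Hq : 0 < (ts - kap * (Y - y0)) / kap) by (apply Rdiv_lt_0_compat; lra).
    exists ((ts - kap * (Y - y0)) / kap). split; [exact Hq|]. intros y Hy Hyp x (_ & _ & H2) Hx. exfalso.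
    assert (Hy' : y0 - y < (ts - kap * (Y - y0)) / kap) by (apply Rabs_def2 in Hy; lra).
    assert (kap * (y0 - y) < kap * ((ts - kap * (Y - y0)) / kap)) by (apply Rmult_lt_compat_l; lra).
    replace (kap * ((ts - kap * (Y - y0)) / kap)) with (ts - kap * (Y - y0)) in H by (field; lra). lra. }
  destruct (Rlt_or_le (f y0) ts) as [Hfy|Hfy].
  { (* [(ts, y0)] lies behind the shock-front, and so do the points near it. *)
    assert (Hloc : exists d, 0 < d /\ forall y, 0 < y -> Rabs (y - y0) < d -> f y < ts).
    { destruct (Req_dec y0 0) as [Z|Z].
      - rewrite Z in *. replace (f 0) with 0 in Hfy by (symmetry; apply Hf).
        destruct (profile_limit_zero ts Hfy) as [d [Hd Hd']]. exists d; split; [exact Hd|].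
        intros y Hy H. apply Rabs_def2 in H. specialize (Hd' y ltac:(lra)).
        apply Rabs_def2 in Hd'. lra.
      - destruct (profile_continuity y0 ltac:(lra)) as (_ & _ & Hc).
        destruct (continuity_pt_gt f y0 ts Hc Hfy) as [d [Hd Hd']]. exists d; split; [exact Hd|].
        intros y _. apply Hd'. }
    destruct Hloc as [d [Hd Hd']]. exists d; split; [exact Hd|].
    intros y Hy Hyp x (_ & H1 & _) Hx. exfalso. specialize (Hd' y Hyp Hy). lra. }
  assert (Hcl : closure (ahead th f) (ts, y0)) by (apply closure_ahead; lra).
  assert (HU := Hat y0 (proj1 Hy0) Hfy Hk).
  assert (Hev : forall s s0 (W : R * R -> Prop),
     filterlim s (within (fun z => closure (ahead th f) z /\ W z) (locally (ts, y0))) (locally s0) ->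
     spacelike gamma p0 s0 U0 ->
     exists r, 0 < r /\ forall x y, Rabs (x - ts) < r -> Rabs (y - y0) < r ->
       closure (ahead th f) (x, y) -> W (x, y) -> spacelike gamma p0 (s (x, y)) (Um (x, y))).
  { intros s s0 W Hs Hsp.
    assert (FF' : Filter (within (fun z => closure (ahead th f) z /\ W z) (locally (ts, y0))))
      by (apply within_filter, locally_filter).
    assert (Hle : forall g : R * R -> R,
       filterlim g (within (closure (ahead th f)) (locally (ts, y0))) (locally (g (ts, y0))) ->
       filterlim g (within (fun z => closure (ahead th f) z /\ W z) (locally (ts, y0))) (locally (g (ts, y0)))).
    { intros g H P HP. specialize (H P HP). revert H. unfold filtermap, within. apply filter_imp. tauto. }
    assert (Hn : within (fun z => closure (ahead th f) z /\ W z) (locally (ts, y0))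
       (fun z => spacelike gamma p0 (s z) (Um z))).
    { apply (spacelike_eventually gamma p0 s0 (Um (ts, y0)) Um s).
      - apply (Hle (fun z => pres (Um z))), C1, Hcl.
      - apply (Hle (fun z => velx (Um z))), C2, Hcl.
      - apply (Hle (fun z => vely (Um z))), C3, Hcl.
      - apply (Hle (fun z => dens (Um z))), C4, Hcl.
      - exact Hs.
      - apply (tss_pos_ahead Hsol), Hcl.
      - rewrite HU. exact Hsp. }
    destruct Hn as [r Hr]. exists r; split; [apply cond_pos|]. intros x y Hx Hy H1 H2.
    apply (Hr (x, y)); [now split|now split]. }
  (* Near [(ts, y0)], either the shock-front is out of reach, or its slope has a limit. *)
  assert (HF : exists (W : R * R -> Prop) s s0,
     filterlim s (within (fun z => closure (ahead th f) z /\ W z) (locally (ts, y0))) (locally s0) /\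
     spacelike gamma p0 s0 U0 /\
     exists d, 0 < d /\ forall x y, ts <= x < ts + d -> Rabs (y - y0) < d -> 0 < y -> f y - x < d ->
       W (x, y) /\ s (x, y) = Derive f y).
  { destruct (Req_dec (f y0) ts) as [Ef|Ef].
    - assert (HPp : p0 < pres (Up (f y0, y0))).
      { destruct (Req_dec y0 0) as [Z|Z].
        - rewrite Z. replace (f 0) with 0 by (symmetry; apply Hf). exact HO.
        - destruct (tss_shock Hsol y0 ltac:(lra)) as (_ & _ & _ & Hj).
          unfold jump in Hj. rewrite Ef, HU in Hj. rewrite Ef. simpl in Hj. lra. }
      destruct (shock_inclination_limit y0) as [s0 [Hs0 Hsp]]; try assumption; [lra|now rewrite Ef|].
      exists (fun z => 0 < snd z), (fun z => Derive f (snd z)), s0. split; [|split; [exact Hsp|]].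
      + intros P HP. destruct (Hs0 P HP) as [d Hd]. exists d. intros [a b] [_ Hb] [_ Hb0]. now apply Hd.
      + exists 1; split; [lra|]. intros x y _ _ Hy _. split; [exact Hy|reflexivity].
    - exists (fun _ => True), (fun _ => 0), 0. split; [apply filterlim_const|split; [exact Hsp0|]].
      set (g := (f y0 - ts) / 3).
      assert (Hy0' : 0 < y0).
      { destruct (Req_dec y0 0) as [Z|Z]; [|lra]. exfalso. rewrite Z in *.
        replace (f 0) with 0 in * by (symmetry; apply Hf). lra. }
      destruct (profile_continuity y0 Hy0') as (_ & _ & Hc).
      destruct (continuity_pt_lt f y0 (f y0 - g) Hc ltac:(unfold g; lra)) as [d [Hd Hd']].
      exists (Rmin d g). split; [apply Rmin_glb_lt; unfold g; lra|].
      intros x y Hx Hy _ Hfx. exfalso. rmin_facts. specialize (Hd' y ltac:(lra)). unfold g in *. lra. }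
  destruct HF as (W & s & s0 & Hs & Hsps & d & Hd & HW).
  destruct (Hev s s0 W Hs Hsps) as [r1 [Hr1 N1]].
  destruct (Hev (fun _ => 0) 0 (fun _ => True) (filterlim_const 0) Hsp0) as [r2 [Hr2 N2]].
  destruct (Hev (fun _ => - kap) (- kap) (fun _ => True) (filterlim_const (- kap)) Hspk) as [r3 [Hr3 N3]].
  exists (Rmin (Rmin d r1) (Rmin r2 r3)). split; [repeat apply Rmin_glb_lt; assumption|].
  rmin_facts. intros y Hy Hyp x (D1 & D2 & D3) Hx.
  assert (Hxa : Rabs (x - ts) < Rmin (Rmin d r1) (Rmin r2 r3)) by (rewrite Rabs_pos_eq; lra).
  assert (Hxy : closure (ahead th f) (x, y)) by (apply closure_ahead; lra).
  split; [apply N2; try lra; trivial|split; [apply N3; try lra; trivial|]].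
  intros H7. destruct (HW x y) as [W1 W2]; try lra. rewrite <- W2. apply N1; try lra; assumption.
Qed.

(** The point [(x1, y1)] is joined to the entrance by two envelopes, of the shifted
    shock-front with a vertical line below it and with a ray above it.  At the points
    where the state is [U0], the flux vanishes and nothing is required of the curve. *)
Lemma stream_vanishes (kap Y r X : R) :
  0 < kap -> 0 < r ->
  (forall x y, in_dependence kap Y x y -> x < X -> Um (x, y) <> U0 -> all_spacelike kap r x y) ->
  forall x y, in_dependence kap Y x y -> x < X -> relative_stream x y = 0.
Proof.
  intros Hkap Hr Hspace x1 y1 (Hy1 & Hx1 & Hk1) HX.
  assert (Hdl : exists dl, 0 < dl /\ dl < r /\ dl < f y1 - x1).
  { exists (Rmin r (f y1 - x1) / 2). assert (0 < Rmin r (f y1 - x1)) by (apply Rmin_glb_lt; lra). rmin_facts. lra. }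
  destruct Hdl as [dl Hdl].
  assert (Hdf : forall y, 0 < y -> is_derive (fun t => f t - dl) y (Derive f y)).
  { intros y Hy. destruct (profile_continuity y Hy) as (_ & D & _).
    replace (Derive f y) with (Derive f y - 0) by ring.
    apply (is_derive_minus f (fun _ => dl)); [exact D|apply (is_derive_const dl y)]. }
  apply Rle_antisym.
  - (* At the height [a], the shifted shock-front is to the left of the entrance. *)
    destruct (profile_limit_zero dl (proj1 Hdl)) as [d [Hd Hd']].
    assert (Ha : exists a, 0 < a /\ a < d /\ a < y1).
    { exists (Rmin d y1 / 2). assert (0 < Rmin d y1) by (apply Rmin_glb_lt; lra). rmin_facts. lra. }
    destruct Ha as [a Ha].
    assert (Hmono := stream_decreases_along_envelope relative_stream
      (fun x y => relative_flux_x gamma p0 u0 rho0 (ahead_extension x y))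
      (fun x y => relative_flux_y gamma p0 u0 rho0 (ahead_extension x y))
      (fun y => f y - dl) (fun _ => x1) (Derive f) (fun _ => 0) a y1 ltac:(lra)).
    cbv beta in Hmono. rewrite (Rmin_right (f y1 - dl) x1) in Hmono by lra.
    specialize (Hd' a ltac:(lra)). apply Rabs_def2 in Hd'.
    rewrite (Rmin_left (f a - dl) x1), (relative_stream_left (f a - dl) a) in Hmono by lra.
    assert (Hkk : forall y, y <= y1 -> x1 < kap * (Y - y)).
    { intros y Hy. assert (kap * y <= kap * y1) by (apply Rmult_le_compat_l; lra). lra. }
    apply Hmono.
    + intros y Hy. split; [apply Hdf; lra|apply (is_derive_const x1 y)].
    + intros y Hy. apply relative_stream_differentiable; [lra|]. rmin_facts. lra.
    + intros y Hy Hc. apply ahead_flux_sign; try lra. intros Hx0 Hne. specialize (Hkk y ltac:(lra)).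
      apply (Hspace (f y - dl) y); try assumption; unfold in_dependence; lra.
    + intros y Hy Hc. apply ahead_flux_sign; try lra. intros Hx0 Hne. specialize (Hkk y ltac:(lra)).
      apply (Hspace x1 y); try assumption; unfold in_dependence; lra.
  - assert (Hq : 0 < x1 / kap) by (apply Rdiv_lt_0_compat; lra).
    set (y2 := y1 + x1 / kap).
    assert (Ey2 : x1 - kap * (y2 - y1) = 0) by (unfold y2; field; lra).
    assert (Hy2 : y1 < y2) by (unfold y2; lra). clearbody y2.
    assert (Hmono := stream_decreases_along_envelope relative_stream
      (fun x y => relative_flux_x gamma p0 u0 rho0 (ahead_extension x y))
      (fun x y => relative_flux_y gamma p0 u0 rho0 (ahead_extension x y))
      (fun y => f y - dl) (fun y => x1 - kap * (y - y1)) (Derive f) (fun _ => - kap) y1 y2 ltac:(lra)).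
    cbv beta in Hmono. rewrite Ey2, (relative_stream_left (Rmin (f y2 - dl) 0) y2) in Hmono;
      [|lra|apply Rmin_r].
    rewrite (Rmin_right (f y1 - dl) (x1 - kap * (y1 - y1))) in Hmono by lra.
    replace (x1 - kap * (y1 - y1)) with x1 in Hmono by ring.
    assert (Hkk : forall y, y1 <= y -> 0 <= kap * (y - y1)) by (intros y Hy; apply Rmult_le_pos; lra).
    apply Hmono.
    + intros y Hy. split; [apply Hdf; lra|]. auto_derive; [exact I|ring].
    + intros y Hy. apply relative_stream_differentiable; [lra|]. rmin_facts. lra.
    + intros y Hy Hc. specialize (Hkk y ltac:(lra)). apply ahead_flux_sign; try lra. intros Hx0 Hne.
      apply (Hspace (f y - dl) y); try assumption; unfold in_dependence; lra.
    + intros y Hy Hc. specialize (Hkk y ltac:(lra)). apply ahead_flux_sign; try lra. intros Hx0 Hne.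
      apply (Hspace (x1 - kap * (y - y1)) y); try assumption; unfold in_dependence; lra.
Qed.

(** Continuation in the abscissa: if the state is [U0] to the left of [ts], it is
    also on [x = ts] by continuity, hence up to [ts + r] by [spacelike_beyond] and
    [stream_vanishes]: where the stream function vanishes, so does the flux through
    vertical lines, and [relative_flux_definite] applies. *)
Lemma ahead_is_upstream :
  p0 < pres (Up origin) -> forall q, closure (ahead th f) q -> Um q = U0.
Proof.
  intros HO.
  enough (Hmain : forall q, ahead th f q -> Um q = U0).
  { intros q Hq. apply (ahead_limit (ahead th f) q); auto. }
  assert (HN : 0 < M ^ 2 - 1) by nra.
  assert (Hkap : exists kap, 0 < kap /\ kap ^ 2 = (M ^ 2 - 1) / 2).
  { exists (sqrt ((M ^ 2 - 1) / 2)). split; [apply sqrt_lt_R0; lra|apply pow2_sqrt; lra]. }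
  destruct Hkap as [kap [Hkap Hkap2]].
  assert (HMs := mach0_sqr gamma p0 u0 rho0 Hg Hp0 Hu0 Hr0).
  assert (Hsl : forall s, s ^ 2 < M ^ 2 - 1 -> spacelike gamma p0 s U0).
  { intros s Hs. apply spacelike_upstream; try assumption.
    apply (Rmult_lt_reg_l rho0); [exact Hr0|]. rewrite <- HMs.
    replace (rho0 * ((1 + s ^ 2) * (gamma * p0 / rho0))) with ((1 + s ^ 2) * (gamma * p0)) by (field; lra).
    apply Rmult_lt_compat_r; [nra|lra]. }
  assert (Hsp0 : spacelike gamma p0 0 U0) by (apply Hsl; lra).
  assert (Hspk : spacelike gamma p0 (- kap) U0) by (apply Hsl; nra).
  enough (HY : forall Y, 0 < Y -> forall x y, in_dependence kap Y x y -> Um (x, y) = U0).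
  { intros [x y] Hq. apply ahead_iff in Hq.
    assert (0 < x / kap) by (apply Rdiv_lt_0_compat; lra).
    apply (HY (y + x / kap + 1)); [lra|]. split; [lra|split; [lra|]].
    replace (kap * (y + x / kap + 1 - y)) with (x + kap) by (field; lra). lra. }
  intros Y HYpos. apply NNPP. intros Hbad0.
  assert (Hbad : exists x y, in_dependence kap Y x y /\ Um (x, y) <> U0).
  { apply NNPP. intros Hn. apply Hbad0. intros x y Hxy. apply NNPP. intros Hne.
    apply Hn. now exists x, y. }
  clear Hbad0.
  (* [ts] is the infimum of the abscissas at which the state is not [U0] *)
  set (L := fun t => forall x y, in_dependence kap Y x y -> Um (x, y) <> U0 -> t <= x).
  destruct (completeness L) as [ts [Hts1 Hts2]].
  { destruct Hbad as (x & y & H1 & H2). exists x. intros t Ht. exact (Ht x y H1 H2). }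
  { exists 0. intros x y (_ & H & _) _. lra. }
  assert (Hts0 : 0 <= ts) by (apply Hts1; intros x y (_ & H & _) _; lra).
  assert (Hbelow : forall x y, in_dependence kap Y x y -> Um (x, y) <> U0 -> ts <= x).
  { intros x y Hxy Hne. apply Hts2. intros t Ht. exact (Ht x y Hxy Hne). }
  assert (Hat : forall y0, 0 <= y0 -> ts <= f y0 -> ts <= kap * (Y - y0) -> Um (ts, y0) = U0).
  { intros y0 Hy0 H1 H2. destruct (Req_dec ts 0) as [E|E].
    - rewrite E. apply (tss_entrance Hsol). split; simpl; lra.
    - assert (Hy0' : 0 < y0).
      { destruct (Req_dec y0 0) as [Z|Z]; [|lra]. rewrite Z in H1.
        replace (f 0) with 0 in H1 by (symmetry; apply Hf). lra. }
      apply (ahead_limit (fun z => snd z = y0 /\ 0 < fst z < ts)).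
      + apply closure_intro. intros eps Heps.
        destruct (interval_approx 0 ts ts eps) as [x' [K1 K2]]; try lra.
        exists x', y0. rewrite Rminus_diag, Rabs_R0. simpl. repeat split; lra.
      + intros [a b] [K1 K2]; simpl in *. subst b. apply ahead_iff; lra.
      + apply closure_ahead; lra.
      + intros [a b] [K1 K2]; simpl in *. subst b. apply NNPP. intros Hne.
        assert (ts <= a); [|lra]. apply (Hbelow a y0); [|exact Hne]. unfold in_dependence. lra. }
  destruct (spacelike_beyond kap Y ts) as [r [Hr Hspace]]; try assumption.
  assert (Hpsi := stream_vanishes kap Y r (ts + r) Hkap Hr).
  assert (Hpsi' := Hpsi (fun x y HD HX Hne => Hspace x y HD (conj (Hbelow x y HD Hne) HX))). clear Hpsi.
  assert (Hfin : ts + r <= ts); [|lra].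
  apply Hts1. intros x y HD Hne. apply Rnot_lt_le. intros Hxr. apply Hne.
  destruct (Hspace x y HD (conj (Hbelow x y HD Hne) Hxr)) as (S0 & _ & _).
  destruct HD as (Hy & Hx & Hk).
  assert (Hxy : ahead th f (x, y)) by (apply ahead_iff; lra).
  destruct (tss_pos_ahead Hsol _ (subset_closure _ _ Hxy)) as [Pp Pr].
  destruct (relative_flux_definite gamma p0 u0 rho0 0 (Um (x, y))) as [_ HE]; try assumption.
  { apply (tss_euler_ahead Hsol x y Hxy). }
  apply HE. rewrite Rmult_0_l, Rminus_0_r.
  destruct (differentiable_pt_lim_unique _ _ _ _ _ (relative_stream_differentiable x y Hy ltac:(lra))) as [_ D].
  unfold ahead_extension in D. rewrite Rmax_right in D by lra. rewrite <- D. apply is_derive_unique.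
  destruct (profile_continuity y Hy) as (_ & _ & Hc).
  destruct (continuity_pt_lt f y x Hc ltac:(lra)) as [d [Hd Hd']].
  assert (Hq : 0 < (kap * (Y - y) - x) / kap) by (apply Rdiv_lt_0_compat; lra).
  apply (is_derive_ext_near (fun _ => 0) _ y 0 (Rmin (Rmin d y) ((kap * (Y - y) - x) / kap)));
    [repeat apply Rmin_glb_lt; lra| |apply (is_derive_const 0 y)].
  intros t Ht. rmin_facts. specialize (Hd' t ltac:(lra)). apply Rabs_def2 in Ht.
  symmetry. apply Hpsi'; [|exact Hxr]. split; [lra|split; [lra|]].
  assert (Hkt : kap * (t - y) < kap * ((kap * (Y - y) - x) / kap)) by (apply Rmult_lt_compat_l; lra).
  replace (kap * ((kap * (Y - y) - x) / kap)) with (kap * (Y - y) - x) in Hkt by (field; lra). lra.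
Qed.

(** * The flow behind the shock-front *)

Hypothesis Hu : forall q, closure (behind th f) q -> 0 < velx (Up q).

Lemma behind_jacobian (px py ux uy vx vy rx ry : R * R -> R) :
  has_gradient (behind th f) (fun q => pres (Up q)) px py ->
  has_gradient (behind th f) (fun q => velx (Up q)) ux uy ->
  has_gradient (behind th f) (fun q => vely (Up q)) vx vy ->
  has_gradient (behind th f) (fun q => dens (Up q)) rx ry ->
  forall q, behind th f q ->
  let wx := quotient_deriv (vely (Up q)) (velx (Up q)) (vx q) (ux q) in
  let wy := quotient_deriv (vely (Up q)) (velx (Up q)) (vy q) (uy q) in
  wx * py q - wy * px q <= 0 /\
  (wx * py q - wy * px q = 0 -> px q = 0 /\ py q = 0 /\ wx = 0 /\ wy = 0).
Proof.
  intros Gp Gu Gv Gr q Hq.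
  assert (Hcl := subset_closure _ _ Hq).
  destruct (tss_pos_behind Hsol q Hcl) as [Pp Pr].
  apply (subsonic_jacobian gamma (pres (Up q)) (velx (Up q)) (vely (Up q)) (dens (Up q))
     (px q) (py q) (ux q) (uy q) (vx q) (vy q) (rx q) (ry q)); try assumption.
  - now apply Hu.
  - apply subsonic_speed; try assumption. apply (tss_subsonic Hsol q Hcl).
  - apply (gas_equations_of_euler gamma (b0 gamma p0 u0 rho0) (behind th f) Up px py ux uy vx vy rx ry);
      try assumption.
    + exact behind_open.
    + intros z Hz. apply (tss_pos_behind Hsol), subset_closure, Hz.
    + apply (tss_euler_behind Hsol).
Qed.

(** On the shock-front, [phi p_y dy] is a differential form on the polar; the
    change of variables [s = f'(y)] turns its integral into one over the polar,
    which depends on the two extreme states only. *)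
Lemma slope_bound (e c a b : R) :
  (forall y, 0 < y -> pres (Up (f y, y)) = shock_pressure gamma p0 M (Derive f y) /\
                      slope (Up (f y, y)) = shock_deflection gamma M (Derive f y)) ->
  e ^ 2 = 1 -> 0 < a < b ->
  (forall s, 0 <= s <= 1 -> e * (slope (Up (strip_x s a, a)) - c) <= 0 /\
                            e * (slope (Up (strip_x s b, b)) - c) <= 0) ->
  e * (tan th - c) <= 0 ->
  e * RInt (fun s => Rmax 0 (e * (shock_deflection gamma M s - c)) ^ 2 * shock_pressure_deriv gamma p0 M s)
       (Derive f a) (Derive f b) <= 0 ->
  forall s y, 0 < s < 1 -> a < y < b -> e * (slope (Up (strip_x s y, y)) - c) <= 0.
Proof.
  intros Hshock He Hab Hends Htan Hbd.
  destruct (tss_regular_behind Hsol) as ((Cp & px & py & Gp & Cpx & Cpy) &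
    (Cu & ux & uy & Gu & Cux & Cuy) & (Cv & vx & vy & Gv & Cvx & Cvy) & (Cr & rx & ry & Gr & Crx & Cry)).
  set (D0 := fun q => closure (behind th f) q /\ q <> origin) in *.
  assert (Hun : forall q, closure (behind th f) q -> velx (Up q) <> 0)
    by (intros q Hq; apply Rgt_not_eq, Hu, Hq).
  set (wx := fun q => quotient_deriv (vely (Up q)) (velx (Up q)) (vx q) (ux q)).
  set (wy := fun q => quotient_deriv (vely (Up q)) (velx (Up q)) (vy q) (uy q)).
  assert (Gw : has_gradient (behind th f) (fun q => slope (Up q)) wx wy).
  { apply slope_gradient; try assumption. intros q Hq. apply Hun, subset_closure, Hq. }
  assert (Cw : continuous_on (closure (behind th f)) (fun q => slope (Up q)))
    by now apply continuous_on_slope.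
  assert (Cu' : continuous_on D0 (fun q => velx (Up q)))
    by (apply (continuous_on_subset (closure (behind th f))); [intros q Hq; apply Hq|exact Cu]).
  assert (Cv' : continuous_on D0 (fun q => vely (Up q)))
    by (apply (continuous_on_subset (closure (behind th f))); [intros q Hq; apply Hq|exact Cv]).
  assert (Hun' : forall q, D0 q -> velx (Up q) <> 0) by (intros q Hq; apply Hun, Hq).
  assert (Cwx : continuous_on D0 wx) by now apply continuous_on_quotient_deriv.
  assert (Cwy : continuous_on D0 wy) by now apply continuous_on_quotient_deriv.
  assert (SC : forall g, continuous_on D0 g -> forall s y, 0 < y ->
     continuity_2d_pt (fun s y => g (strip_x (clip s) y, y)) s y).
  { intros g Hgc s y Hy. apply (strip_continuity D0); try assumption. intros q H1 H2. now split. }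
  assert (SC' : forall g, continuous_on (closure (behind th f)) g -> forall s y, 0 < y ->
     continuity_2d_pt (fun s y => g (strip_x (clip s) y, y)) s y).
  { intros g Hgc s y Hy. apply (strip_continuity (closure (behind th f))); try assumption. auto. }
  assert (CX : forall s y, 0 < y -> continuity_2d_pt (fun s y => y * cot th - f y) s y).
  { intros s y Hy. destruct (profile_continuity y Hy) as (_ & _ & Hc).
    apply continuity_2d_pt_minus; [cont2d|].
    apply (continuity_1d_2d_pt_comp f (fun _ y => y)); [exact Hc|apply continuity_2d_pt_id2]. }
  assert (CY : forall s y, 0 < y -> continuity_2d_pt (fun s y => (1 - clip s) * Derive f y + clip s * cot th) s y).
  { intros s y Hy. destruct (profile_second_derivative y Hy) as [Df _].
    assert (C1 : continuity_2d_pt (fun s _ => clip s) s y).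
    { apply (continuity_1d_2d_pt_comp clip (fun s _ => s)); [apply continuity_clip|apply continuity_2d_pt_id1]. }
    assert (C2 : continuity_2d_pt (fun _ y => Derive f y) s y).
    { apply (continuity_1d_2d_pt_comp (Derive f) (fun _ y => y)); [|apply continuity_2d_pt_id2].
      eapply is_derive_continuity_pt, Df. }
    cont2d. }
  set (P := fun s y => strip_x (clip s) y).
  set (Ds := fun (gx : R * R -> R) s y => gx (P s y, y) * (y * cot th - f y)).
  set (Dy := fun (gx gy : R * R -> R) s y =>
     gx (P s y, y) * ((1 - clip s) * Derive f y + clip s * cot th) + gy (P s y, y)).
  assert (CDs : forall gx s y, continuous_on D0 gx -> 0 < y -> continuity_2d_pt (Ds gx) s y).
  { intros gx s y Hgx Hy. apply continuity_2d_pt_mult; [now apply SC|now apply CX]. }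
  assert (CDy : forall gx gy s y, continuous_on D0 gx -> continuous_on D0 gy -> 0 < y ->
     continuity_2d_pt (Dy gx gy) s y).
  { intros gx gy s y Hgx Hgy Hy. apply continuity_2d_pt_plus; [|now apply SC].
    apply continuity_2d_pt_mult; [now apply SC|now apply CY]. }
  (* Both sides are the derivative at [y] of the pressure along the shock-front, computed
     from inside the region and through the polar. *)
  assert (Htrace : forall y, 0 < y ->
    Dy px py 0 y = shock_pressure_deriv gamma p0 M (Derive f y) * Derive_n f 2 y).
  { intros y Hy.
    assert (H1 : is_derive (fun t => pres (Up (f t, t))) y (Dy px py 0 y)).
    { set (d0 := Rmin y 1). assert (Hd0 : 0 < d0) by (apply Rmin_glb_lt; lra).
      assert (Hdy : d0 <= y) by apply Rmin_l. assert (Hd1 : d0 <= 1) by apply Rmin_r.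
      apply (is_derive_trace (fun e t => pres (Up (P e t, t))) (Dy px py) _ y _ d0 Hd0).
      - intros s t Hs Ht. apply Rabs_def2 in Ht.
        apply (strip_derivatives (fun q => pres (Up q)) px py s t); try assumption; lra.
      - intros t Ht eps Heps. apply Rabs_def2 in Ht.
        destruct (SC' (fun q => pres (Up q)) Cp 0 t ltac:(lra) (mkposreal eps Heps)) as [d Hd]. simpl in Hd.
        exists d; split; [apply cond_pos|]. intros s Hs.
        specialize (Hd s t). rewrite (clip_id 0) in Hd by lra. rewrite (proj1 (strip_ends t)) in Hd. apply Hd.
        + rewrite Rminus_0_r, Rabs_pos_eq; lra.
        + rewrite Rminus_diag, Rabs_R0. apply cond_pos.
      - intros eps Heps. destruct (CDy px py 0 y Cpx Cpy Hy (mkposreal eps Heps)) as [d Hd]. simpl in Hd.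
        exists d; split; [apply cond_pos|]. intros s t Hs Ht. apply Rlt_le, Hd; [|exact Ht].
        rewrite Rminus_0_r, Rabs_pos_eq; lra. }
    assert (H2 : is_derive (fun t => pres (Up (f t, t))) y
       (shock_pressure_deriv gamma p0 M (Derive f y) * Derive_n f 2 y)).
    { apply (is_derive_ext_near (fun t => shock_pressure gamma p0 M (Derive f t)) _ y _ y Hy).
      - intros t Ht. apply Rabs_def2 in Ht. symmetry. apply Hshock. lra.
      - rewrite Rmult_comm. destruct (profile_second_derivative y Hy) as [Df _].
        apply (is_derive_comp (shock_pressure gamma p0 M) (Derive f) y); [now apply is_derive_shock_pressure|exact Df]. }
    rewrite <- (is_derive_unique _ _ _ H1). exact (is_derive_unique _ _ _ H2). }
  assert (Hmain : forall s y, 0 < s < 1 -> a < y < b -> e * (slope (Up (P s y, y)) - c) <= 0).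
  2:{ intros s y Hs Hy. specialize (Hmain s y Hs Hy). unfold P in Hmain. rewrite clip_id in Hmain by lra. exact Hmain. }
  apply (strip_maximum_principle e c a b (fun s y => pres (Up (P s y, y))) (Ds px) (Dy px py)
    (fun s y => slope (Up (P s y, y))) (Ds wx) (Dy wx wy) He (proj2 Hab)).
  - intros s y Hs Hy.
    destruct (strip_derivatives (fun q => pres (Up q)) px py s y Gp Cpx Cpy Hs ltac:(lra)) as [A1 A2].
    destruct (strip_derivatives (fun q => slope (Up q)) wx wy s y Gw Cwx Cwy Hs ltac:(lra)) as [A3 A4].
    split; [exact A1|split; [exact A2|split; [exact A3|split; [exact A4|]]]].
    split; [apply CDs; [exact Cpx|lra]|split; [apply CDs; [exact Cwx|lra]|apply CDy; [exact Cwx|exact Cwy|lra]]].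
  - intros s y Hy. split; [apply (SC' (fun q => slope (Up q)) Cw); lra|apply CDy; [exact Cpx|exact Cpy|lra]].
  - intros s y Hs Hy. unfold P, Ds, Dy, P. rewrite clip_id by lra.
    assert (Hb := strip_behind s y ltac:(lra) Hs).
    destruct (behind_jacobian px py ux uy vx vy rx ry Gp Gu Gv Gr _ Hb)
      as [J1 J2].
    set (q := (strip_x s y, y)) in *. fold (wx q) in J1, J2. fold (wy q) in J1, J2.
    destruct (profile_continuity y ltac:(lra)) as [Hfy _].
    set (Z := y * cot th - f y) in *. assert (HZ : 0 < Z) by (unfold Z; lra).
    set (T := (1 - s) * Derive f y + s * cot th).
    replace (wx q * Z * (px q * T + py q) - (wx q * T + wy q) * (px q * Z)) with
      (Z * (wx q * py q - wy q * px q)) by ring.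
    split; [nra|]. intros H0. destruct J2 as (_ & _ & J3 & _).
    + apply (Rmult_eq_reg_l Z); lra.
    + rewrite J3; ring.
  - intros s Hs. unfold P. rewrite clip_id by lra. apply Hends; lra.
  - intros y Hy. unfold P. rewrite clip_id by lra. rewrite (proj2 (strip_ends y)).
    destruct (tss_slip Hsol (y * cot th, y)) as [_ ->]; [|exact Htan].
    pose proof (cot_pos th Hth). pose proof (cot_tan th Hth). split; simpl.
    + apply Rmult_lt_0_compat; lra.
    + rewrite Rmult_assoc, H0. ring.
  - assert (EI : RInt (fun y => Rmax 0 (e * (slope (Up (P 0 y, y)) - c)) ^ 2 * Dy px py 0 y) a b =
      RInt (fun s => Rmax 0 (e * (shock_deflection gamma M s - c)) ^ 2 * shock_pressure_deriv gamma p0 M s)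
       (Derive f a) (Derive f b)).
    { rewrite <- (RInt_comp (fun s => Rmax 0 (e * (shock_deflection gamma M s - c)) ^ 2 * shock_pressure_deriv gamma p0 M s)
        (Derive f) (Derive_n f 2) a b).
      - apply RInt_ext. intros y Hy. rewrite Rmin_left, Rmax_right in Hy by lra.
        rewrite Htrace by lra. unfold P. rewrite clip_id by lra. rewrite (proj1 (strip_ends y)).
        destruct (Hshock y ltac:(lra)) as [_ ->]. unfold scal; simpl; unfold mult; simpl. ring.
      - intros y Hy. now apply continuous_polar_weight.
      - intros y Hy. rewrite Rmin_left, Rmax_right in Hy by lra.
        apply (profile_second_derivative y). lra. }
    rewrite EI. exact Hbd.
Qed.

Variables (pstar pstrong : R).
Hypotheses (Hpstar : is_pstar gamma p0 u0 rho0 pstar)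
  (Hpstrong : is_pstrong gamma p0 u0 rho0 th pstar pstrong)
  (Hinf : slope_tends_at_infinity (fun q => behind th f q \/ shock f q) Up (tan th))
  (HOw : slope (Up origin) = tan th)
  (HOp : pres (Up origin) = pstrong).

Lemma pstrong_above_p0 : p0 < pstrong.
Proof. destruct Hpstar as [H1 _]. destruct Hpstrong as [H2 _]. lra. Qed.

Lemma ahead_uniform (q : R * R) : closure (ahead th f) q -> Um q = U0.
Proof. apply ahead_is_upstream. rewrite HOp. exact pstrong_above_p0. Qed.

Lemma behind_shock_state (y : R) : 0 < y ->
  p0 < pres (Up (f y, y)) /\
  pres (Up (f y, y)) = shock_pressure gamma p0 M (Derive f y) /\
  Derive f y ^ 2 < M ^ 2 - 1 /\
  velx (Up (f y, y)) = u0 - (pres (Up (f y, y)) - p0) / (rho0 * u0) /\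
  vely (Up (f y, y)) = Derive f y * (pres (Up (f y, y)) - p0) / (rho0 * u0) /\
  slope (Up (f y, y)) = shock_deflection gamma M (Derive f y) /\
  dens (Up (f y, y)) = rho0 * (((gamma + 1) * pres (Up (f y, y)) + (gamma - 1) * p0) /
                               ((gamma - 1) * pres (Up (f y, y)) + (gamma + 1) * p0)).
Proof.
  intros Hy. destruct (shock_in_closures y (Rlt_le _ _ Hy)) as [C1 C2].
  destruct (tss_pos_behind Hsol _ C2) as [Pp Pr].
  apply (shock_from_upstream gamma p0 u0 rho0 (Derive f y)); try assumption.
  - now apply flow_bernoulli.
  - rewrite <- (ahead_uniform _ C1).
    exact (tss_shock Hsol y Hy).
Qed.

Lemma behind_slope_continuous : continuous_on (closure (behind th f)) (fun q => slope (Up q)).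
Proof.
  destruct (regular_flow_continuous _ _ (tss_regular_behind Hsol)) as (_ & C2 & C3 & _).
  apply continuous_on_slope; try assumption. intros q Hq. apply Rgt_not_eq, Hu, Hq.
Qed.

Lemma behind_closure_constant (g : R * R -> R) (c : R) :
  continuous_on (closure (behind th f)) g -> (forall q, behind th f q -> g q = c) ->
  forall q, closure (behind th f) q -> g q = c.
Proof.
  intros Cg Hgc q Hq. apply (closure_value (behind th f) (closure (behind th f)) g q c); try assumption.
  - apply subset_closure.
  - now apply Cg.
Qed.

(** At the vertex the shock-front has the inclination of the strong solution; this
    is where the prescribed pressure [pstrong] enters. *)
Lemma vertex_inclination : exists s1, 0 < s1 /\
  filterlim (Derive f) (at_height 0) (locally s1) /\
  shock_pressure gamma p0 M s1 = pstrong /\ shock_deflection gamma M s1 = tan th /\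
  (forall s, 0 <= s <= s1 -> shock_deflection gamma M s <= tan th).
Proof.
  pose proof pstrong_above_p0 as Hps.
  destruct (regular_flow_continuous _ _ (tss_regular_behind Hsol)) as (C1 & _ & C3 & _).
  pose proof (at_height_proper 0 (Rle_refl 0)) as PF.
  assert (FF : Filter (at_height 0)) by apply PF.
  assert (HO : closure (behind th f) origin) by apply origin_closure.
  assert (A := shock_approach (closure (behind th f)) 0 (Rle_refl 0)
    (fun y Hy => proj2 (shock_in_closures y (Rlt_le _ _ Hy)))).
  assert (Ef : (f 0, 0) = origin) by (unfold origin; f_equal; apply Hf). rewrite Ef in A.
  assert (L1 : filterlim (fun y => pres (Up (f y, y))) (at_height 0) (locally pstrong)).
  { rewrite <- HOp. exact (filterlim_comp _ _ _ _ _ _ _ _ A (C1 _ HO)). }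
  assert (L3 : filterlim (fun y => vely (Up (f y, y))) (at_height 0) (locally (vely (Up origin)))).
  { exact (filterlim_comp _ _ _ _ _ _ _ _ A (C3 _ HO)). }
  assert (Hmu : 0 < rho0 * u0) by (apply Rmult_lt_0_compat; lra).
  set (s1 := rho0 * u0 * vely (Up origin) / (pstrong - p0)).
  assert (Hk : 0 < tan th) by now apply tan_pos_of_angle.
  assert (HuO : 0 < velx (Up origin)) by (apply Hu, HO).
  assert (HvO : 0 < vely (Up origin)).
  { replace (vely (Up origin)) with (slope (Up origin) * velx (Up origin)) by (unfold slope; field; lra).
    rewrite HOw. now apply Rmult_lt_0_compat. }
  assert (Hs1 : 0 < s1) by (apply Rdiv_lt_0_compat; [now apply Rmult_lt_0_compat|lra]).
  assert (Ls : filterlim (Derive f) (at_height 0) (locally s1)).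
  { apply (filterlim_ext_loc (fun y => rho0 * u0 * vely (Up (f y, y)) / (pres (Up (f y, y)) - p0))).
    - apply at_height_pos. intros y Hy. destruct (behind_shock_state y Hy) as (S1 & _ & _ & _ & S5 & _).
      rewrite S5. field. lra.
    - apply flim_div; [flim|flim|lra]. }
  assert (EPi : shock_pressure gamma p0 M s1 = pstrong).
  { apply (filterlim_locally_unique (F := at_height 0) (fun y => pres (Up (f y, y)))); [|exact L1].
    apply (filterlim_ext_loc (fun y => shock_pressure gamma p0 M (Derive f y))).
    - apply at_height_pos. intros y Hy. destruct (behind_shock_state y Hy) as (_ & S2 & _). now symmetry.
    - apply (flim_continuous (shock_pressure gamma p0 M) (Derive f) s1 Ls).
      apply (ex_derive_continuous (shock_pressure gamma p0 M)). eexists. now apply is_derive_shock_pressure. }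
  destruct (strong_branch gamma p0 u0 rho0 th pstar pstrong s1 Hg Hp0 Hu0 Hr0 HM0 Hk Hpstar Hpstrong
    (Rlt_le _ _ Hs1) EPi) as [B1 B2].
  now exists s1.
Qed.

(** For a point with [e (w - c) > 0], the strip is cut at a height near the vertex
    and at a height far away, where [w] is close to [tan th]. *)
Lemma slope_comparison (e c x y : R) :
  (e = 1 /\ tan th < c) \/ (e = -1 /\ 0 < c < tan th) ->
  behind th f (x, y) -> e * (slope (Up (x, y)) - c) <= 0.
Proof.
  intros He Hxy. pose proof (cot_pos th Hth) as Hcot.
  assert (Hk : 0 < tan th) by now apply tan_pos_of_angle.
  apply behind_iff in Hxy. destruct Hxy as [Hy Hx].
  destruct vertex_inclination as (s1 & Hs1 & Ls & Ep & Es & Hle).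
  set (eps := Rabs (tan th - c)).
  assert (Heps : 0 < eps) by (apply Rabs_pos_lt; destruct He; lra).
  assert (Hclose : forall z, Rabs (z - tan th) < eps -> e * (z - c) <= 0).
  { intros z Hz. unfold eps in Hz. apply Rabs_def2 in Hz. destruct He as [[-> Hc]|[-> Hc]].
    - rewrite (Rabs_left (tan th - c)) in Hz by lra. lra.
    - rewrite (Rabs_pos_eq (tan th - c)) in Hz by lra. lra. }
  assert (Hramp : forall b, 0 < b -> slope (Up (strip_x 1 b, b)) = tan th).
  { intros b Hb. rewrite (proj2 (strip_ends b)). apply (tss_slip Hsol (b * cot th, b)). split; simpl.
    - now apply Rmult_lt_0_compat.
    - rewrite Rmult_assoc, (cot_tan th Hth). ring. }
  assert (Hnear : exists r1, 0 < r1 /\ forall q1 q2, Rabs q1 < r1 -> Rabs q2 < r1 ->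
     closure (behind th f) (q1, q2) -> Rabs (slope (Up (q1, q2)) - tan th) < eps).
  { assert (Hb : locally (slope (Up origin)) (fun z => Rabs (z - tan th) < eps)).
    { rewrite HOw. exists (mkposreal _ Heps). intros z Hz. exact Hz. }
    destruct (behind_slope_continuous origin (proj2 origin_closure) _ Hb) as [r1 Hr1].
    exists r1; split; [apply cond_pos|].
    intros q1 q2 H1 H2 Hq. apply (Hr1 (q1, q2)); [|exact Hq]. split.
    - change (Rabs (q1 - 0) < r1). now rewrite Rminus_0_r.
    - change (Rabs (q2 - 0) < r1). now rewrite Rminus_0_r. }
  destruct Hnear as [r1 [Hr1 Hnear]].
  assert (Hthr : exists r2, 0 < r2 /\ forall a, 0 < a < r2 -> e = 1 ->
     0 <= Derive f a /\ forall s, 0 <= s <= Derive f a -> shock_deflection gamma M s <= c).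
  { destruct He as [[-> Hc]|[-> _]]; [|exists 1; split; [lra|intros; lra]].
    destruct (ex_derive_shock_deflection gamma M s1 Hg) as [l Hl].
    destruct (continuity_pt_gt (shock_deflection gamma M) s1 c) as [d [Hd Hd']];
      [eapply is_derive_continuity_pt, Hl|lra|].
    assert (Hm : 0 < Rmin d s1) by (apply Rmin_glb_lt; lra).
    assert (Hb : locally s1 (fun z => Rabs (z - s1) < Rmin d s1)).
    { exists (mkposreal _ Hm). intros z Hz. exact Hz. }
    destruct (Ls _ Hb) as [r2 Hr2]. exists r2; split; [apply cond_pos|]. intros a Ha _.
    assert (Hfa : Rabs (Derive f a - s1) < Rmin d s1).
    { apply Hr2; [|lra]. change (Rabs (a - 0) < r2). rewrite Rminus_0_r, Rabs_pos_eq; lra. }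
    rmin_facts. apply Rabs_def2 in Hfa.
    split; [lra|]. intros s Hs. destruct (Rle_or_lt s s1).
    - apply Rle_trans with (tan th); [|lra]. apply Hle; lra.
    - apply Rlt_le, Hd'. apply Rabs_def1; lra. }
  destruct Hthr as [r2 [Hr2 Hthr]].
  destruct (Hinf eps Heps) as [r Hr].
  assert (Hq : 0 < r1 / (1 + cot th)) by (apply Rdiv_lt_0_compat; lra).
  assert (Ha : exists a, 0 < a /\ a < y /\ a < r2 /\ a < r1 / (1 + cot th)).
  { exists (Rmin (Rmin y r2) (r1 / (1 + cot th)) / 2).
    assert (0 < Rmin (Rmin y r2) (r1 / (1 + cot th))) by (repeat apply Rmin_glb_lt; lra). rmin_facts. lra. }
  destruct Ha as (a & Ha0 & Hay & Har2 & Har1).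
  assert (Har : a * (1 + cot th) < r1).
  { replace r1 with (r1 / (1 + cot th) * (1 + cot th)) by (field; lra). apply Rmult_lt_compat_r; lra. }
  assert (Hb : exists b, y < b /\ r < b).
  { exists (Rmax y r + 1). pose proof (Rmax_l y r). pose proof (Rmax_r y r). lra. }
  destruct Hb as (b & Hyb & Hrb).
  assert (Hwa : forall s, 0 <= s <= 1 -> Rabs (slope (Up (strip_x s a, a)) - tan th) < eps).
  { intros s Hs. assert (Hac : 0 < a * cot th) by now apply Rmult_lt_0_compat.
    destruct (profile_continuity a Ha0) as [Hfa _].
    apply Hnear.
    - unfold strip_x. rewrite Rabs_pos_eq by nra. nra.
    - rewrite Rabs_pos_eq; lra.
    - now apply strip_closure. }
  assert (Hwb : forall s, 0 <= s <= 1 -> Rabs (slope (Up (strip_x s b, b)) - tan th) < eps).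
  { intros s Hs. destruct (Req_dec s 1) as [->|Hs1'].
    - rewrite Hramp by lra. rewrite Rminus_diag, Rabs_R0. exact Heps.
    - apply Hr.
      + destruct (Req_dec s 0) as [->|Hs0].
        * right. split; simpl; [lra|apply strip_ends].
        * left. apply strip_behind; lra.
      + simpl. apply Rlt_le_trans with b; [exact Hrb|].
        rewrite <- (sqrt_pow2 b) at 1 by lra. apply sqrt_le_1_alt. simpl.
        pose proof (Rle_0_sqr (strip_x s b)) as Hsq. unfold Rsqr in Hsq. lra. }
  destruct (strip_position x y Hy Hx) as (s & Hs & Ex). rewrite <- Ex.
  apply (slope_bound e c a b); try lra.
  - intros z Hz. destruct (behind_shock_state z Hz) as (_ & S2 & _ & _ & _ & S6 & _). now split.
  - destruct He as [[-> _]|[-> _]]; ring.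
  - intros t Ht. split; apply Hclose; [now apply Hwa|now apply Hwb].
  - apply Hclose. rewrite Rminus_diag, Rabs_R0. exact Heps.
  - destruct (behind_shock_state a Ha0) as (_ & _ & Sa & _ & _ & Wa & _).
    destruct (behind_shock_state b ltac:(lra)) as (_ & _ & Sb & _ & _ & Wb & _).
    destruct He as [[-> Hc]|[-> Hc]].
    + destruct (Hthr a (conj Ha0 Har2) eq_refl) as [T1 T2].
      apply polar_weight_above; try assumption. lra.
    + assert (Ka := Hclose _ (Hwa 0 ltac:(lra))). assert (Kb := Hclose _ (Hwb 0 ltac:(lra))).
      rewrite (proj1 (strip_ends a)), Wa in Ka. rewrite (proj1 (strip_ends b)), Wb in Kb.
      apply polar_weight_below; try assumption; try lra.
      * apply Rnot_lt_le. intros Hn. pose proof (shock_deflection_sign gamma M (Derive f a) Hg Sa ltac:(lra)). lra.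
      * apply Rnot_lt_le. intros Hn. pose proof (shock_deflection_sign gamma M (Derive f b) Hg Sb ltac:(lra)). lra.
Qed.

Lemma slope_constant (q : R * R) : behind th f q -> slope (Up q) = tan th.
Proof.
  destruct q as [x y]. intros Hq. assert (Hk : 0 < tan th) by now apply tan_pos_of_angle.
  apply Rle_antisym; apply Rnot_lt_le; intros Hlt.
  - pose proof (slope_comparison 1 ((tan th + slope (Up (x, y))) / 2) x y ltac:(left; lra) Hq). lra.
  - set (c := Rmax (tan th / 2) ((tan th + slope (Up (x, y))) / 2)).
    assert (H1 : tan th / 2 <= c) by apply Rmax_l.
    assert (H2 : (tan th + slope (Up (x, y))) / 2 <= c) by apply Rmax_r.
    assert (H3 : c < tan th) by (apply Rmax_lub_lt; lra).
    pose proof (slope_comparison (-1) c x y ltac:(right; lra) Hq). lra.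
Qed.

(** The Jacobian vanishes with the gradient of [w], hence so does the gradient of
    [p]; the value is found by going down to the vertex inside the strip. *)
Lemma pressure_constant (q : R * R) : closure (behind th f) q -> pres (Up q) = pstrong.
Proof.
  pose proof (cot_pos th Hth) as Hcot.
  destruct (tss_regular_behind Hsol) as ((Cp & px & py & Gp & Cpx & Cpy) &
    (Cu & ux & uy & Gu & Cux & Cuy) & (Cv & vx & vy & Gv & Cvx & Cvy) & (Cr & rx & ry & Gr & Crx & Cry)).
  assert (Hgrad : forall q, behind th f q -> px q = 0 /\ py q = 0).
  { intros z Hz.
    destruct (behind_jacobian px py ux uy vx vy rx ry Gp Gu Gv Gr z Hz) as [_ J].
    destruct (gradient_of_constant (behind th f) _ _ _ (tan th) z (behind_open z Hz)
      (slope_gradient (behind th f) Up ux uy vx vy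
       (fun q Hq => Rgt_not_eq _ _ (Hu q (subset_closure _ _ Hq))) Gu Gv) slope_constant Hz) as [W1 W2].
    destruct J as (J1 & J2 & _); [|now split]. rewrite W1, W2. ring. }
  revert q. apply (behind_closure_constant (fun q => pres (Up q)) pstrong Cp).
  intros [x y] Hq. apply behind_iff in Hq. destruct Hq as [Hy Hx].
  destruct (strip_position x y Hy Hx) as (s & Hs & Ex).
  assert (Hcst : forall t, 0 < t -> pres (Up (strip_x s t, t)) = pres (Up (x, y))).
  { intros t Ht. rewrite <- Ex.
    apply (constant_of_zero_derivative (fun t => pres (Up (strip_x s t, t))) y t).
    intros z Hz. assert (Hz0 : 0 < z) by (unfold Rmin in Hz; destruct (Rle_dec y t); lra).
    destruct (strip_derivatives (fun q => pres (Up q)) px py s z Gp Cpx Cpy Hs Hz0) as [_ D].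
    rewrite clip_id in D by lra.
    destruct (Hgrad _ (strip_behind s z Hz0 Hs)) as [-> ->] in D.
    rewrite Rmult_0_l, Rplus_0_l in D. exact D. }
  rewrite <- HOp. symmetry.
  apply (closure_value (fun z => 0 < snd z /\ fst z = strip_x s (snd z)) (closure (behind th f))
    (fun z => pres (Up z)) origin).
  - intros [a b] [H1 H2]; simpl in *. rewrite H2. apply strip_closure; lra.
  - apply closure_intro. intros eps Heps.
    assert (Ht : exists t, 0 < t /\ t * (1 + cot th) = eps / 2).
    { exists (eps / (2 * (1 + cot th))). split; [apply Rdiv_lt_0_compat; lra|field; lra]. }
    destruct Ht as (t & Ht & Et).
    assert (Htc : 0 < t * cot th) by now apply Rmult_lt_0_compat.
    destruct (profile_continuity t Ht) as [Hft _].
    exists (strip_x s t), t. rewrite !Rminus_0_r.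
    split; [|split; [rewrite Rabs_pos_eq; lra|simpl; split; [lra|reflexivity]]].
    unfold strip_x. rewrite Rabs_pos_eq by nra. nra.
  - apply Cp, origin_closure.
  - intros [a b] [H1 H2]; simpl in *. rewrite H2. now apply Hcst.
Qed.

(** On the polar, the pressure determines [f'] up to sign, and the deflection is
    positive only for positive slopes. *)
Lemma shock_straight : exists s1, 0 < s1 /\ shock_pressure gamma p0 M s1 = pstrong /\
  forall y, 0 < y -> Derive f y = s1 /\ f y = y * s1.
Proof.
  destruct vertex_inclination as (s1 & Hs1 & _ & Ep & _ & _).
  assert (Hk : 0 < tan th) by now apply tan_pos_of_angle.
  exists s1. split; [exact Hs1|split; [exact Ep|]].
  assert (Hf' : forall y, 0 < y -> Derive f y = s1).
  { intros y Hy. destruct (behind_shock_state y Hy) as (_ & S2 & S3 & _ & _ & S6 & _).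
    assert (C2 := proj2 (shock_in_closures y (Rlt_le _ _ Hy))).
    rewrite (pressure_constant _ C2) in S2.
    rewrite (behind_closure_constant _ (tan th) behind_slope_continuous slope_constant _ C2) in S6.
    assert (Hpos : 0 < Derive f y).
    { apply Rnot_le_lt. intros Hn. pose proof (shock_deflection_sign gamma M (Derive f y) Hg S3 Hn). lra. }
    assert (HMne : M <> 0) by lra.
    destruct (Rtotal_order (Derive f y) s1) as [H|[H|H]]; [|exact H|].
    - pose proof (shock_pressure_decreasing gamma p0 M (Derive f y) s1 Hg Hp0 HMne ltac:(lra)). lra.
    - pose proof (shock_pressure_decreasing gamma p0 M s1 (Derive f y) Hg Hp0 HMne ltac:(lra)). lra. }
  intros y Hy. split; [now apply Hf'|].
  assert (Hc : forall t, 0 < t -> f t - t * s1 = f y - y * s1).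
  { intros t Ht. apply (constant_of_zero_derivative (fun t => f t - t * s1) y t).
    intros z Hz. assert (Hz0 : 0 < z) by (unfold Rmin in Hz; destruct (Rle_dec y t); lra).
    destruct (profile_continuity z Hz0) as (_ & D & _). rewrite (Hf' z Hz0) in D.
    replace 0 with (s1 - s1) by ring. apply (is_derive_minus f (fun t => t * s1)); [exact D|].
    auto_derive; [exact I|ring]. }
  apply Rminus_diag_uniq. apply NNPP. intros Hne.
  set (K := Rabs (f y - y * s1)). assert (HK : 0 < K) by (apply Rabs_pos_lt; exact Hne).
  destruct (profile_limit_zero (K / 2) ltac:(lra)) as [d [Hd Hd']].
  assert (Hq : 0 < K / (2 * s1)) by (apply Rdiv_lt_0_compat; lra).
  assert (Ht : exists t, 0 < t /\ t < d /\ t < K / (2 * s1)).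
  { exists (Rmin d (K / (2 * s1)) / 2).
    assert (0 < Rmin d (K / (2 * s1))) by (apply Rmin_glb_lt; lra). rmin_facts. lra. }
  destruct Ht as [t Ht]. specialize (Hd' t ltac:(lra)).
  assert (Hts : t * s1 < K / 2).
  { replace (K / 2) with (K / (2 * s1) * s1) by (field; lra). apply Rmult_lt_compat_r; lra. }
  assert (Hts0 : 0 < t * s1) by (apply Rmult_lt_0_compat; lra).
  assert (HKt : K = Rabs (f t - t * s1)) by (unfold K; rewrite (Hc t) by lra; reflexivity).
  assert (Rabs (f t - t * s1) < K); [|lra]. apply Rabs_def2 in Hd'. apply Rabs_def1; lra.
Qed.

(** Since [p_x = 0], the momentum equation makes [u] constant in the direction
    [(1, tan th)]; the straight streamline through a point meets the shock-front,
    where [u] is determined by the pressure. *)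
Lemma velocity_constant (q : R * R) :
  closure (behind th f) q -> velx (Up q) = u0 - (pstrong - p0) / (rho0 * u0).
Proof.
  destruct shock_straight as (s1 & Hs1 & _ & Hsh).
  assert (Hfl := fun y Hy => proj2 (Hsh y Hy)).
  assert (Hk : 0 < tan th) by now apply tan_pos_of_angle.
  destruct (tss_regular_behind Hsol) as ((Cp & px & py & Gp & Cpx & Cpy) &
    (Cu & ux & uy & Gu & Cux & Cuy) & (Cv & vx & vy & Gv & Cvx & Cvy) & (Cr & rx & ry & Gr & Crx & Cry)).
  assert (Hposc := tss_pos_behind Hsol).
  assert (Hs1c : s1 < cot th).
  { destruct (profile_continuity 1 Rlt_0_1) as [H _]. rewrite (Hfl 1) in H by lra. lra. }
  pose proof (cot_tan th Hth) as Hct.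
  assert (Hs1k : s1 * tan th < 1) by (rewrite <- Hct; apply Rmult_lt_compat_r; lra).
  set (us := u0 - (pstrong - p0) / (rho0 * u0)).
  revert q. apply (behind_closure_constant (fun q => velx (Up q)) us Cu).
  intros [x y] Hq. apply behind_iff in Hq. destruct Hq as [Hy Hx]. rewrite (Hfl y Hy) in Hx.
  (* The streamline through [(x, y)] leaves the shock-front at [(x - T, yS)]. *)
  set (T := (x - y * s1) / (1 - s1 * tan th)).
  assert (HT : 0 < T) by (apply Rdiv_lt_0_compat; lra).
  assert (ET : T * (1 - s1 * tan th) = x - y * s1) by (unfold T; field; lra).
  set (yS := y - T * tan th).
  assert (HyS : 0 < yS).
  { apply (Rmult_lt_reg_r (1 - s1 * tan th)); [lra|]. rewrite Rmult_0_l. unfold yS.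
    replace ((y - T * tan th) * (1 - s1 * tan th)) with (y * (1 - s1 * tan th) - T * (1 - s1 * tan th) * tan th) by ring.
    rewrite ET. pose proof (proj2 (wedge_iff th x y Hth) (proj2 Hx)). lra. }
  assert (ExS : x - T = f yS) by (rewrite Hfl by exact HyS; unfold yS; lra).
  assert (Hin : forall t, 0 < t -> behind th f (f yS + t * 1, yS + t * tan th)).
  { intros t Ht. assert (0 < t * tan th) by now apply Rmult_lt_0_compat.
    apply behind_iff. rewrite (Hfl yS HyS), Hfl by lra. split; [lra|split].
    - assert (0 < t * (1 - s1 * tan th)) by (apply Rmult_lt_0_compat; lra). lra.
    - rewrite Rmult_plus_distr_r, (Rmult_assoc t), (Rmult_comm (tan th)), Hct.
      assert (yS * s1 < yS * cot th) by (apply Rmult_lt_compat_l; lra). lra. }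
  assert (Hcst : forall t, 0 < t -> velx (Up (f yS + t * 1, yS + t * tan th)) = velx (Up (x, y))).
  { intros t Ht. replace (x, y) with (f yS + T * 1, yS + T * tan th) by (f_equal; [lra|unfold yS; ring]).
    apply (constant_of_zero_derivative (fun t => velx (Up (f yS + t * 1, yS + t * tan th))) T t).
    intros z Hz. assert (Hz0 : 0 < z) by (unfold Rmin in Hz; destruct (Rle_dec T t); lra).
    assert (Hb := Hin z Hz0).
    assert (D := is_derive_along_line (behind th f) _ (fun q => velx (Up q)) ux uy (f yS) yS 1 (tan th) z
      behind_not_origin (behind_open _ Hb) Gu Cux Cuy).
    destruct (gas_equations_of_euler gamma (b0 gamma p0 u0 rho0) (behind th f) Up px py ux uy vx vy rx ry
      Hg behind_open (fun q Hq => Hposc q (subset_closure _ _ Hq)) (tss_euler_behind Hsol)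
      Gp Gu Gv Gr _ Hb) as (_ & E2 & _).
    set (q := (f yS + z * 1, yS + z * tan th)) in *.
    destruct (gradient_of_constant (behind th f) _ px py pstrong q (behind_open q Hb) Gp
      (fun z Hz => pressure_constant z (subset_closure _ _ Hz)) Hb) as [Px _]. rewrite Px in E2.
    destruct (Hposc q (subset_closure _ _ Hb)) as [_ Pr]. pose proof (Hu q (subset_closure _ _ Hb)) as Pu.
    assert (Ev : vely (Up q) = velx (Up q) * tan th).
    { rewrite <- (slope_constant q Hb). unfold slope. field. lra. }
    rewrite Ev in E2.
    replace (ux q * 1 + uy q * tan th) with 0 in D; [exact D|].
    apply (Rmult_eq_reg_l (dens (Up q) * velx (Up q))); [|apply Rgt_not_eq, Rmult_lt_0_compat; lra]. lra. }
  assert (CS := proj2 (shock_in_closures yS (Rlt_le _ _ HyS))).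
  destruct (behind_shock_state yS HyS) as (_ & _ & _ & S4 & _). rewrite (pressure_constant _ CS) in S4. fold us in S4.
  rewrite <- S4. symmetry.
  apply (closure_value (fun z => exists t, 0 < t /\ z = (f yS + t * 1, yS + t * tan th)) (closure (behind th f))
    (fun z => velx (Up z)) (f yS, yS)).
  - intros z [t [Ht ->]]. now apply subset_closure, Hin.
  - apply closure_intro. intros eps Heps.
    assert (Ht : exists t, 0 < t /\ t * (1 + tan th) = eps / 2).
    { exists (eps / (2 * (1 + tan th))). split; [apply Rdiv_lt_0_compat; lra|field; lra]. }
    destruct Ht as (t & Ht & Et).
    assert (Htc : 0 < t * tan th) by now apply Rmult_lt_0_compat.
    exists (f yS + t * 1), (yS + t * tan th). split; [|split; [|now exists t]].
    + replace (f yS + t * 1 - f yS) with t by ring. rewrite Rabs_pos_eq; lra.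
    + replace (yS + t * tan th - yS) with (t * tan th) by ring. rewrite Rabs_pos_eq; lra.
  - apply Cu, CS.
  - intros z [t [Ht ->]]. now apply Hcst.
Qed.

Lemma strong_solution : is_strong_solution gamma p0 u0 rho0 th pstrong f Um Up.
Proof.
  destruct shock_straight as (s1 & Hs1 & Ep & Hsh). pose proof pstrong_above_p0 as Hps.
  assert (Hposc := tss_pos_behind Hsol).
  assert (HvS : forall q, closure (behind th f) q -> vely (Up q) = velx (Up q) * tan th).
  { intros q Hq. rewrite <- (behind_closure_constant _ (tan th) behind_slope_continuous slope_constant q Hq).
    unfold slope. field. apply Rgt_not_eq, Hu, Hq. }
  assert (HrS : forall q, closure (behind th f) q -> dens (Up q) =
    rho0 * (((gamma + 1) * pstrong + (gamma - 1) * p0) / ((gamma - 1) * pstrong + (gamma + 1) * p0))).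
  { (* The Bernoulli law has the same other terms at [q] as on the shock-front. *)
    intros q Hq. assert (C1 := proj2 (shock_in_closures 1 Rle_0_1)).
    destruct (behind_shock_state 1 Rlt_0_1) as (_ & _ & _ & _ & _ & _ & S7).
    rewrite (pressure_constant _ C1) in S7. rewrite <- S7.
    assert (B1 := proj2 flow_bernoulli _ C1). assert (B2 := proj2 flow_bernoulli _ Hq).
    destruct (Hposc _ C1) as [P1 R1]. destruct (Hposc _ Hq) as [P2 R2].
    unfold bernoulli in B1, B2. rewrite sonic_sqr in B1, B2 by lra.
    rewrite (HvS _ C1), (velocity_constant _ C1), (pressure_constant _ C1) in B1.
    rewrite (HvS _ Hq), (velocity_constant _ Hq), (pressure_constant _ Hq) in B2.
    set (r1 := dens (Up (f 1, 1))) in *. set (r2 := dens (Up q)) in *.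
    assert (Hgp : 0 < gamma * pstrong) by (apply Rmult_lt_0_compat; lra).
    assert (E : gamma * pstrong / r2 = gamma * pstrong / r1).
    { apply (Rmult_eq_reg_r (/ (gamma - 1))); [|apply Rinv_neq_0_compat; lra]. unfold Rdiv in *. lra. }
    apply (Rmult_eq_reg_l (gamma * pstrong / r2)); [|apply Rgt_not_eq, Rdiv_lt_0_compat; lra].
    rewrite E at 2. field. lra. }
  split; [|split; [exact ahead_uniform|]].
  - destruct (shock_angle_of_slope gamma p0 u0 rho0 s1 Hg Hp0 HM0 Hs1) as [A1 A2].
    exists (PI / 2 - atan s1). rewrite Ep in A1. split; [exact A1|]. intros y Hy. rewrite A2.
    destruct (Req_dec y 0) as [->|Hy0].
    + rewrite Rmult_0_l. apply Hf.
    + apply Hsh. lra.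
  - intros q Hq. assert (E1 := pressure_constant q Hq). assert (E2 := velocity_constant q Hq).
    assert (E3 := HvS q Hq). assert (E4 := HrS q Hq). rewrite E2 in E3.
    unfold strong_state. cbv zeta.
    destruct (Up q) as [p u v r]; simpl in E1, E2, E3, E4. rewrite E1, E2, E3, E4. reflexivity.
Qed.
End Wedge.

Theorem theorem2p3
  (gamma p0 u0 rho0 thetaW pstar pstrong : R)
  (f : R -> R) (Um Up : R * R -> state)
  (Hgamma : 1 < gamma)
  (Hp0 : 0 < p0) (Hu0 : 0 < u0) (Hrho0 : 0 < rho0)
  (HM0 : 1 < mach0 gamma p0 u0 rho0)
  (Htheta : 0 < thetaW < PI / 2)
  (Hpstar : is_pstar gamma p0 u0 rho0 pstar)
  (Htan : 0 < tan thetaW <= polar gamma p0 u0 rho0 pstar)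
  (Hpstrong : is_pstrong gamma p0 u0 rho0 thetaW pstar pstrong)
  (Hsol : transonic_shock_solution gamma p0 u0 rho0 thetaW f Um Up)
  (Hu : forall q, closure (behind thetaW f) q -> 0 < velx (Up q))
  (Hinf : slope_tends_at_infinity
            (fun q => behind thetaW f q \/ shock f q) Up (tan thetaW))
  (HOw : slope (Up origin) = tan thetaW)
  (HOp : pres (Up origin) = pstrong) :
  is_strong_solution gamma p0 u0 rho0 thetaW pstrong f Um Up.
Proof.
  exact (strong_solution thetaW f Htheta (tss_profile _ _ _ _ _ _ _ _ Hsol) gamma p0 u0 rho0 Um Up
    Hgamma Hp0 Hu0 Hrho0 HM0 Hsol Hu pstar pstrong Hpstar Hpstrong Hinf HOw HOp).
Qed.
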